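(* Let $d\ge 2$, let $G\subset O(d)$ be a finite reflection group with root system $\mathcal{R}$, normalized so that $\langle v,v\rangle=2$ for all $v\in\mathcal{R}$, let $\mathcal{R}_+$ be a positive subsystem, let $\kappa:\mathcal{R}\to[0,\infty)$ be a $G$-invariant function, and let $h_\kappa(x)=\prod_{v\in\mathcal{R}_+}|\langle x,v\rangle|^{\kappa_v}$. Then there is a constant $C_{d,\kappa}>0$, depending only on $d$ and $\kappa$, such that for every real-valued $f\in C^1(\mathbb{S}^{d-1})$ with $\int_{\mathbb{S}^{d-1}} f(x)h_\kappa^2(x)\,d\sigma(x)=0$ and $\int_{\mathbb{S}^{d-1}}|f(x)|^2h_\kappa^2(x)\,d\sigma(x)=1$, $$\left[\min_{y\in\mathbb{S}^{d-1}}\int_{\mathbb{S}^{d-1}}(1-\langle x,y\rangle)|f(x)|^2h_\kappa^2(x)\,d\sigma(x)\right]\left[\int_{\mathbb{S}^{d-1}}\left|\sqrt{-\Delta_{\kappa,0}}\,f(x)\right|^2h_\kappa^2(x)\,d\sigma(x)\right]\ge C_{d,\kappa}.$$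
   Context: $\mathbb{S}^{d-1}=\{x\in\mathbb{R}^d:\|x\|=1\}$, with $d\sigma$ the usual rotation-invariant surface (Haar) measure; $\langle\cdot,\cdot\rangle$ and $\|\cdot\|$ are the Euclidean inner product and norm. For $v\ne0$, $\sigma_v x=x-\frac{2\langle x,v\rangle}{\|v\|^2}v$. The root system $\mathcal{R}$ of $G$ satisfies $\mathcal{R}=\mathcal{R}_+\cup(-\mathcal{R}_+)$, and the reflections in $G$ are exactly $\{\sigma_v:v\in\mathcal{R}_+\}$; these generate $G$. Write $\kappa_v=\kappa(v)$, $|\kappa|=\sum_{v\in\mathcal{R}_+}\kappa_v$ and $\lambda_\kappa=\frac{d-2}{2}+|\kappa|$. Dunkl operators: $\mathcal{D}_i f(x)=\partial_i f(x)+\sum_{v\in\mathcal{R}_+}\kappa_v\langle v,e_i\rangle\frac{f(x)-f(\sigma_v x)}{\langle x,v\rangle}$, $1\le i\le d$, where $e_i$ is the $i$th standard basis vector. The $\kappa$-Laplacian is $\Delta_\kappa=\sum_{j=1}^d\mathcal{D}_j^2$, and the Dunkl–Laplace–Beltrami operator is $\Delta_{\kappa,0}f(x)=\Delta_\kappa F(z)|_{z=x}$ for $x\in\mathbb{S}^{d-1}$, where $F(z)=f(z/\|z\|)$. Let $\Pi_n^d$ be the space of restrictions to $\mathbb{S}^{d-1}$ of polynomials of degree at most $n$, and let $\mathcal{H}_n^d(h_\kappa^2)$ (spherical $h$-harmonics of degree $n$) be the orthogonal complement of $\Pi_{n-1}^d$ in $\Pi_n^d$ with respect to $\langle f,g\rangle_\kappa=\int_{\mathbb{S}^{d-1}}f\overline{g}\,h_\kappa^2\,d\sigma$.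 Then $\mathcal{H}_n^d(h_\kappa^2)$ is an eigenspace of $\Delta_{\kappa,0}$ with eigenvalue $-n(n+2\lambda_\kappa)$. Let $\mathrm{proj}_n(h_\kappa^2;\cdot)$ be the orthogonal projection of $L^2(h_\kappa^2;\mathbb{S}^{d-1})$ onto $\mathcal{H}_n^d(h_\kappa^2)$. The operator $\sqrt{-\Delta_{\kappa,0}}=(-\Delta_{\kappa,0})^{1/2}$ is defined in the distributional sense by $\mathrm{proj}_n(h_\kappa^2;(-\Delta_{\kappa,0})^{1/2}f)=(n(n+2\lambda_\kappa))^{1/2}\mathrm{proj}_n(h_\kappa^2;f)$ for $n=0,1,2,\dots$. *)

(* Defs.v *)
From HB Require Import structures.
From mathcomp Require Import all_boot all_order all_algebra finmap.
From mathcomp Require Import all_classical all_reals all_analysis.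
From mathcomp Require mpoly.

Set Implicit Arguments.
Unset Strict Implicit.
Unset Printing Implicit Defensive.

(* The notations of mpoly clash with those of MathComp-Analysis. *)
Import -(notations) mpoly.
Import Order.TTheory GRing.Theory Num.Theory numFieldNormedType.Exports.

Local Open Scope classical_set_scope.
Local Open Scope ring_scope.

Section Euclidean.
Context {R : realType} {d : nat}.
Implicit Types x y u v z : 'rV[R]_d.

Definition dot x y : R := \sum_(i < d) x 0 i * y 0 i.

(* The library norm of 'rV[R]_d is the sup norm. *)
Definition enorm x : R := Num.sqrt (dot x x).

Definition sphere : set 'rV[R]_d := [set x | enorm x = 1].

(* A function on the sphere is represented by a function on 'rV[R]_d of which
   only the values on the sphere matter. *)
Definition homogeneous_ext (f : 'rV[R]_d -> R) z : R := f ((enorm z)^-1 *: z).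

Definition C1_sphere (f : 'rV[R]_d -> R) : Prop :=
  forall z, z != 0 ->
    differentiable (homogeneous_ext f) z /\
    forall v, {for z, continuous ('D_v (homogeneous_ext f))}.

Definition reflection v x : 'rV[R]_d := x - (2 * dot x v / dot v v) *: v.

(* Matrices act on row vectors on the right: x *m reflection_mx v is
   reflection v x. *)
Definition reflection_mx v : 'M[R]_d := lin1_mx (reflection v).

Definition orthogonal_mx (Q : 'M[R]_d) : Prop := Q *m Q^T = 1%:M.

Definition orthogonal_subgroup (G : set 'M[R]_d) : Prop :=
  [/\ forall Q, G Q -> orthogonal_mx Q,
      G 1%:M,
      forall P Q, G P -> G Q -> G (P *m Q) &
      forall Q, G Q -> G (invmx Q)].

Definition root_system (Phi : {fset 'rV[R]_d}) : Prop :=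
  [/\ 0 \notin Phi,
      forall u v, u \in Phi -> v \in Phi -> reflection v u \in Phi &
      forall (v : 'rV[R]_d) (c : R),
        v \in Phi -> c *: v \in Phi -> c = 1 \/ c = -1].

Definition reflection_group (G : set 'M[R]_d) (Phi : {fset 'rV[R]_d}) : Prop :=
  [/\ orthogonal_subgroup G /\ finite_set G,
      root_system Phi,
      forall v, v != 0 ->
        G (reflection_mx v) <->
        (exists2 u, u \in Phi & reflection_mx v = reflection_mx u) &
      forall H : set 'M[R]_d, orthogonal_subgroup H ->
        (forall v, v \in Phi -> H (reflection_mx v)) -> G `<=` H].

Definition positive_subsystem (Phi Rp : {fset 'rV[R]_d}) : Prop :=
  exists u, (forall v, v \in Phi -> dot u v != 0) /\
    forall v, (v \in Rp) = (v \in Phi) && (0 < dot u v).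

Definition multiplicity (G : set 'M[R]_d) (Phi : {fset 'rV[R]_d})
    (kappa : 'rV[R]_d -> R) : Prop :=
  (forall v, v \in Phi -> 0 <= kappa v) /\
  (forall v Q, v \in Phi -> G Q -> kappa (v *m Q) = kappa v).

Definition weight (Rp : {fset 'rV[R]_d}) (kappa : 'rV[R]_d -> R) x : R :=
  \prod_(v <- Rp) `|dot x v| `^ kappa v.

Definition lambda_kappa (Rp : {fset 'rV[R]_d}) (kappa : 'rV[R]_d -> R) : R :=
  (d%:R - 2) / 2 + \sum_(v <- Rp) kappa v.

(* sphere_poly n holds of the restrictions to the sphere of the polynomials of
   degree < n: msize is degree + 1, and msize 0 = 0.  Hence the space of
   polynomials of degree at most n is sphere_poly n.+1, and sphere_poly 0 is
   the zero space. *)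
Definition sphere_poly (n : nat) (f : 'rV[R]_d -> R) : Prop :=
  exists p : mpoly.mpoly d R, (mpoly.msize p <= n)%N /\
    forall x, sphere x -> f x = mpoly.meval (fun i => x 0 i) p.

End Euclidean.

Arguments sphere R d : clear implicits.

Notation rV_borel R d := (g_sigma_algebraType (@open 'rV[R]_d)).

Section SphericalHarmonics.
Context {R : realType} {d : nat}.
Variable sigma : {measure set (rV_borel R d) -> \bar R}.

(* These conditions determine sigma on the sphere up to a positive constant
   factor, i.e. up to the normalization of the surface measure. *)
Definition surface_measure : Prop :=
  (0 < sigma (sphere R d) < +oo)%E /\
  forall (Q : 'M[R]_d) (A : set (rV_borel R d)), orthogonal_mx Q ->
    measurable A -> A `<=` sphere R d ->
    sigma [set x *m Q | x in A] = sigma A.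

(* Instantiated with the weight h_kappa. *)
Variable h : 'rV[R]_d -> R.
Implicit Types f g Y Z : 'rV[R]_d -> R.

Definition weighted_int f : R :=
  \int[sigma]_(x in sphere R d) (f x * h x ^+ 2).

Definition inner f g : R := weighted_int (fun x => f x * g x).

Definition in_L2 f : Prop :=
  measurable_fun (sphere R d : set (rV_borel R d)) (f : rV_borel R d -> R) /\
  (\int[sigma]_(x in sphere R d) (`|f x| ^+ 2 * h x ^+ 2)%:E < +oo)%E.

Definition h_harmonic (n : nat) Y : Prop :=
  sphere_poly n.+1 Y /\ forall Z, sphere_poly n Z -> inner Y Z = 0.

Definition is_proj (n : nat) f Y : Prop :=
  h_harmonic n Y /\
  forall Z, h_harmonic n Z -> inner (fun x => f x - Y x) Z = 0.

(* g represents (-Delta)^(1/2) f, where -Delta has the eigenvalue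
   n (n + 2 lambda) on the h-harmonics of degree n. *)
Definition is_sqrt_laplace (lambda : R) f g : Prop :=
  in_L2 g /\
  forall n : nat, exists2 Y, is_proj n f Y &
    is_proj n g (fun x => Num.sqrt (n%:R * (n%:R + 2 * lambda)) * Y x).

(* is_sqrt_laplace determines g up to equality sigma-almost everywhere on the
   sphere; the value 0 is a default when f has no image in L^2. *)
Definition sqrt_laplace (lambda : R) f : 'rV[R]_d -> R :=
  xget (fun=> 0) (is_sqrt_laplace lambda f).

End SphericalHarmonics.

Definition is_minimum {T : Type} {R : realType} (A : set T) (F : T -> R)
    (m : R) : Prop :=
  (exists2 y, A y & F y = m) /\ forall y, A y -> m <= F y.

(* Main.v *)
Require Import Defs.
From HB Require Import structures.
From mathcomp Require Import all_boot all_order all_algebra finmap.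
From mathcomp Require Import all_classical all_reals all_analysis.
From mathcomp Require Import measurable_realfun.
From mathcomp Require mpoly.
From mathcomp Require Import ring lra zify.

(** Write [w] for [h_kappa ^ 2], the product of [|<x, u>| ^ kappa u] over all
    roots [u], and [K] for the sum of [kappa] over all roots, so that [2 * lambda]
    is [d - 2 + K].

    The theorem comes from a local Heisenberg inequality. On polynomials,
    [- Delta_{kappa,0}] is the operator [dunkl_op], and [green] shows that it is
    symmetric for [w] with the quadratic form
      [E(p, p) = W (sum over i < j of (D_ij p) ^ 2
                    + 1/2 sum over u of kappa u ((p - p o s_u) / <x, u>) ^ 2)]
    where [W] is the integral against [w], [D_ij] is the derivative along the
    rotations of a coordinate plane, and [s_u] is the reflection of [u]. The
    formula is the infinitesimal form of the rotation invariance of the surface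
    measure, applied to a smooth approximation of the weight. The linear form
    [<x, y>] is an eigenvector with eigenvalue [d - 1 + K], hence
      [(d - 1 + K) W (p ^ 2 <x, y>) = E(p ^ 2, <., y>)].
    If [p ^ 2] is concentrated near [y], that is, if its dispersion
    [m = W ((1 - <x, y>) p ^ 2)] is small, then the left-hand side is nearly
    [d - 1 + K] times the mass of [p ^ 2]. On the right-hand side the gradient
    part is at most [tau E(p, p) + 2 m / tau]. The contribution of the walls is
    not small, but by [wall_difference_le] it exceeds [K] times the mass at most by
    half of the mass and by terms of the same kind as for the gradient. Since
    [d - 1 >= 1], half of the mass remains on the left, which is [heisenberg]; the
    choice of [tau] turns it into a lower bound for [m E(p, p)], which is the core
    of [uncertainty].

    The passage from polynomials to a C1 function [f] goes through the expansion
    in h-harmonics. As [dunkl_op] is symmetric and acts on degree [n] as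
    [mu n = n (n + 2 lambda)] up to lower degrees, the energy of a partial sum of
    the expansion is the sum of [mu n] times the squared norms of the harmonic
    parts ([energy_partial_sum]), which is at most the squared norm of the square
    root of the operator applied to [f]. The same identity gives the spectral gap
    that is used when [f] is not concentrated.

    It remains to see that the square root of the operator maps [f] to an L2
    function, and that the harmonics are complete. A C1 function is Lipschitz
    ([C1_sphere_lipschitz]). Convolution with the kernels [(1 + <x, y>) ^ N]
    approximates it uniformly by polynomials whose Lipschitz constants, and hence
    energies, stay bounded ([lipschitz_approximation], [energy_lipschitz_le]).
    Bessel's inequality for the energy then bounds the sum of [mu n] times the
    squared norms of the harmonic parts of [f], and the completeness of the
    weighted L2 space ([riesz_fischer]) gives the function ([sqrt_laplace_ex]).
    The minimum over [y] is attained because the dispersion is affine in [y]. *)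

Set Implicit Arguments.
Unset Strict Implicit.
Unset Printing Implicit Defensive.

Import -(notations) mpoly.
Import Order.TTheory GRing.Theory Num.Theory numFieldNormedType.Exports.

Local Open Scope classical_set_scope.
Local Open Scope ring_scope.

(** * Euclidean geometry of the sphere *)

Section EuclideanGeometry.
Context {R : realType} {d : nat}.
Implicit Types (x y u v : 'rV[R]_d) (Q : 'M[R]_d) (c : R).

Lemma dotC x y : dot x y = dot y x.
Proof. by apply: eq_bigr => i _; rewrite mulrC. Qed.

Lemma dotDl x y u : dot (x + y) u = dot x u + dot y u.
Proof. by rewrite -big_split; apply: eq_bigr => i _; rewrite mxE mulrDl. Qed.

Lemma dotZl c x y : dot (c *: x) y = c * dot x y.
Proof. by rewrite mulr_sumr; apply: eq_bigr => i _; rewrite mxE mulrA. Qed.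

Lemma dotNl x y : dot (- x) y = - dot x y.
Proof. by rewrite -scaleN1r dotZl mulN1r. Qed.

Lemma dotBl x y u : dot (x - y) u = dot x u - dot y u.
Proof. by rewrite dotDl dotNl. Qed.

Lemma dotDr x y u : dot u (x + y) = dot u x + dot u y.
Proof. by rewrite dotC dotDl !(dotC u). Qed.

Lemma dotZr c x y : dot x (c *: y) = c * dot x y.
Proof. by rewrite dotC dotZl dotC. Qed.

Lemma dotNr x y : dot x (- y) = - dot x y.
Proof. by rewrite dotC dotNl dotC. Qed.

Lemma dotBr x y u : dot u (x - y) = dot u x - dot u y.
Proof. by rewrite dotDr dotNr. Qed.

Definition dotE := (dotDl, dotDr, dotBl, dotBr, dotZl, dotZr, dotNl, dotNr).

Lemma dot_ge0 x : 0 <= dot x x.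
Proof. by apply: sumr_ge0 => i _; rewrite -expr2 sqr_ge0. Qed.

Lemma dot_eq0 x : (dot x x == 0) = (x == 0).
Proof.
apply/eqP/eqP => [/eqP|->]; last first.
  by rewrite /dot big1// => i _; rewrite !mxE mul0r.
rewrite psumr_eq0 => [/allP x0|i _]; last by rewrite -expr2 sqr_ge0.
apply/rowP => i; rewrite mxE; apply/eqP.
by have := x0 i (mem_index_enum _); rewrite /= -expr2 sqrf_eq0.
Qed.

Lemma dot_cauchy_schwarz x y : dot x y ^+ 2 <= dot x x * dot y y.
Proof.
have [y0|y0] := eqVneq y 0.
  have z0 z : dot z (0 : 'rV[R]_d) = 0.
    by rewrite -(scale0r (0 : 'rV[R]_d)) dotZr mul0r.
  by rewrite y0 !z0 mulr0 expr0n.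
have yy : 0 < dot y y by rewrite lt_def dot_ge0 dot_eq0 y0.
have := dot_ge0 (dot y y *: x - dot x y *: y).
rewrite !dotE (dotC y x) => h.
rewrite -subr_ge0 -(pmulr_rge0 _ yy); move: h; congr (0 <= _); ring.
Qed.

Lemma sphereE x : sphere R d x <-> dot x x = 1.
Proof.
rewrite /sphere /enorm /=; split => [h|->]; last by rewrite sqrtr1.
by rewrite -(sqr_sqrtr (dot_ge0 x)) h expr1n.
Qed.

Lemma dot_sphere_le x y : sphere R d x -> sphere R d y -> `|dot x y| <= 1.
Proof.
move=> /sphereE x1 /sphereE y1; have := dot_cauchy_schwarz x y; rewrite x1 y1 mulr1.
by rewrite -real_normK ?num_real// expr_le1 ?normr_ge0.
Qed.

Lemma orthogonal_dot Q x y : orthogonal_mx Q -> dot (x *m Q) (y *m Q) = dot x y.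
Proof.
have dotmx u v : dot u v = (u *m v^T) 0 0.
  by rewrite mxE; apply: eq_bigr => i _; rewrite mxE.
by move=> oQ; rewrite !dotmx trmx_mul mulmxA -(mulmxA x) oQ mulmx1.
Qed.

Lemma orthogonal_unit Q : orthogonal_mx Q -> Q \in unitmx.
Proof. by move=> /mulmx1_unit[]. Qed.

Lemma orthogonal_mul P Q :
  orthogonal_mx P -> orthogonal_mx Q -> orthogonal_mx (P *m Q).
Proof.
rewrite /orthogonal_mx => oP oQ.
by rewrite trmx_mul mulmxA -(mulmxA P) oQ mulmx1.
Qed.

Lemma sphere_orthogonal Q x : orthogonal_mx Q ->
  sphere R d (x *m Q) <-> sphere R d x.
Proof. by move=> oQ; rewrite !sphereE orthogonal_dot. Qed.

Lemma orthogonal_mxP Q :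
  (forall x y, dot (x *m Q) (y *m Q) = dot x y) -> orthogonal_mx Q.
Proof.
move=> h; apply/matrixP => i j.
have := h (delta_mx 0 i) (delta_mx 0 j); rewrite -!rowE /dot => e.
rewrite mxE [RHS]mxE.
transitivity (\sum_j0 (row i Q) 0 j0 * (row j Q) 0 j0).
  by apply: eq_bigr => k _; rewrite !mxE.
rewrite e (bigD1 i)//= !mxE !eqxx/= mul1r big1 ?addr0 1?eq_sym// => k /negPf ki.
by rewrite !mxE ki andbF mul0r.
Qed.

Fact reflection_is_linear v : linear (reflection v).
Proof.
move=> c x y; rewrite /reflection !dotE scalerBr addrACA -opprD; congr (_ - _).
by rewrite scalerA -scalerDl; congr (_ *: _); rewrite mulrDr mulrDl !mulrA (mulrC c 2).
Qed.

Lemma mul_reflection_mx v x : x *m reflection_mx v = reflection v x.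
Proof.
pose f := GRing.isLinear.Build R _ _ _ (reflection v) (reflection_is_linear v).
pose F : {linear 'rV[R]_d -> 'rV[R]_d} := HB.pack (reflection v) f.
exact: (mul_rV_lin1 F).
Qed.

Lemma dot_reflection v x y :
  dot v v != 0 -> dot (reflection v x) (reflection v y) = dot x y.
Proof.
move=> v0; rewrite /reflection !dotE (dotC v y); field.
by rewrite v0.
Qed.

Lemma orthogonal_reflection v : dot v v != 0 -> orthogonal_mx (reflection_mx v).
Proof.
by move=> v0; apply: orthogonal_mxP => x y; rewrite !mul_reflection_mx dot_reflection.
Qed.

Lemma sqr_coord_le x (i : 'I_d) : x 0 i ^+ 2 <= dot x x.
Proof.
rewrite /dot (bigD1 i)//= -expr2 lerDl sumr_ge0// => j _.
by rewrite -expr2 sqr_ge0.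
Qed.

Lemma enorm_ge0 x : 0 <= enorm x.
Proof. exact: sqrtr_ge0. Qed.

Lemma enorm_sqr x : enorm x ^+ 2 = dot x x.
Proof. by rewrite sqr_sqrtr// dot_ge0. Qed.

Lemma enorm_le x y c : 0 <= c -> dot x x <= c ^+ 2 * dot y y -> enorm x <= c * enorm y.
Proof.
move=> c0 h; rewrite -(@ler_pXn2r _ 2)// ?nnegrE ?mulr_ge0 ?enorm_ge0//.
by rewrite exprMn !enorm_sqr.
Qed.

End EuclideanGeometry.

(** * Bounded measurable functions and integrals over the sphere *)

Section SphereIntegral.
Context {R : realType} {d : nat}.
Implicit Types (x y : 'rV[R]_d) (Q : 'M[R]_d) (c : R) (f g : 'rV[R]_d -> R).

Let T := rV_borel R d.
Let S : set T := sphere R d.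

Lemma borel_continuous_measurable (g : 'rV[R]_d -> 'rV[R]_d) :
  continuous g -> measurable_fun [set: T] (g : T -> T).
Proof.
move=> cg; apply: (@measurability _ _ T T setT g (@open 'rV[R]_d)) => //.
move=> _ [B oB <-]; rewrite setTI; apply: sub_sigma_algebra.
exact: (open_comp (fun x _ => cg x)).
Qed.

Lemma borel_continuous_on_measurable (U : set 'rV[R]_d) (f : 'rV[R]_d -> R) :
  open U -> (forall x, U x -> {for x, continuous f}) ->
  measurable_fun (U : set T) (f : T -> R).
Proof.
move=> oU cf; apply: (measurability (@RGenOpens.G R)).
  exact: RGenOpens.measurableE.
move=> _ [_ [a [b ->]] <-]; apply: sub_sigma_algebra.
rewrite openE => x [Ux fx]; apply: filterI.
  by apply: open_nbhs_nbhs.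
apply: cf => //; apply: open_nbhs_nbhs; split => //; exact: interval_open.
Qed.

Lemma borel_coord_measurable i : measurable_fun [set: T] (fun x : T => (x : 'rV[R]_d) 0 i).
Proof.
apply: (@borel_continuous_on_measurable setT (fun x => x 0 i)); first exact: openT.
by move=> x _; exact: coord_continuous.
Qed.

Lemma measurable_sphere : measurable S.
Proof.
have m : measurable_fun [set: T] (fun x : T => dot (x : 'rV[R]_d) x).
  by apply: measurable_sum => i; apply: measurable_funM; exact: borel_coord_measurable.
rewrite (_ : S = setT `&` (fun x : T => dot (x : 'rV[R]_d) x) @^-1` [set 1]).
  exact: m.
by apply/seteqP; split => x /=; [move/sphereE|move=> [_ ?]; exact/sphereE].
Qed.

(** Apart from general L2 functions, the integrands below are polynomial
    expressions in functions of this kind, so that the closure lemmas replace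
    integrability arguments. *)
Definition bounded_measurable f :=
  measurable_fun S (f : T -> R) /\ exists M, forall x, S x -> `|f x| <= M.
Local Notation bm := bounded_measurable.

Lemma eq_bm f g : (forall x, S x -> f x = g x) -> bm f -> bm g.
Proof.
move=> fg [mf [M fM]]; split; last by exists M => x Sx; rewrite -fg// fM.
by apply: eq_measurable_fun mf => x /set_mem; exact: fg.
Qed.

Lemma bm_cst c : bm (fun=> c).
Proof. by split => //; exists `|c|. Qed.

Lemma bmD f g : bm f -> bm g -> bm (fun x => f x + g x).
Proof.
move=> [mf [M fM]] [mg [N gN]]; split; first exact: measurable_funD.
exists (M + N) => x Sx; rewrite (le_trans (ler_normD _ _))//.
by rewrite lerD ?fM ?gN.
Qed.

Lemma bmM f g : bm f -> bm g -> bm (fun x => f x * g x).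
Proof.
move=> [mf [M fM]] [mg [N gN]]; split; first exact: measurable_funM.
by exists (M * N) => x Sx; rewrite normrM ler_pM ?fM ?gN.
Qed.

Lemma bmZ c f : bm f -> bm (fun x => c * f x).
Proof. by move=> bf; apply: bmM => //; exact: bm_cst. Qed.

Lemma bmN f : bm f -> bm (fun x => - f x).
Proof.
by move=> bf; apply: (eq_bm _ (bmZ (-1) bf)) => x _; rewrite mulN1r.
Qed.

Lemma bmB f g : bm f -> bm g -> bm (fun x => f x - g x).
Proof. by move=> bf bg; apply: bmD => //; exact: bmN. Qed.

Lemma bmX f n : bm f -> bm (fun x => f x ^+ n).
Proof.
move=> bf; elim: n => [|n ih]; first exact: bm_cst.
by apply: (eq_bm _ (bmM bf ih)) => x _; rewrite exprS.
Qed.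

Lemma bm_norm f : bm f -> bm (fun x => `|f x|).
Proof.
move=> [mf [M fM]]; split; first exact: measurableT_comp.
by exists M => x Sx; rewrite normr_id fM.
Qed.

Lemma bm_sum (I : Type) (r : seq I) (F : I -> 'rV[R]_d -> R) :
  (forall i, bm (F i)) -> bm (fun x => \sum_(i <- r) F i x).
Proof.
move=> bF; elim: r => [|i r ih].
  by apply: (eq_bm _ (bm_cst 0)) => x _; rewrite big_nil.
by apply: (eq_bm _ (bmD (bF i) ih)) => x _; rewrite big_cons.
Qed.

Lemma sphere_coord_le x i : sphere R d x -> `|x 0 i| <= 1.
Proof.
move=> /sphereE x1; rewrite -(@expr_le1 _ 2)// real_normK ?num_real//.
by rewrite -x1 sqr_coord_le.
Qed.

Lemma bm_coord i : bm (fun x => x 0 i).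
Proof.
split; first by apply: measurable_funTS; exact: borel_coord_measurable.
by exists 1 => x; exact: sphere_coord_le.
Qed.

Lemma bm_dot y : bm (fun x => dot x y).
Proof. by apply: bm_sum => i; apply: bmM; [exact: bm_coord|exact: bm_cst]. Qed.

Lemma continuous_coord (g : 'rV[R]_d -> 'rV[R]_d) :
  (forall j, continuous (fun x => g x 0 j)) -> continuous g.
Proof.
move=> h x; apply/(@cvg_ballP _ _ _ _ (nbhs_filter x)) => e e0.
have H j : \forall y \near x, ball (g x 0 j) e (g y 0 j).
  by have /(@cvg_ballP _ _ _ _ (nbhs_filter x))/(_ _ e0) := h j x.
apply: filterS (@filter_forall _ _ _ _ (nbhs_filter x) H) => y yH; split => // i j.
by rewrite !ord1; exact: yH.
Qed.

Lemma mulmx_continuous Q : continuous (fun x : 'rV[R]_d => x *m Q).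
Proof.
apply: continuous_coord => j.
rewrite (_ : (fun _ => _) = fun y => \sum_(k < d) y 0 k * Q k j); last first.
  by apply/funext => y; rewrite mxE.
apply: continuous_big => [|k _ y]; first exact: add_continuous.
apply: (@continuousM _ _ (fun y : 'rV[R]_d => y 0 k) (fun=> Q k j)).
  exact: coord_continuous.
exact: cst_continuous.
Qed.

Lemma measurable_mulmx Q :
  measurable_fun [set: T] ((fun x : 'rV[R]_d => x *m Q) : T -> T).
Proof. by apply: borel_continuous_measurable; exact: mulmx_continuous. Qed.

Lemma bm_mulmx Q f : orthogonal_mx Q -> bm f -> bm (fun x => f (x *m Q)).
Proof.
move=> oQ [mf [M fM]]; split; last first.
  by exists M => x Sx; apply/fM/sphere_orthogonal.
apply: (measurable_comp measurable_sphere _ mf).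
  by move=> _ [x Sx <-]; exact/sphere_orthogonal.
by apply: measurable_funTS; exact: measurable_mulmx.
Qed.

Variable sigma : {measure set T -> \bar R}.
Hypothesis sigmaP : surface_measure sigma.

Definition sphere_int f : R := \int[sigma]_(x in S) f x.
Local Notation I := sphere_int.

Lemma sigma_fin : (sigma S < +oo)%E.
Proof. by case: sigmaP => /andP[]. Qed.

Lemma bm_integrable f : bm f -> sigma.-integrable S (EFin \o f).
Proof.
move=> [mf [M fM]]; apply: measurable_bounded_integrable => //.
- exact: measurable_sphere.
- exact: sigma_fin.
- exists M; split; first exact: num_real.
  by move=> N MN x Sx /=; rewrite (le_trans (fM _ Sx))// ltW.
Qed.

Lemma eq_sphere_int f g : (forall x, S x -> f x = g x) -> I f = I g.
Proof. by move=> fg; apply: eq_Rintegral => x /set_mem; exact: fg. Qed.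

Lemma sphere_intD f g : bm f -> bm g -> I (fun x => f x + g x) = I f + I g.
Proof.
by move=> bf bg; apply: RintegralD => //; do ?exact: measurable_sphere; exact: bm_integrable.
Qed.

Lemma sphere_intB f g : bm f -> bm g -> I (fun x => f x - g x) = I f - I g.
Proof.
by move=> bf bg; apply: RintegralB => //; do ?exact: measurable_sphere; exact: bm_integrable.
Qed.

Lemma sphere_intZ c f : bm f -> I (fun x => c * f x) = c * I f.
Proof.
by move=> bf; apply: RintegralZl => //; do ?exact: measurable_sphere; exact: bm_integrable.
Qed.

Lemma sphere_int_cst c : I (fun=> c) = c * fine (sigma S).
Proof. by apply: Rintegral_cst; exact: measurable_sphere. Qed.

Lemma sphere_int_sum (J : Type) (r : seq J) (F : J -> 'rV[R]_d -> R) :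
  (forall i, bm (F i)) -> I (fun x => \sum_(i <- r) F i x) = \sum_(i <- r) I (F i).
Proof.
move=> bF; elim: r => [|i r ih].
  by rewrite big_nil -[RHS](mul0r (fine (sigma S))) -sphere_int_cst; apply: eq_sphere_int => x _; rewrite big_nil.
rewrite big_cons -ih -sphere_intD//; last exact: bm_sum.
by apply: eq_sphere_int => x _; rewrite big_cons.
Qed.

Lemma le_sphere_int f g : bm f -> bm g -> (forall x, S x -> f x <= g x) -> I f <= I g.
Proof.
by move=> bf bg fg; apply: le_Rintegral => //; do ?exact: measurable_sphere; exact: bm_integrable.
Qed.

Lemma sphere_int_ge0 f : (forall x, S x -> 0 <= f x) -> 0 <= I f.
Proof. by move=> f0; apply: Rintegral_ge0. Qed.

Lemma sigma_gt0 : 0 < fine (sigma S).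
Proof. by apply: fine_gt0; case: sigmaP. Qed.

(** The invariance of [sigma] concerns the images of sets. An orthogonal matrix
    maps the sphere onto itself, so the push-forward of [sigma] agrees with
    [sigma] there, and the change of variables formula applies. *)
Lemma sphere_int_mulmx Q f : orthogonal_mx Q -> bm f -> I (fun x => f (x *m Q)) = I f.
Proof.
move=> oQ bf.
pose phi : T -> T := fun x : 'rV[R]_d => x *m Q.
have mphi : measurable_fun setT phi by exact: measurable_mulmx.
have phiS : phi @^-1` S = S.
  by apply/seteqP; split => x; [exact: (sphere_orthogonal x oQ).1|exact: (sphere_orthogonal x oQ).2].
pose F : T -> \bar R := EFin \o ((f : T -> R) \_ S).
have mF : measurable_fun setT F.
  apply/measurable_EFinP; apply/(measurable_restrictT _ measurable_sphere).
  by case: bf.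
have FE x : S x -> F x = (f x)%:E by move=> Sx; rewrite /F/= patchE mem_set.
have iF : sigma.-integrable (phi @^-1` S) (F \o phi).
  rewrite phiS; apply: eq_integrable (bm_integrable (bm_mulmx oQ bf)).
    exact: measurable_sphere.
  by move=> x /set_mem Sx /=; rewrite FE//; exact: (sphere_orthogonal x oQ).2.
have := integral_pushforward mphi mF iF measurable_sphere.
rewrite phiS => e.
rewrite /I /Rintegral; congr fine.
transitivity (\int[sigma]_(x in S) (F \o phi) x)%E.
  by apply: eq_integral => x /set_mem Sx /=; rewrite FE//; exact: (sphere_orthogonal x oQ).2.
rewrite -e; transitivity (\int[sigma]_(x in S) F x)%E; last first.
  by apply: eq_integral => x /set_mem Sx /=; rewrite FE.
apply: eq_measure_integral => A mA AS; rewrite /pushforward.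
have [_ inv] := sigmaP.
apply: etrans (esym (inv Q (phi @^-1` A) oQ _ _)) _.
- by rewrite -[X in measurable X]setTI; exact: mphi.
- by move=> x Ax; apply: (sphere_orthogonal x oQ).1; exact: AS Ax.
congr (sigma _); apply/seteqP; split => [_ [x Ax <-]//|y Ay].
have uQ := orthogonal_unit oQ.
by exists ((y : 'rV[R]_d) *m invmx Q); rewrite /phi/= mulmxKV.
Qed.

Lemma sphere_int_dominated_cvg (fk : nat -> 'rV[R]_d -> R) f M :
  (forall k, bm (fk k)) -> bm f -> (forall k x, S x -> `|fk k x| <= M) ->
  (forall x, S x -> fk ^~ x @ \oo --> f x) -> I (fk k) @[k --> \oo] --> I f.
Proof.
move=> bfk bf fkM cf.
have fin g : bm g -> (\int[sigma]_(x in S) (g x)%:E \is a fin_num)%E.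
  by move=> bg; apply: integrable_fin_num; [exact: measurable_sphere|exact: bm_integrable].
have [] := @dominated_convergence _ T R sigma S measurable_sphere
  (fun k => EFin \o fk k) (EFin \o f) (cst M%:E).
- by move=> k; apply/measurable_EFinP; case: (bfk k).
- by apply/measurable_EFinP; case: bf.
- by apply: aeW => x Sx; apply: cvg_EFin; [exact: nearW|exact: cf].
- exact: (bm_integrable (bm_cst M)).
- by apply: aeW => x k Sx; rewrite /= lee_fin fkM.
move=> _ _ h; apply: (@fine_cvg _ _ _ _ (fun k => \int[sigma]_(x in S) (fk k x)%:E)%E).
by rewrite /sphere_int /Rintegral fineK//; exact: fin.
Qed.

End SphereIntegral.

(** * Polynomials: rotational derivatives, divided differences and the Dunkl operator *)

Section PolynomialOperators.
Context {R : realType} {d : nat}.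
Implicit Types (x v : 'rV[R]_d) (p q r : mpoly d R) (c : R) (i j k : 'I_d).

Definition ev p x : R := meval (fun i => x 0 i) p.

Definition mvar i : mpoly d R := mpolyX R (mnm1 i).

Lemma evD p q x : ev (p + q) x = ev p x + ev q x. Proof. exact: mevalD. Qed.
Lemma evB p q x : ev (p - q) x = ev p x - ev q x. Proof. exact: mevalB. Qed.
Lemma evN p x : ev (- p) x = - ev p x. Proof. exact: mevalN. Qed.
Lemma evM p q x : ev (p * q) x = ev p x * ev q x. Proof. exact: mevalM. Qed.
Lemma evZ c p x : ev (c *: p) x = c * ev p x. Proof. exact: mevalZ. Qed.
Lemma ev0 x : ev 0 x = 0. Proof. exact: meval0. Qed.
Lemma ev1 x : ev 1 x = 1. Proof. exact: meval1. Qed.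
Lemma ev_var i x : ev (mvar i) x = x 0 i. Proof. exact: mevalXU. Qed.
Lemma evX p n x : ev (p ^+ n) x = ev p x ^+ n. Proof. exact: rmorphXn. Qed.
Lemma ev_sum (I : Type) (s : seq I) (F : I -> mpoly d R) x :
  ev (\sum_(i <- s) F i) x = \sum_(i <- s) ev (F i) x.
Proof. exact: raddf_sum. Qed.

Definition evE := (evD, evB, evN, evM, evZ, ev0, ev1, ev_var, evX, ev_sum).

Lemma msize_add n p q : (msize p <= n)%N -> (msize q <= n)%N -> (msize (p + q) <= n)%N.
Proof. by move=> hp hq; rewrite (leq_trans (msizeD_le _ _))// geq_max hp. Qed.

Lemma msize_scale n c p : (msize p <= n)%N -> (msize (c *: p) <= n)%N.
Proof. by move=> hp; rewrite (leq_trans (msizeZ_le _ _)). Qed.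

Lemma msize_opp n p : (msize p <= n)%N -> (msize (- p) <= n)%N.
Proof. by rewrite msizeN. Qed.

Lemma msize_sub n p q : (msize p <= n)%N -> (msize q <= n)%N -> (msize (p - q) <= n)%N.
Proof. by move=> hp hq; rewrite msize_add// msize_opp. Qed.

Lemma msize_bigsum (I : Type) (s : seq I) (F : I -> mpoly d R) n :
  (forall a, (msize (F a) <= n)%N) -> (msize (\sum_(a <- s) F a) <= n)%N.
Proof.
move=> h; elim: s => [|i s ih]; first by rewrite big_nil msize0.
by rewrite big_cons msize_add.
Qed.

Lemma msize_mul a b p q : (msize p <= a.+1)%N -> (msize q <= b.+1)%N ->
  (msize (p * q) <= (a + b).+1)%N.
Proof.
move=> hp hq; have [->|p0] := eqVneq p 0; first by rewrite mul0r msize0.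
have [->|q0] := eqVneq q 0; first by rewrite mulr0 msize0.
rewrite msizeM//; move: (leq_add hp hq); rewrite addSn addnS.
by case: (_ + _)%N => // n /ltnW.
Qed.

Lemma msize_var i : msize (mvar i) = 2%N.
Proof. by rewrite msizeX mdeg1. Qed.

Lemma msize_mulvar n i p : (msize p <= n)%N -> (msize (mvar i * p) <= n.+1)%N.
Proof.
have [->|p0] := eqVneq p 0; first by rewrite mulr0 msize0.
case: n => [|n hp]; first by rewrite leqn0 msize_poly_eq0 (negPf p0).
by rewrite (@msize_mul 1 n)// msize_var.
Qed.

(** The bound is an argument of the predicate because the facts proved in this
    way compare it with the degrees of other polynomials, such as derivatives
    and divided differences. *)
Lemma mpoly_degree_ind (Q : nat -> mpoly d R -> Prop) :
    (forall n, Q n 0) ->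
    (forall n c p q, Q n p -> Q n q -> Q n (c *: p + q)) ->
    (forall n p, Q n p -> Q n.+1 p) ->
    Q 1%N 1 ->
    (forall n i p, Q n.+1 p -> Q n.+2 (mvar i * p)) ->
  forall n p, (msize p <= n)%N -> Q n p.
Proof.
move=> Q0 QD QS Q1 QX n p.
have Qmono a b q : (a <= b)%N -> Q a q -> Q b q.
  by move=> /subnK <-; elim: (b - a)%N => // k ih /ih; exact: QS.
have Qm e (m : multinom d) : mdeg m = e -> Q e.+1 (mpolyX R m).
  elim: e m => [|e ih] m mk.
    by move/eqP : mk; rewrite mdeg_eq0 => /eqP ->; rewrite mpolyX0.
  have [i mi] : exists i, m i != 0%N.
    apply/existsP; rewrite -negb_forall; apply/negP => /forallP h.
    by move: mk; rewrite mdegE big1// => i _; apply/eqP; exact: h.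
  have le_im : lem (mnm1 i) m.
    by apply/mnm_lepP => j; rewrite mnm1E; case: eqP => // <-; rewrite lt0n.
  rewrite -(submK le_im) (@addmC d) mpolyXD; apply/QX/ih.
  have := congr1 (fun m => mdeg m) (submK le_im).
  by rewrite mdegD mdeg1 mk addn1 => -[].
move=> hp; rewrite (mpolyE p).
have : forall m, m \in msupp p -> Q n (mpolyX R m).
  move=> m /msize_mdeg_lt mp; apply: Qmono (Qm _ _ erefl).
  exact: leq_trans mp hp.
elim: (msupp p) => [|m s ih] h; first by rewrite big_nil.
rewrite big_cons; apply: QD; first by apply: h; rewrite mem_head.
by apply: ih => m' m's; apply: h; rewrite inE m's orbT.
Qed.

Lemma mderiv_var i j : mderiv i (mvar j) = (i == j)%:R.
Proof.
rewrite mderivX mnm1E eq_sym; case: eqP => [->|_]; last by rewrite scale0r.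
rewrite scale1r (_ : mnm_sub _ _ = mnm0) ?mpolyX0//.
by apply/mnmP => l; rewrite mnmBE mnm0E subnn.
Qed.

Lemma mderiv1 i : mderiv i (1 : mpoly d R) = 0.
Proof. by rewrite -mpolyC1 mderivC. Qed.

Lemma mderiv_varM i j p : mderiv i (mvar j * p) = (i == j)%:R * p + mvar j * mderiv i p.
Proof. by rewrite mderivM mderiv_var. Qed.

Lemma msize_mderiv n i p : (msize p <= n)%N -> (msize (mderiv i p) <= n.-1)%N.
Proof.
move=> hp; suff [] : (msize p <= n)%N /\ (msize (mderiv i p) <= n.-1)%N by [].
move: n p hp; apply: mpoly_degree_ind.
- by move=> n; rewrite mderiv0 msize0.
- move=> n c p q [p1 p2] [q1 q2]; rewrite mderivD mderivZ.
  by rewrite !msize_add ?msize_scale.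
- by move=> n p [p1 p2]; rewrite (leqW p1); split => //=; lia.
- by rewrite msize1 mderiv1 msize0.
- move=> n j p [p1 p2]; rewrite msize_mulvar//; split => //=.
  rewrite mderiv_varM msize_add ?msize_mulvar//.
  by case: eqP => _; rewrite ?mul1r// mul0r msize0.
Qed.

(** The derivative along the rotations of the plane of the coordinates [i] and
    [j]. *)
Definition rot_deriv i j p : mpoly d R := mvar i * mderiv j p - mvar j * mderiv i p.

Definition euler p : mpoly d R := \sum_i mvar i * mderiv i p.

Definition laplacian p : mpoly d R := \sum_i mderiv i (mderiv i p).

Definition sqnorm_poly : mpoly d R := \sum_i mvar i * mvar i.

Definition lin_poly v : mpoly d R := \sum_i v 0 i *: mvar i.

Lemma ev_lin v x : ev (lin_poly v) x = dot x v.
Proof. by rewrite evE; apply: eq_bigr => i _; rewrite !evE mulrC. Qed.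

Lemma ev_sqnorm x : ev sqnorm_poly x = dot x x.
Proof. by rewrite evE; apply: eq_bigr => i _; rewrite !evE. Qed.

Lemma msize_lin v : (msize (lin_poly v) <= 2)%N.
Proof. by apply: msize_bigsum => i; rewrite msize_scale// msize_var. Qed.

Lemma eulerD p q : euler (p + q) = euler p + euler q.
Proof. by rewrite -big_split; apply: eq_bigr => i _; rewrite mderivD mulrDr. Qed.

Lemma eulerZ c p : euler (c *: p) = c *: euler p.
Proof. by rewrite scaler_sumr; apply: eq_bigr => i _; rewrite mderivZ scalerAr. Qed.

Lemma euler_varM i p : euler (mvar i * p) = mvar i * (p + euler p).
Proof.
rewrite /euler mulrDr mulr_sumr (bigD1 i)//= [in RHS](bigD1 i)//=.
rewrite mderiv_varM eqxx mul1r mulrDr -!addrA; congr (_ + _).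
rewrite mulrCA; congr (_ + _); apply: eq_bigr => j /negPf ji.
by rewrite mderiv_varM ji mul0r add0r mulrCA.
Qed.

Lemma msize_euler n p : (msize p <= n)%N -> (msize (euler p) <= n)%N.
Proof.
case: n => [|n hp].
  rewrite leqn0 msize_poly_eq0 => /eqP ->.
  by rewrite /euler big1 ?msize0// => i _; rewrite mderiv0 mulr0.
by apply: msize_bigsum => i; apply/msize_mulvar/(msize_mderiv i hp).
Qed.

(** On homogeneous polynomials the Euler operator is multiplication by the
    degree. *)
Lemma euler_lower n p : (msize p <= n.+1)%N -> (msize (euler p - n%:R *: p) <= n)%N.
Proof.
move=> hp.
pose Q m p := (msize p <= m)%N /\
  (if m is m'.+1 then (msize (euler p - m'%:R *: p) <= m')%N else True).
suff [] : Q n.+1 p by [].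
have e0 : euler 0 = 0 by rewrite /euler big1// => i _; rewrite mderiv0 mulr0.
move: (n.+1) p hp => {n}; apply: mpoly_degree_ind.
- by move=> [|n]; split; rewrite ?msize0// e0 scaler0 subr0 msize0.
- move=> [|n] c p q [p1 p2] [q1 q2]; split => //=; try by rewrite msize_add ?msize_scale.
  rewrite eulerD eulerZ (_ : _ - _ = c *: (euler p - n%:R *: p) + (euler q - n%:R *: q)).
    by rewrite msize_add ?msize_scale.
  rewrite !scalerDr opprD !scalerN !scalerA (mulrC n%:R) addrACA; congr (_ + _).
- move=> [|n] p [p1 p2]; split => //=; rewrite ?(leqW p1)//.
    by move: p1; rewrite leqn0 msize_poly_eq0 => /eqP ->; rewrite e0 scaler0 subr0 msize0.
  rewrite -natr1 scalerDl scale1r opprD addrA msize_sub ?(leqW p2)//.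
- split; first by rewrite msize1.
  rewrite scale0r subr0.
  by rewrite /euler big1 ?msize0// => i _; rewrite mderiv1 mulr0.
- move=> n i p [p1 p2]; split; first by rewrite msize_mulvar.
  rewrite euler_varM (_ : _ - _ = mvar i * (euler p - n%:R *: p)) ?msize_mulvar//.
  by rewrite -natr1 scalerDl scale1r -!mul_mpolyC; ring.
Qed.

(** The Casimir operator of the rotations in terms of the Laplacian. The
    ordered pairs count each plane twice, hence the factor 2. *)
Lemma sum_sqr_rot_derivE p : \sum_i \sum_j rot_deriv i j (rot_deriv i j p) =
  2 *: (sqnorm_poly * laplacian p - euler (euler p) - (d%:R - 2) *: euler p).
Proof.
pose X := mvar; pose P i : mpoly d R := mderiv i p; pose H i j : mpoly d R := mderiv i (mderiv j p).
have HC i j : H i j = H j i by exact: mderiv_comm.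
have e1 i j : rot_deriv i j (rot_deriv i j p) =
   ((X i * X i) * H j j + (X j * X j) * H i i) - X i * P i - X j * P j
   + ((i == j)%:R * (X i * P j) + (i == j)%:R * (X j * P i))
   - (X i * (X j * H i j) + X i * (X j * H i j)).
  rewrite /X /P /H /rot_deriv !mderivB !mderiv_varM !eqxx (eq_sym j i).
  by rewrite (mderiv_comm i j) !mul1r; ring.
have es i (F : 'I_d -> mpoly d R) : \sum_j (i == j)%:R * F j = F i.
  rewrite (bigD1 i)//= eqxx mul1r big1 ?addr0// => j; rewrite eq_sym => /negPf ->.
  by rewrite mul0r.
have -> : euler (euler p) = euler p + \sum_i \sum_j X i * (X j * H i j).
  rewrite {1}/euler -big_split; apply: eq_bigr => i _ /=.
  rewrite -mulr_sumr -mulrDr /euler raddf_sum; congr (_ * _).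
  rewrite -[mderiv i p in RHS](es i P) -big_split; apply: eq_bigr => j _ /=.
  by rewrite mderiv_varM.
rewrite pair_big; under eq_bigr do rewrite e1.
rewrite !(big_split, sumrN)/=.
rewrite -!(pair_big xpredT xpredT (fun i j => X i * X i * H j j))/=.
rewrite -!(pair_big xpredT xpredT (fun i j => X j * X j * H i i))/=.
rewrite -!(pair_big xpredT xpredT (fun i j => X i * P i))/=.
rewrite -!(pair_big xpredT xpredT (fun i j => X j * P j))/=.
rewrite -!(pair_big xpredT xpredT (fun i j => (i == j)%:R * (X i * P j)))/=.
rewrite -!(pair_big xpredT xpredT (fun i j => (i == j)%:R * (X j * P i)))/=.
rewrite -!(pair_big xpredT xpredT (fun i j => X i * (X j * H i j)))/=.
have -> : \sum_i \sum_j X i * X i * H j j = sqnorm_poly * laplacian p.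
  by rewrite mulr_suml; apply: eq_bigr => i _; rewrite mulr_sumr.
have -> : \sum_i \sum_j X j * X j * H i i = sqnorm_poly * laplacian p.
  by rewrite exchange_big mulr_suml; apply: eq_bigr => i _; rewrite mulr_sumr.
have -> : \sum_(i < d) \sum_(j < d) X i * P i = d%:R *: euler p.
  rewrite scaler_sumr; apply: eq_bigr => i _.
  by rewrite sumr_const card_ord scaler_nat.
have -> : \sum_(i < d) \sum_(j < d) X j * P j = d%:R *: euler p.
  by rewrite sumr_const card_ord scaler_nat.
have -> : \sum_i \sum_j (i == j)%:R * (X i * P j) = euler p.
  by apply: eq_bigr => i _; rewrite es.
have -> : \sum_i \sum_j (i == j)%:R * (X j * P i) = euler p.
  by apply: eq_bigr => i _; rewrite (es i (fun j => X j * P i)).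
by rewrite scalerBl !scaler_nat; ring.
Qed.

(** The Laplace-Beltrami operator of the sphere, with the sign that makes it
    nonnegative. *)
Definition laplace_beltrami p : mpoly d R :=
  (- 2^-1) *: \sum_i \sum_j rot_deriv i j (rot_deriv i j p).

(** On the sphere the squared norm in [sum_sqr_rot_derivE] is 1. The Laplacian
    then lowers the degree, and the Euler operator gives the eigenvalue. *)
Lemma laplace_beltrami_lower n p : (msize p <= n.+1)%N -> exists2 q, (msize q <= n)%N &
  forall x, sphere R d x -> ev (laplace_beltrami p) x = n%:R * (n%:R + (d%:R - 2)) * ev p x + ev q x.
Proof.
move=> hp.
pose e := euler p - n%:R *: p.
exists (euler e + n%:R *: e + (d%:R - 2) *: e - laplacian p).
  have he : (msize e <= n)%N by exact: euler_lower.
  rewrite msize_sub ?msize_add ?msize_scale ?msize_euler//.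
  apply: msize_bigsum => i.
  exact: leq_trans (msize_mderiv i (msize_mderiv i hp)) (leq_pred _).
move=> x /sphereE x1.
rewrite /laplace_beltrami evZ sum_sqr_rot_derivE evZ !evB evM ev_sqnorm x1 mul1r.
have -> : euler e = euler (euler p) - n%:R *: euler p.
  by rewrite /e -scaleN1r eulerD !eulerZ scaleN1r.
by rewrite /e !evE; field.
Qed.

(** The reflection subtracts a multiple of [v] with the factor [<x, v>], so
    that the difference of [p] and its reflection is divisible by [<x, v>]. On
    the wall the quotient is the derivative along [v], so that a second
    division is possible. Both quotients are built one variable at a time. *)
Fact divided_difference_ex v n p : dot v v = 2 -> (msize p <= n)%N ->
  exists rs : mpoly d R * mpoly d R,
  [/\ (msize rs.1 <= n.-1)%N, (msize rs.2 <= n.-2)%N,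
    forall x, ev p x - ev p (reflection v x) = dot x v * ev rs.1 x &
    forall x, \sum_i v 0 i * ev (mderiv i p) x = dot x v * ev rs.2 x + ev rs.1 x].
Proof.
move=> v2 hp.
pose P n p (rs : mpoly d R * mpoly d R) := [/\ (msize rs.1 <= n.-1)%N, (msize rs.2 <= n.-2)%N,
    forall x, ev p x - ev p (reflection v x) = dot x v * ev rs.1 x &
    forall x, \sum_i v 0 i * ev (mderiv i p) x = dot x v * ev rs.2 x + ev rs.1 x].
suff [] : (msize p <= n)%N /\ exists rs, P n p rs by [].
move: n p hp; apply: mpoly_degree_ind.
- move=> n; rewrite msize0; split => //; exists (0, 0); split; rewrite ?msize0// => x.
    by rewrite !ev0 subrr mulr0.
  by rewrite big1 ?ev0 ?mulr0 ?addr0// => i _; rewrite mderiv0 ev0 mulr0.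
- move=> n c p q [hp [[r s] [/= r1 s1 r2 s2]]] [hq [[r' s'] [/= r1' s1' r2' s2']]].
  split; first by rewrite msize_add// msize_scale.
  exists (c *: r + r', c *: s + s'); split => /=.
  - by rewrite msize_add// msize_scale.
  - by rewrite msize_add// msize_scale.
  - move=> x; move: (r2 x) (r2' x); rewrite !evE => e e'.
    transitivity (c * (ev p x - ev p (reflection v x)) + (ev q x - ev q (reflection v x))).
      by ring.
    by rewrite e e'; ring.
  - move=> x; rewrite !evE.
    transitivity (c * (\sum_i v 0 i * ev (mderiv i p) x) + \sum_i v 0 i * ev (mderiv i q) x).
      by rewrite mulr_sumr -big_split; apply: eq_bigr => i _; rewrite mderivD mderivZ evD evZ mulrDr mulrCA.
    by rewrite s2 s2'; ring.
- move=> n p [hp [[r s] [/= r1 s1 r2 s2]]]; split; first exact: leqW.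
  exists (r, s); split => //=.
    by apply: leq_trans r1 _; rewrite leq_pred.
  by apply: leq_trans s1 _; rewrite -!subn1 leq_sub2r// leq_subr.
- rewrite msize1; split => //; exists (0, 0); split; rewrite ?msize0// => x.
    by rewrite !ev1 ev0 subrr mulr0.
  by rewrite big1 ?ev0 ?mulr0 ?addr0// => i _; rewrite mderiv1 ev0 mulr0.
- move=> n i p [hp [[r s] [/= r1 s1 r2 s2]]]; split; first by rewrite msize_mulvar.
  exists (mvar i * r + v 0 i *: (p - lin_poly v * r), mvar i * s + v 0 i *: r).
  have hlr : (msize (lin_poly v * r) <= n.+1)%N.
    case: n {hp s1} r1 => [|n] r1; last by rewrite (@msize_mul 1 n)// msize_lin.
    by move: r1; rewrite leqn0 msize_poly_eq0 => /eqP ->; rewrite mulr0 msize0.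
  split => /=.
  - by rewrite msize_add ?msize_mulvar// msize_scale// msize_sub.
  - rewrite msize_add ?msize_scale//.
    case: n {hp r1 hlr} s1 => [|n] s1; last by rewrite msize_mulvar.
    move: s1; rewrite [(0.-1)%N]/= leqn0 msize_poly_eq0 => /eqP ->; rewrite mulr0 msize0//.
  - move=> x; have e := r2 x.
    have {}e : ev p (reflection v x) = ev p x - dot x v * ev r x by rewrite -e; ring.
    by rewrite !(ev_lin, evE) e /reflection v2 !mxE; field.
  - move=> x; rewrite !(ev_lin, evE).
    transitivity (v 0 i * ev p x + x 0 i * \sum_j v 0 j * ev (mderiv j p) x).
      rewrite mulr_sumr (bigD1 i)//= [in RHS](bigD1 i)//= addrA; congr (_ + _).
        by rewrite mderiv_varM eqxx mul1r !evE; ring.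
      apply: eq_bigr => j /negPf ji; by rewrite mderiv_varM ji mul0r add0r !evE; ring.
    by rewrite s2; ring.
Qed.

(** For the root [v] with reflection [s], the two polynomials
    [(p - p \o s) / <x, v>] and [(<grad p, v> - (p - p \o s) / <x, v>) / <x, v>]. *)
Definition dunkl_quot v p : mpoly d R * mpoly d R :=
  xget (0, 0) [set rs | [/\ (msize rs.1 <= (msize p).-1)%N, (msize rs.2 <= (msize p).-2)%N,
    forall x, ev p x - ev p (reflection v x) = dot x v * ev rs.1 x &
    forall x, \sum_i v 0 i * ev (mderiv i p) x = dot x v * ev rs.2 x + ev rs.1 x]].

Lemma dunkl_quotP v p : dot v v = 2 ->
  [/\ (msize (dunkl_quot v p).1 <= (msize p).-1)%N,
    (msize (dunkl_quot v p).2 <= (msize p).-2)%N,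
    forall x, ev p x - ev p (reflection v x) = dot x v * ev (dunkl_quot v p).1 x &
    forall x, \sum_i v 0 i * ev (mderiv i p) x =
      dot x v * ev (dunkl_quot v p).2 x + ev (dunkl_quot v p).1 x].
Proof.
move=> v2; have [rs h] := divided_difference_ex v2 (leqnn (msize p)).
rewrite /dunkl_quot; case: xgetP => [rs' _ //|/(_ rs)[]]; exact: h.
Qed.

Section DunklOperator.
Variables (Phi : seq 'rV[R]_d) (kappa : 'rV[R]_d -> R).
Hypothesis Phi2 : {in Phi, forall v, dot v v = 2}.

Let K := \sum_(v <- Phi) kappa v.

(** This is [- Delta_{kappa,0}] on restrictions of polynomials. For roots with
    [<v, v> = 2] the Dunkl Laplacian is the Laplacian plus the second divided
    differences, weighted by [kappa], over all roots; the Euler term comes from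
    the extension of degree 0 off the sphere. *)
Definition dunkl_op p : mpoly d R :=
  laplace_beltrami p + K *: euler p - \sum_(v <- Phi) kappa v *: (dunkl_quot v p).2.

(** The second divided differences lower the degree, so that only the Euler
    term adds to the eigenvalue of [laplace_beltrami_lower]. *)
Lemma dunkl_op_lower n p : (msize p <= n.+1)%N -> exists2 q, (msize q <= n)%N &
  forall x, sphere R d x ->
    ev (dunkl_op p) x = n%:R * (n%:R + (d%:R - 2 + K)) * ev p x + ev q x.
Proof.
move=> hp; have [q hq qE] := laplace_beltrami_lower hp.
exists (q + K *: (euler p - n%:R *: p) - \sum_(v <- Phi) kappa v *: (dunkl_quot v p).2).
  rewrite msize_sub ?msize_add ?msize_scale ?euler_lower//.
  rewrite big_seq; elim/big_ind: _ => [|? ? ? ?|v vPhi]; rewrite ?msize0// ?msize_add//.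
  rewrite msize_scale//; have [_ h _ _] := dunkl_quotP p (Phi2 vPhi).
  by rewrite (leq_trans h)// (leq_trans (leq_pred _))// -subn1 leq_subLR add1n.
move=> x Sx; rewrite /dunkl_op evB evD (qE x Sx) !(evD, evB, evZ).
by rewrite !evN evZ; ring.
Qed.

End DunklOperator.

Lemma ev_laplace_beltrami p x : ev (laplace_beltrami p) x = - 2^-1 * \sum_i \sum_j ev (rot_deriv i j (rot_deriv i j p)) x.
Proof.
by rewrite /laplace_beltrami evZ ev_sum; congr (_ * _); apply: eq_bigr => i _; rewrite ev_sum.
Qed.

Lemma ev_rot_deriv i j p x : ev (rot_deriv i j p) x =
  x 0 i * ev (mderiv j p) x - x 0 j * ev (mderiv i p) x.
Proof. by rewrite evB !evM !ev_var. Qed.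

Lemma ev_euler p x : ev (euler p) x = \sum_i x 0 i * ev (mderiv i p) x.
Proof. by rewrite /euler ev_sum; apply: eq_bigr => i _; rewrite evM ev_var. Qed.

Lemma rot_derivM i j p q :
  rot_deriv i j (p * q) = rot_deriv i j p * q + p * rot_deriv i j q.
Proof. by rewrite /rot_deriv !mderivM; ring. Qed.

Lemma rot_derivD i j p q : rot_deriv i j (p + q) = rot_deriv i j p + rot_deriv i j q.
Proof. by rewrite /rot_deriv !mderivD; ring. Qed.

Lemma rot_derivZ i j c p : rot_deriv i j (c *: p) = c *: rot_deriv i j p.
Proof. by rewrite /rot_deriv !mderivZ -!scalerAr scalerBr. Qed.

Lemma mderiv_lin i v : mderiv i (lin_poly v) = @mpolyC d R (v 0 i).
Proof.
rewrite /lin_poly raddf_sum (bigD1 i)//= mderivZ mderiv_var eqxx big1 ?addr0.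
  by rewrite -mul_mpolyC mulr1.
by move=> j; rewrite eq_sym => /negPf ji; rewrite mderivZ mderiv_var ji scaler0.
Qed.

Lemma bm_ev p : bounded_measurable (ev p).
Proof.
have [n hp] := ubnP (msize p); move: (ltnW hp) => {hp}.
move: n p; apply: mpoly_degree_ind => //.
- by move=> _; apply: (eq_bm _ (bm_cst 0)) => x _; rewrite ev0.
- move=> _ c p q bp bq; apply: (eq_bm _ (bmD (bmZ c bp) bq)) => x _.
  by rewrite evD evZ.
- by apply: (eq_bm _ (bm_cst 1)) => x _; rewrite ev1.
- move=> _ i p bp; apply: (eq_bm _ (bmM (bm_coord i) bp)) => x _.
  by rewrite evM ev_var.
Qed.

End PolynomialOperators.

(** * Derivatives along rotations *)

Section OneVariable.
Context {R : realType}.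
Implicit Types (f g : R -> R) (t a b : R).

Lemma is_derive1_chain f g t a b :
  is_derive t 1 f a -> is_derive (f t) 1 g b -> is_derive t 1 (fun s => g (f s)) (b * a).
Proof.
move=> df dg.
have f1 : derivable f t 1 by exact: ex_derive.
have g1 : derivable g (f t) 1 by exact: ex_derive.
have h1 : derivable (g \o f) t 1.
  apply/derivable1_diffP; apply: (@differentiable_comp _ _ _ _ f g).
    exact: (derivable1_diffP _ _).1 f1.
  exact: (derivable1_diffP _ _).1 g1.
apply: DeriveDef => //; rewrite -derive1E (derive1_comp f1 g1) !derive1E.
by rewrite (@derive_val _ _ _ _ _ _ _ df) (@derive_val _ _ _ _ _ _ _ dg).
Qed.

Lemma is_derive_cvg_quotient f a : is_derive (0 : R) 1 f a ->
  (k.+1%:R * (f k.+1%:R^-1 - f 0)) @[k --> \oo] --> a.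
Proof.
move=> df; have := @ex_derive _ _ _ _ _ _ _ df.
rewrite /derivable => cf.
have cf2 : (fun h => h^-1 *: ((f \o shift 0) (h *: 1) - f 0)) @ 0^' --> a.
  by move: cf; rewrite -(@derive_val _ _ _ _ _ _ _ df).
pose u (k : nat) : R := k.+1%:R^-1.
have cu : u @ \oo --> 0^'.
  move=> A /= A0.
  have h : \forall k \near \oo, u k != 0 -> A (u k) by exact: (@cvg_harmonic R _ A0).
  change (\forall k \near \oo, A (u k)).
  near=> k; have : u k != 0 by rewrite /u invr_eq0 pnatr_eq0.
  by near: k.
have := cvg_comp _ _ cu cf2.
apply: cvg_trans; apply: near_eq_cvg; near=> k => /=.
by rewrite /u invrK /= addr0 /GRing.scale/= mulr1.
Unshelve. all: by end_near. Qed.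

Lemma is_derive_mvt f (df : R -> R) M t : (forall s : R, is_derive s 1 f (df s)) ->
  (forall s, `|df s| <= M) -> 0 <= t -> `|f t - f 0| <= M * t.
Proof.
move=> fd dM t0.
have [] := @MVT_segment R f df 0 t t0 => //.
  by apply: derivable_within_continuous => s _; exact: ex_derive.
by move=> c _; rewrite subr0 => ->; rewrite normrM (ger0_norm t0) ler_wpM2r.
Qed.

End OneVariable.

Section Rotations.
Context {R : realType} {d : nat}.
Implicit Types (x y u v : 'rV[R]_d) (p q : mpoly d R) (i j k : 'I_d) (t : R)
  (F : 'rV[R]_d -> R).

Let e i : 'rV[R]_d := delta_mx 0 i.

Definition rot i j t x : 'rV[R]_d :=
  x + ((cos t - 1) * x 0 i - sin t * x 0 j) *: e i
    + ((cos t - 1) * x 0 j + sin t * x 0 i) *: e j.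

Lemma dot_deltar i x : dot x (e i) = x 0 i.
Proof.
rewrite /dot (bigD1 i)//= mxE !eqxx mulr1 big1 ?addr0// => j /negPf ji.
by rewrite mxE ji andbF mulr0.
Qed.

Lemma dot_deltal i x : dot (e i) x = x 0 i.
Proof. by rewrite dotC dot_deltar. Qed.

Lemma dot_rot i j t x y : i != j -> dot (rot i j t x) (rot i j t y) = dot x y.
Proof.
move=> ij; rewrite /rot !dotE !dot_deltar !dot_deltal !mxE !eqxx !andTb (eq_sym j).
rewrite (negPf ij).
have c2 := cos2Dsin2 t; have {}c2 : sin t ^+ 2 = 1 - cos t ^+ 2 by rewrite -c2; ring.
by rewrite ?mulr1n ?mulr0n; ring: c2.
Qed.

Fact rot_is_linear i j t : linear (rot i j t).
Proof.
move=> c x y; rewrite /rot; apply/rowP => l; rewrite !mxE; ring.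
Qed.

Definition rot_mx i j t : 'M[R]_d := lin1_mx (rot i j t).

Lemma mul_rot_mx i j t x : x *m rot_mx i j t = rot i j t x.
Proof.
pose f := GRing.isLinear.Build R _ _ _ (rot i j t) (@rot_is_linear i j t).
pose r : {linear 'rV[R]_d -> 'rV[R]_d} := HB.pack (rot i j t) f.
exact: (mul_rV_lin1 r).
Qed.

Lemma orthogonal_rot i j t : i != j -> orthogonal_mx (rot_mx i j t).
Proof. by move=> ij; apply: orthogonal_mxP => x y; rewrite !mul_rot_mx dot_rot. Qed.

Lemma rot0 i j x : rot i j 0 x = x.
Proof. by rewrite /rot cos0 sin0 subrr !mul0r subrr addr0 !scale0r !addr0. Qed.

(** The derivative is required along whole orbits because the mean value
    theorem is used on them. *)
Definition rot_differentiable i j F (DF : 'rV[R]_d -> R) :=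
  forall x t, is_derive t 1 (fun s => F (rot i j s x)) (DF (rot i j t x)).

Lemma rot_differentiable_coord i j k : i != j ->
  rot_differentiable i j (fun x => x 0 k)
    (fun x => x 0 i * (j == k)%:R - x 0 j * (i == k)%:R).
Proof.
move=> ij x t.
pose A := x 0 i * (i == k)%:R + x 0 j * (j == k)%:R.
pose B := x 0 i * (j == k)%:R - x 0 j * (i == k)%:R.
rewrite (_ : (fun s => _) = cst (x 0 k - A) + (cos * cst A + sin * cst B)); last first.
  apply/funext => s; rewrite !mxE /= !fctE (eq_sym k i) (eq_sym k j) /A /B.
  by case: (i == k); case: (j == k); rewrite ?mulr1n ?mulr0n; ring.
apply: (is_derive_eq (is_deriveD (is_derive_cst (x 0 k - A) t 1)
  (is_deriveD (is_deriveM (is_derive_cos t) (is_derive_cst A t 1))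
              (is_deriveM (is_derive_sin t) (is_derive_cst B t 1))))).
rewrite !mxE !eqxx (eq_sym j i) (negPf ij) /cst /GRing.scale/= /A /B.
by case: (i == k); case: (j == k); rewrite ?mulr1n ?mulr0n; ring.
Qed.

Lemma rot_differentiableM i j F G DF DG : rot_differentiable i j F DF ->
  rot_differentiable i j G DG ->
  rot_differentiable i j (fun x => F x * G x) (fun x => DF x * G x + F x * DG x).
Proof.
move=> dF dG x t; apply: (is_derive_eq (is_deriveM (dF x t) (dG x t))).
by rewrite /GRing.scale/=; ring.
Qed.

Lemma rot_differentiableD i j F G DF DG : rot_differentiable i j F DF ->
  rot_differentiable i j G DG ->
  rot_differentiable i j (fun x => F x + G x) (fun x => DF x + DG x).
Proof. by move=> dF dG x t; apply: (is_deriveD (dF x t) (dG x t)). Qed.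

Lemma rot_differentiable_cst i j c : rot_differentiable i j (fun=> c) (fun=> 0).
Proof. by move=> x t; exact: is_derive_cst. Qed.

Lemma rot_differentiable_comp i j F DF (g dg : R -> R) : rot_differentiable i j F DF ->
  (forall x, is_derive (F x) 1 g (dg (F x))) ->
  rot_differentiable i j (fun x => g (F x)) (fun x => dg (F x) * DF x).
Proof. by move=> dF dg' x t; apply: is_derive1_chain. Qed.

Lemma rot_differentiable_sum i j (I : Type) (r : seq I) (F DF : I -> 'rV[R]_d -> R) :
  (forall a, rot_differentiable i j (F a) (DF a)) ->
  rot_differentiable i j (fun x => \sum_(a <- r) F a x) (fun x => \sum_(a <- r) DF a x).
Proof.
move=> h; elim: r => [|a r ih].
  rewrite (_ : (fun _ => _) = fun=> 0); last by apply/funext => x; rewrite big_nil.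
  rewrite (_ : (fun _ => _) = fun=> 0); last by apply/funext => x; rewrite big_nil.
  exact: rot_differentiable_cst.
rewrite (_ : (fun _ => _) = fun x => F a x + \sum_(a <- r) F a x); last first.
  by apply/funext => x; rewrite big_cons.
rewrite [X in rot_differentiable _ _ _ X](_ : _ =
    fun x => DF a x + \sum_(a <- r) DF a x); last first.
  by apply/funext => x; rewrite big_cons.
exact: rot_differentiableD.
Qed.

Lemma eq_rot_differentiable i j F DF DF' : DF =1 DF' ->
  rot_differentiable i j F DF -> rot_differentiable i j F DF'.
Proof. by move=> /funext ->. Qed.

Lemma rot_differentiable_ev i j p : i != j ->
  rot_differentiable i j (ev p) (ev (rot_deriv i j p)).
Proof.
move=> ij; have [n hp] := ubnP (msize p); move: (ltnW hp) => {hp}.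
have evfun q (g : 'rV[R]_d -> R) : (forall x, ev q x = g x) -> ev q = g by move=> /funext.
move: n p; apply: mpoly_degree_ind => //.
- move=> _; rewrite (evfun 0 (fun=> 0)); last by move=> x; rewrite ev0.
  apply: eq_rot_differentiable (@rot_differentiable_cst _ _ _) => x.
  by rewrite ev_rot_deriv !mderiv0 !ev0 !mulr0 subrr.
- move=> _ c p q bp bq.
  rewrite (evfun (c *: p + q) (fun x => c * ev p x + ev q x)); last by move=> x; rewrite evD evZ.
  apply: eq_rot_differentiable (rot_differentiableD (rot_differentiableM
    (@rot_differentiable_cst i j c) bp) bq) => x.
  by rewrite rot_derivD rot_derivZ evD evZ mul0r add0r.
- rewrite (evfun 1 (fun=> 1)); last by move=> x; rewrite ev1.
  apply: eq_rot_differentiable (@rot_differentiable_cst _ _ _) => x.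
  by rewrite ev_rot_deriv !mderiv1 !ev0 !mulr0 subrr.
- move=> _ k p bp.
  rewrite (evfun _ (fun x => x 0 k * ev p x)); last by move=> x; rewrite evM ev_var.
  apply: eq_rot_differentiable (rot_differentiableM
    (@rot_differentiable_coord i j k ij) bp) => x.
  rewrite rot_derivM [RHS]evD [X in _ = X + _]evM [X in _ = _ + X]evM ev_var.
  rewrite [X in _ = X * _ + _]ev_rot_deriv !mderiv_var; congr (_ * _ + _).
  by do 2 case: eqP => _; rewrite ?ev1 ?ev0.
Qed.

Section Integral.
Variable sigma : {measure set (rV_borel R d) -> \bar R}.
Hypothesis sigmaP : surface_measure sigma.
Local Notation I := (sphere_int sigma).
Local Notation bm := bounded_measurable.

(** The integral of [F] composed with a rotation does not depend on the angle.
    The bound on [DF] dominates the difference quotients, so that one may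
    differentiate under the integral sign. *)
Lemma sphere_int_rot_derivative i j F DF : i != j -> rot_differentiable i j F DF ->
  bm F -> bm DF -> I DF = 0.
Proof.
move=> ij dF bF bDF.
pose t (k : nat) : R := k.+1%:R^-1.
pose fk (k : nat) x := k.+1%:R * (F (x *m rot_mx i j (t k)) - F x).
have bFr (k : nat) : bm (fun x => F (x *m rot_mx i j (t k))).
  by apply: bm_mulmx => //; exact: orthogonal_rot.
have bfk (k : nat) : bm (fk k) by apply: bmZ; apply: bmB.
have I0 (k : nat) : I (fk k) = 0.
  by rewrite sphere_intZ ?sphere_intB// ?sphere_int_mulmx// ?subrr ?mulr0//; [exact: orthogonal_rot|exact: bmB].
have [_ [M DFM]] := bDF.
have h : I (fk m) @[m --> \oo] --> I DF.
  apply: (@sphere_int_dominated_cvg _ _ _ sigmaP fk DF M); [exact: bfk|exact: bDF| |].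
    move=> k x Sx; rewrite /fk normrM ger0_norm//.
    have := @is_derive_mvt _ (fun s => F (rot i j s x)) (fun s => DF (rot i j s x)) M (t k) (dF x).
    rewrite rot0 mul_rot_mx => h.
    rewrite mulrC -ler_pdivlMr// h// => [s|].
      by apply: DFM; rewrite -mul_rot_mx; exact: (sphere_orthogonal x (orthogonal_rot s ij)).2.
    by rewrite /t invr_ge0.
  move=> x Sx; have := dF x 0; rewrite rot0 => /is_derive_cvg_quotient.
  by rewrite /fk rot0; under eq_cvg do rewrite -mul_rot_mx.
have e0 : (fun m : nat => I (fk m)) = fun=> 0 by apply/funext => k; exact: I0.
move: h; rewrite e0 => h; apply: (cvg_unique _ h (cvg_cst (0 : R))).
exact: norm_hausdorff.
Qed.

End Integral.

End Rotations.

(** * The weight of a root system and its regularization *)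

Section RootWeight.
Context {R : realType} {d : nat}.
Implicit Types (x u v : 'rV[R]_d) (i j : 'I_d) (e : R).
Local Notation bm := bounded_measurable.

(** The reflection group enters the analysis only through these properties. The
    list of roots may be empty, in which case the results below concern the
    classical Laplace-Beltrami operator. *)
Record root_multiplicity (Phi : seq 'rV[R]_d) (kappa : 'rV[R]_d -> R) : Prop :=
  RootMultiplicity {
  roots_uniq : uniq Phi;
  roots_norm : {in Phi, forall v, dot v v = 2};
  roots_reflection : {in Phi &, forall u v, reflection v u \in Phi};
  multiplicity_ge0 : {in Phi, forall v, 0 <= kappa v};
  multiplicity_reflection : {in Phi &, forall u v, kappa (reflection v u) = kappa u}
}.

Variables (Phi : seq 'rV[R]_d) (kappa : 'rV[R]_d -> R).
Hypothesis Phi_kappa : root_multiplicity Phi kappa.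

Let uniqPhi := roots_uniq Phi_kappa.
Let Phi2 := roots_norm Phi_kappa.
Let PhiP := roots_reflection Phi_kappa.
Let kappa_ge0 := multiplicity_ge0 Phi_kappa.
Let kappaP := multiplicity_reflection Phi_kappa.

(** The product runs over all roots. Opposite roots give equal factors, so that
    this is the square of [h_kappa]. *)
Definition root_weight x : R := \prod_(u <- Phi) `|dot x u| `^ kappa u.

(** For small multiplicities the weight is not differentiable on the walls.
    Replacing each [<x, u> ^ 2] by [<x, u> ^ 2 + e] makes it smooth and keeps
    the invariance under reflections. *)
Definition smooth_weight e x : R :=
  expR (\sum_(u <- Phi) kappa u / 2 * ln (dot x u ^+ 2 + e)).

Lemma reflectionK v x : dot v v != 0 -> reflection v (reflection v x) = x.
Proof.
move=> v0; rewrite /reflection !dotE; apply/rowP => i; rewrite !mxE; field.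
by rewrite v0.
Qed.

Lemma dot_reflectionC v x u : dot (reflection v x) u = dot x (reflection v u).
Proof. by rewrite /reflection !dotE (dotC v u); ring. Qed.

Lemma sphere_reflection v x : v \in Phi ->
  sphere R d (reflection v x) <-> sphere R d x.
Proof.
move=> /Phi2 v2; rewrite -mul_reflection_mx; apply: sphere_orthogonal.
by apply: orthogonal_reflection; rewrite v2.
Qed.

Lemma perm_reflection v : v \in Phi -> perm_eq [seq reflection v u | u <- Phi] Phi.
Proof.
move=> vPhi; have v0 : dot v v != 0 by rewrite Phi2.
apply: uniq_perm => //.
  by rewrite map_inj_in_uniq// => u w _ _ /(congr1 (reflection v)); rewrite !reflectionK.
move=> u; apply/mapP/idP => [[w wPhi ->]|uPhi]; first exact: PhiP.
by exists (reflection v u); [exact: PhiP|rewrite reflectionK].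
Qed.

Lemma smooth_weight_reflection e v x : v \in Phi ->
  smooth_weight e (reflection v x) = smooth_weight e x.
Proof.
move=> vPhi; congr expR.
rewrite -(perm_big _ (perm_reflection vPhi))/= big_map !big_seq.
apply: eq_bigr => u uPhi; rewrite kappaP// dot_reflectionC reflectionK//.
by rewrite Phi2.
Qed.

Lemma smooth_weight_gt0 e x : 0 < smooth_weight e x.
Proof. exact: expR_gt0. Qed.

Lemma dot_root_le u x : sphere R d x -> u \in Phi -> dot x u ^+ 2 <= 2.
Proof.
move=> /sphereE x1 /Phi2 u2; have := dot_cauchy_schwarz x u.
by rewrite x1 u2 mul1r.
Qed.

Definition weight_bound : R := expR (\sum_(u <- Phi) kappa u / 2 * ln 3).

Lemma smooth_weight_le e x : 0 < e <= 1 -> sphere R d x ->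
  smooth_weight e x <= weight_bound.
Proof.
move=> /andP[e0 e1] Sx; rewrite ler_expR !big_seq; apply: ler_sum => u uPhi.
rewrite ler_wpM2l ?divr_ge0 ?kappa_ge0// ler_ln ?posrE//.
  by have := dot_root_le Sx uPhi; lra.
by rewrite ltr_wpDl// sqr_ge0.
Qed.

Lemma bm_smooth_weight e : 0 < e <= 1 -> bm (smooth_weight e).
Proof.
move=> e01; split; last first.
  exists weight_bound => x Sx.
  by rewrite ger0_norm ?smooth_weight_le// ltW// smooth_weight_gt0.
apply: measurableT_comp; first exact: measurable_expR.
apply: measurable_sum => u; apply: measurable_funM => //.
apply: measurableT_comp; first exact: measurable_ln.
by have [] := bmD (bmX 2 (bm_dot u)) (bm_cst e).
Qed.

(** At [s = 0] the limit is 0 for positive [a] but 1 for [a = 0], by the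
    convention on powers; a multiplicity may vanish. *)
Lemma cvg_powR_shift (a s : R) : 0 <= a ->
  (s ^+ 2 + (k : nat).+1%:R^-1) `^ (a / 2) @[k --> \oo] --> `|s| `^ a.
Proof.
move=> a0; have ch : (fun k : nat => s ^+ 2 + k.+1%:R^-1) @ \oo --> s ^+ 2.
  rewrite -[X in _ --> X]addr0; apply: cvgD; first exact: cvg_cst.
  exact: cvg_harmonic.
have [->|s0] := eqVneq s 0.
  rewrite normr0; have [->|an0] := eqVneq a 0.
    by rewrite mul0r powRr0; under eq_cvg do rewrite powRr0; exact: cvg_cst.
  rewrite powR0//; have a2 : 0 < a / 2 by rewrite divr_gt0// lt_def an0.
  have := @powR_cvg0 R _ a2 => c0.
  apply: (cvg_comp (fun k : nat => 0 ^+ 2 + k.+1%:R^-1) (fun b => b `^ (a / 2)) _ c0).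
  move=> A A0.
  have h : \forall k \near \oo, 0 < (k.+1%:R^-1 : R) -> A (k.+1%:R^-1).
    exact: (@cvg_harmonic R _ A0).
  change (\forall k \near \oo, A (0 ^+ 2 + k.+1%:R^-1)).
  near=> k; rewrite expr0n add0r; have : 0 < (k.+1%:R^-1 : R) by rewrite invr_gt0.
  by near: k.
have s2 : 0 < s ^+ 2 by rewrite lt_def sqrf_eq0 s0 sqr_ge0.
have -> : `|s| `^ a = expR (a / 2 * ln (s ^+ 2)).
  rewrite /powR normr_eq0 (negPf s0) -real_normK ?num_real// lnXn ?normr_gt0//.
  by congr expR; rewrite mulr2n; field.
rewrite (_ : (fun _ => _) = (fun k : nat => expR (a / 2 * ln (s ^+ 2 + k.+1%:R^-1)))).
  apply: continuous_cvg; first exact: continuous_expR.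
  apply: cvgMr => //; apply: continuous_cvg => //; exact: continuous_ln.
apply/funext => k; rewrite /powR gt_eqF// ltr_wpDr// invr_ge0//.
Unshelve. all: by end_near. Qed.

Lemma cvg_smooth_weight x :
  smooth_weight ((k : nat).+1%:R^-1) x @[k --> \oo] --> root_weight x.
Proof.
have pos s (k : nat) : 0 < s ^+ 2 + (k.+1%:R^-1 : R).
  by rewrite ltr_wpDl// ?sqr_ge0// invr_gt0.
rewrite (_ : (fun _ => _) = fun k : nat =>
    \prod_(u <- Phi) (dot x u ^+ 2 + k.+1%:R^-1) `^ (kappa u / 2)).
  rewrite /root_weight; move: kappa_ge0; elim: (Phi) => [_|u s ih h].
    by rewrite big_nil; under eq_cvg do rewrite big_nil; exact: cvg_cst.
  rewrite big_cons; under eq_cvg do rewrite big_cons.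
  apply: cvgM; first by apply: cvg_powR_shift; apply: h; rewrite mem_head.
  by apply: ih => v vs; apply: h; rewrite inE vs orbT.
apply/funext => k; rewrite /smooth_weight expR_sum; apply: eq_bigr => u _.
by rewrite /powR gt_eqF.
Qed.

Lemma root_weight_ge0 x : 0 <= root_weight x.
Proof. by apply: prodr_ge0 => u _; exact: powR_ge0. Qed.

Lemma root_weight_reflection v x : v \in Phi ->
  root_weight (reflection v x) = root_weight x.
Proof.
move=> vPhi; have := @cvg_smooth_weight (reflection v x).
rewrite (_ : (fun _ => _) = fun k : nat => smooth_weight (k.+1%:R^-1) x); last first.
  by apply/funext => k; rewrite smooth_weight_reflection.
move=> h; apply: (cvg_unique _ h (@cvg_smooth_weight x)).
exact: norm_hausdorff.
Qed.

(** Quotients by [<x, u>] are uncontrolled on the wall of [u], but they always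
    come with the factor [kappa u], so that the wall may be ignored. *)
Lemma root_weight_wall u x : u \in Phi -> dot x u = 0 -> kappa u * root_weight x = 0.
Proof.
move=> uPhi xu; have [->|k0] := eqVneq (kappa u) 0; first by rewrite mul0r.
by rewrite /root_weight (big_rem u)//= xu normr0 powR0// mul0r mulr0.
Qed.

Lemma invS_gt0_le1 (k : nat) : 0 < (k.+1%:R^-1 : R) <= 1.
Proof. by rewrite invr_gt0 ltr0n/= invf_le1 ?ltr0n// ler1n. Qed.

Lemma bm_root_weight : bm root_weight.
Proof.
split.
  apply: measurable_prod => u _.
  apply: (measurableT_comp (@measurable_powR R (kappa u))).
  by have [] := bm_norm (bm_dot u).
exists weight_bound => x Sx; rewrite ger0_norm ?root_weight_ge0//.
rewrite -(cvg_lim (@norm_hausdorff _ _) (@cvg_smooth_weight x)).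
apply: limr_le; first by apply: cvgP; exact: cvg_smooth_weight.
by apply: nearW => k; apply: smooth_weight_le => //; exact: invS_gt0_le1.
Qed.

(** The logarithmic derivative of the smooth weight along a rotation. *)
Definition smooth_weight_log_deriv e i j x : R :=
  \sum_(u <- Phi) kappa u * (dot x u * ev (rot_deriv i j (lin_poly u)) x) / (dot x u ^+ 2 + e).

Lemma rot_differentiable_smooth_weight e i j : 0 < e -> i != j ->
  rot_differentiable i j (smooth_weight e)
    (fun x => smooth_weight e x * smooth_weight_log_deriv e i j x).
Proof.
move=> e0 ij.
pose L x := \sum_(u <- Phi) kappa u / 2 * ln (dot x u ^+ 2 + e).
apply: (@rot_differentiable_comp _ _ i j L (smooth_weight_log_deriv e i j) expR expR).
apply: rot_differentiable_sum => u.
have du := rot_differentiable_ev (lin_poly u) ij.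
have evu : ev (lin_poly u) = fun x => dot x u by apply/funext => x; rewrite ev_lin.
rewrite evu in du.
pose G x := dot x u * dot x u + e.
have dG : rot_differentiable i j G _ :=
  rot_differentiableD (rot_differentiableM du du) (@rot_differentiable_cst _ _ i j e).
have dL := @rot_differentiable_comp _ _ i j G _ (@ln R) (fun b => b^-1) dG _.
rewrite (_ : (fun _ => _) = fun x => cst (kappa u / 2) x * ln (G x)); last first.
  by apply/funext => x; rewrite /G expr2.
apply: eq_rot_differentiable; last first.
  apply: (rot_differentiableM (@rot_differentiable_cst _ _ i j (kappa u / 2)) (dL _)) => x.
  by apply: is_derive1_ln; rewrite /G -expr2 ltr_wpDl// sqr_ge0.
move=> x /=; rewrite /G -expr2; field.
by rewrite gt_eqF// ltr_wpDl// sqr_ge0.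
Qed.

End RootWeight.

(** * Green's formula *)

Section Green.
Context {R : realType} {d : nat}.
Implicit Types (x u v : 'rV[R]_d) (p q : mpoly d R) (i j : 'I_d) (e : R)
  (F : 'rV[R]_d -> R).
Variable sigma : {measure set (rV_borel R d) -> \bar R}.
Hypothesis sigmaP : surface_measure sigma.
Local Notation I := (sphere_int sigma).
Local Notation bm := bounded_measurable.

Variables (Phi : seq 'rV[R]_d) (kappa : 'rV[R]_d -> R).
Hypothesis Phi_kappa : root_multiplicity Phi kappa.

Local Notation w0 := (root_weight Phi kappa).
Local Notation w := (smooth_weight Phi kappa).
Local Notation L := (dunkl_op Phi kappa).

Definition weighted_sphere_int F : R := I (fun x => F x * w0 x).
Local Notation W := weighted_sphere_int.

(** On the sphere the first sum is twice the inner product of the tangential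
    gradients. The second one contains each reflection twice, once for each of
    two opposite roots. *)
Definition energy_density p q : mpoly d R :=
  2^-1 *: (\sum_i \sum_j rot_deriv i j p * rot_deriv i j q)
  + 2^-1 *: (\sum_(u <- Phi) kappa u *: ((dunkl_quot u p).1 * (dunkl_quot u q).1)).

Lemma ev_energy_density p q x : ev (energy_density p q) x =
  2^-1 * (\sum_i \sum_j ev (rot_deriv i j p) x * ev (rot_deriv i j q) x) +
  2^-1 * (\sum_(u <- Phi) kappa u * (ev (dunkl_quot u p).1 x * ev (dunkl_quot u q).1 x)).
Proof.
rewrite /energy_density evD !evZ; congr (_ * _ + _ * _).
  rewrite ev_sum; apply: eq_bigr => i _; rewrite ev_sum; apply: eq_bigr => j _.
  exact: evM.
by rewrite ev_sum; apply: eq_bigr => u _; rewrite evZ evM.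
Qed.

Lemma ev_dunkl_op p x : ev (L p) x = ev (laplace_beltrami p) x + (\sum_(u <- Phi) kappa u) * ev (euler p) x
  - \sum_(u <- Phi) kappa u * ev (dunkl_quot u p).2 x.
Proof.
rewrite /dunkl_op evB evD [X in _ + X - _]evZ [X in _ - X]ev_sum; congr (_ - _).
by apply: eq_bigr => u _; rewrite evZ.
Qed.

Lemma rot_deriv_id i p : rot_deriv i i p = 0.
Proof. exact: subrr. Qed.

Lemma ev_rot_lin i j u x : ev (rot_deriv i j (lin_poly u)) x = x 0 i * u 0 j - x 0 j * u 0 i.
Proof. by rewrite ev_rot_deriv !mderiv_lin /ev !mevalC. Qed.

(** The inner product of the tangential gradients of [q] and of [<., u>] is
    that of their gradients less that of their radial parts. *)
Lemma sum_rot_deriv_lin q u x : sphere R d x ->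
  2^-1 * \sum_i \sum_j ev (rot_deriv i j q) x * ev (rot_deriv i j (lin_poly u)) x =
  \sum_i u 0 i * ev (mderiv i q) x - dot x u * ev (euler q) x.
Proof.
move=> /sphereE x1.
pose g i := ev (mderiv i q) x.
have e1 i j : ev (rot_deriv i j q) x * ev (rot_deriv i j (lin_poly u)) x =
    (x 0 i * x 0 i) * (u 0 j * g j) + (u 0 i * g i) * (x 0 j * x 0 j)
    - ((x 0 i * u 0 i) * (x 0 j * g j) + (x 0 i * g i) * (x 0 j * u 0 j)).
  by rewrite ev_rot_lin ev_rot_deriv -/(g i) -/(g j); ring.
under eq_bigr do under eq_bigr do rewrite e1.
under eq_bigr do rewrite big_split sumrN !big_split/= -!mulr_sumr.
rewrite !(big_split, sumrN)/= -!mulr_suml.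
rewrite ev_euler -/(dot x x) x1 -/(dot x u) /g; by field.
Qed.

Lemma bm_inv_shift u e : 0 < e -> bm (fun x => (dot x u ^+ 2 + e)^-1).
Proof.
move=> e0; have pos x : 0 < dot x u ^+ 2 + e by rewrite ltr_wpDl// sqr_ge0.
split; last first.
  exists e^-1 => x _; rewrite ger0_norm; last by rewrite invr_ge0 ltW.
  by rewrite lef_pV2 ?posrE// lerDr sqr_ge0.
rewrite (_ : (fun _ => _) = fun x => expR (- ln (dot x u ^+ 2 + e))).
  apply: measurableT_comp; first exact: measurable_expR.
  apply: measurableT_comp => //; apply: measurableT_comp; first exact: measurable_ln.
  by have [] := bmD (bmX 2 (bm_dot u)) (bm_cst e).
by apply/funext => x; rewrite expRN lnK// posrE.
Qed.

(** The smooth weight leaves these factors in front of the terms of the roots.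
    They tend to 1 off the walls. *)
Definition wall_cutoff e u x : R := dot x u ^+ 2 / (dot x u ^+ 2 + e).

Lemma bm_wall_cutoff e u : 0 < e -> bm (wall_cutoff e u).
Proof. by move=> e0; apply: bmM; [exact/bmX/bm_dot|exact: bm_inv_shift]. Qed.

Lemma wall_cutoff01 e u x : 0 < e -> 0 <= wall_cutoff e u x <= 1.
Proof.
move=> e0; have pos : 0 < dot x u ^+ 2 + e by rewrite ltr_wpDl// sqr_ge0.
by rewrite divr_ge0 ?sqr_ge0 ?(ltW pos)//= ler_pdivrMr// mul1r lerDl ltW.
Qed.

(** Integration by parts for each rotation, the smooth weight being one of the
    factors. Its logarithmic derivative yields the sum over the roots. *)
Lemma smooth_weight_by_parts e p q : 0 < e <= 1 ->
  I (fun x => ((2^-1 * \sum_i \sum_j ev (rot_deriv i j p) x * ev (rot_deriv i j q) x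
     - ev p x * ev (laplace_beltrami q) x)
    + \sum_(u <- Phi) kappa u * (ev p x * dot x u *
        (\sum_i u 0 i * ev (mderiv i q) x - dot x u * ev (euler q) x)
          / (dot x u ^+ 2 + e))) * w e x) = 0.
Proof.
move=> e01; have /andP[e0 _] := e01.
pose lw i j := smooth_weight_log_deriv Phi kappa e i j.
have blw i j : bm (lw i j).
  apply: bm_sum => u; apply: bmM; last exact: bm_inv_shift.
  apply: bmZ; apply: bmM; [exact: bm_dot|exact: bm_ev].
have bw : bm (w e) by exact: bm_smooth_weight.
pose g i j x := (ev (rot_deriv i j p) x * ev (rot_deriv i j q) x +
    ev p x * ev (rot_deriv i j (rot_deriv i j q)) x) * w e x +
    (ev p x * ev (rot_deriv i j q) x) * (w e x * lw i j x).
have bg i j : bm (g i j).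
  exact: (bmD (bmM (bmD (bmM (bm_ev _) (bm_ev _)) (bmM (bm_ev _) (bm_ev _))) bw)
    (bmM (bmM (bm_ev _) (bm_ev _)) (bmM bw (blw i j)))).
have g0 i j : I (g i j) = 0.
  have [<-|ij] := eqVneq i j.
    rewrite (_ : 0 = I (fun=> 0)); last by rewrite sphere_int_cst mul0r.
    by apply: eq_sphere_int => x _; rewrite /g !rot_deriv_id !ev0; ring.
  apply: (@sphere_int_rot_derivative _ _ _ sigmaP i j
    (fun x => (ev p x * ev (rot_deriv i j q) x) * w e x) _ ij); last exact: bg.
  - apply: (rot_differentiableM (rot_differentiableM (rot_differentiable_ev p ij)
      (rot_differentiable_ev (rot_deriv i j q) ij))).
    exact: rot_differentiable_smooth_weight.
  - exact: (bmM (bmM (bm_ev _) (bm_ev _)) bw).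
transitivity (I (fun x => 2^-1 * \sum_i \sum_j g i j x)); last first.
  rewrite sphere_intZ//; last by apply: bm_sum => i; exact: bm_sum.
  rewrite sphere_int_sum//; last by move=> i; exact: bm_sum.
  rewrite big1 ?mulr0// => i _; rewrite sphere_int_sum// big1//.
apply: eq_sphere_int => x Sx; rewrite ev_laplace_beltrami.
under [X in _ - _ + X]eq_bigr do rewrite -sum_rot_deriv_lin//.
rewrite /g /lw /smooth_weight_log_deriv.
set A := \sum_i \sum_j _ * _.
set B := \sum_i \sum_j ev (rot_deriv i j _) x.
transitivity ((2^-1 * A + 2^-1 * (ev p x * B) +
  2^-1 * \sum_i \sum_j \sum_(u <- Phi) kappa u * ev p x * ev (rot_deriv i j q) x *
    (dot x u * ev (rot_deriv i j (lin_poly u)) x) / (dot x u ^+ 2 + e)) * w e x); last first.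
  rewrite /A /B -!mulrDr -mulrA mulr_sumr -!big_split mulr_suml; congr (_ * _).
  apply: eq_bigr => i _; rewrite mulr_sumr -!big_split mulr_suml.
  apply: eq_bigr => j _ /=; rewrite mulrDl; congr (_ + _).
  rewrite [w e x * _]mulrC mulrA; congr (_ * _); rewrite mulr_sumr.
  by apply: eq_bigr => u _; ring.
congr (_ * _); rewrite mulNr mulrN opprK; congr (_ + _ + _); first by ring.
under [in RHS]eq_bigr do rewrite exchange_big.
rewrite exchange_big mulr_sumr; apply: eq_bigr => u _ /=.
set S1 := \sum_i \sum_j _ * _.
transitivity (kappa u * ev p x * dot x u / (dot x u ^+ 2 + e) * 2^-1 * S1); first by ring.
rewrite [RHS]mulrC mulr_suml /S1 mulr_sumr; apply: eq_bigr => i _.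
rewrite mulr_suml mulr_sumr; apply: eq_bigr => j _; ring.
Qed.

Lemma sphere_int_reflection v F : v \in Phi -> bm F -> I (fun x => F (reflection v x)) = I F.
Proof.
move=> vPhi bF; have v2 := roots_norm Phi_kappa vPhi.
have oQ : orthogonal_mx (reflection_mx v) by apply: orthogonal_reflection; rewrite v2.
rewrite -(sphere_int_mulmx sigmaP oQ bF); apply: eq_sphere_int => x _.
by rewrite mul_reflection_mx.
Qed.

(** Under the reflection the difference quotient of [q] is invariant and [<x,
    v>] changes sign, so that only the odd part of [p] contributes. *)
Lemma sphere_int_odd_part e v p q : 0 < e <= 1 -> v \in Phi ->
  I (fun x => ev p x * dot x v * ev (dunkl_quot v q).1 x / (dot x v ^+ 2 + e) * w e x) =
  I (fun x => 2^-1 * wall_cutoff e v x * ev (dunkl_quot v p).1 x *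
      ev (dunkl_quot v q).1 x * w e x).
Proof.
move=> e01 vPhi; have /andP[e0 _] := e01.
have v2 := roots_norm Phi_kappa vPhi.
have [_ _ rp _] := dunkl_quotP p v2; have [_ _ rq _] := dunkl_quotP q v2.
have sv x : dot (reflection v x) v = - dot x v.
  by rewrite dot_reflectionC /reflection v2 dotBr dotZr; field.
have rqs x : dot x v * ev (dunkl_quot v q).1 (reflection v x) =
             dot x v * ev (dunkl_quot v q).1 x.
  have := rq (reflection v x); rewrite reflectionK ?v2// sv => h.
  by rewrite -[RHS]rq -[RHS]opprB h; ring.
set f := fun x => ev p x * dot x v * _ / _ * _.
have bf : bm f.
  exact: (bmM (bmM (bmM (bmM (bm_ev p) (bm_dot v)) (bm_ev _)) (bm_inv_shift v e0))
    (bm_smooth_weight Phi_kappa e01)).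
have -> : I f = 2^-1 * (I f + I (fun x => f (reflection v x))).
  by rewrite sphere_int_reflection//; field.
have bfs : bm (fun x => f (reflection v x)).
  have v0 : dot v v != 0 by rewrite v2.
  apply: (eq_bm _ (bm_mulmx (orthogonal_reflection v0) bf)).
  by move=> x _; rewrite mul_reflection_mx.
rewrite -sphere_intD// -sphere_intZ//; last exact: bmD.
apply: eq_sphere_int => x Sx; rewrite /f /wall_cutoff sv sqrrN (smooth_weight_reflection Phi_kappa)//.
have ps : ev p (reflection v x) = ev p x - dot x v * ev (dunkl_quot v p).1 x.
  by rewrite -rp; ring.
have sq : ev p (reflection v x) * - dot x v * ev (dunkl_quot v q).1 (reflection v x)
   = - ev p (reflection v x) * (dot x v * ev (dunkl_quot v q).1 x) by rewrite -rqs; ring.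
by rewrite sq ps; ring.
Qed.

(** The derivative along a root splits into a multiple of [<x, u>] and the
    difference quotient, to which [sphere_int_odd_part] applies. Except for the
    cutoffs this is the formula of [green]. *)
Lemma green_regularized e p q : 0 < e <= 1 ->
  I (fun x => (2^-1 * \sum_i \sum_j ev (rot_deriv i j p) x * ev (rot_deriv i j q) x
     - ev p x * ev (laplace_beltrami q) x) * w e x
    + \sum_(u <- Phi) (ev p x * (ev (dunkl_quot u q).2 x - ev (euler q) x)
       + 2^-1 * (ev (dunkl_quot u p).1 x * ev (dunkl_quot u q).1 x)) *
       (kappa u * wall_cutoff e u x * w e x)) = 0.
Proof.
move=> e01; have /andP[e0 _] := e01; rewrite -[RHS](smooth_weight_by_parts p q e01).
have bw : bm (w e) by exact: bm_smooth_weight.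
pose A x := (2^-1 * \sum_i \sum_j ev (rot_deriv i j p) x * ev (rot_deriv i j q) x
     - ev p x * ev (laplace_beltrami q) x) * w e x.
have bA : bm A.
  apply: bmM bw; apply: bmB; last exact: (bmM (bm_ev _) (bm_ev _)).
  by apply: bmZ; apply: bm_sum => i; apply: bm_sum => j; exact: (bmM (bm_ev _) (bm_ev _)).
pose B u x := (ev p x * (ev (dunkl_quot u q).2 x - ev (euler q) x)) *
  (wall_cutoff e u x * w e x).
have bcw u : bm (fun x => wall_cutoff e u x * w e x) by exact: (bmM (bm_wall_cutoff u e0) bw).
have bB u : bm (B u) by exact: (bmM (bmM (bm_ev _) (bmB (bm_ev _) (bm_ev _))) (bcw u)).
pose C u x := 2^-1 * wall_cutoff e u x * ev (dunkl_quot u p).1 x *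
      ev (dunkl_quot u q).1 x * w e x.
have bC u : bm (C u).
  exact: (bmM (bmM (bmM (bmZ _ (bm_wall_cutoff u e0)) (bm_ev _)) (bm_ev _)) bw).
pose C' u x := ev p x * dot x u * ev (dunkl_quot u q).1 x / (dot x u ^+ 2 + e) * w e x.
have bC' u : bm (C' u).
  exact: (bmM (bmM (bmM (bmM (bm_ev p) (bm_dot u)) (bm_ev _)) (bm_inv_shift u e0)) bw).
transitivity (I (fun x => A x + \sum_(u <- Phi) kappa u * (B u x + C u x))).
  apply: eq_sphere_int => x _; congr (_ + _); apply: eq_bigr => u _; rewrite /B /C; ring.
transitivity (I (fun x => A x + \sum_(u <- Phi) kappa u * (B u x + C' u x))); last first.
  apply: eq_sphere_int => x _; rewrite [RHS]mulrDl; congr (_ + _).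
  rewrite mulr_suml !big_seq; apply: eq_bigr => u uPhi.
  have [_ _ _ ->] := dunkl_quotP q (roots_norm Phi_kappa uPhi).
  by rewrite /B /C' /wall_cutoff; ring.
have bS (D : 'rV[R]_d -> 'rV[R]_d -> R) : (forall u, bm (D u)) ->
    bm (fun x => \sum_(u <- Phi) kappa u * (B u x + D u x)).
  by move=> bD; apply: bm_sum => u; apply: bmZ; exact: bmD.
have IS (D : 'rV[R]_d -> 'rV[R]_d -> R) : (forall u, bm (D u)) ->
    I (fun x => A x + \sum_(u <- Phi) kappa u * (B u x + D u x)) =
    I A + \sum_(u <- Phi) kappa u * (I (B u) + I (D u)).
  move=> bD; rewrite sphere_intD//; last exact: bS.
  rewrite sphere_int_sum//; last by move=> u; exact: (bmZ _ (bmD (bB u) (bD u))).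
  by congr (_ + _); apply: eq_bigr => u _; rewrite sphere_intZ ?sphere_intD//; exact: bmD.
rewrite !IS//; congr (_ + _); rewrite !big_seq; apply: eq_bigr => u uPhi.
by congr (_ * (_ + _)); apply/esym/sphere_int_odd_part.
Qed.

(** On the wall the cutoff is 0, and so is the limit by [root_weight_wall]. *)
Lemma cvg_wall_cutoff u x : u \in Phi ->
  kappa u * wall_cutoff ((k : nat).+1%:R^-1) u x * w (k.+1%:R^-1) x @[k --> \oo]
    --> kappa u * w0 x.
Proof.
move=> uPhi; have cw := @cvg_smooth_weight _ _ _ _ Phi_kappa x.
have [s0|s0] := eqVneq (dot x u) 0.
  rewrite (root_weight_wall kappa uPhi s0).
  rewrite (_ : (fun _ => _) = fun=> 0); first exact: cvg_cst.
  by apply/funext => k; rewrite /wall_cutoff s0 expr0n/= !mul0r mulr0 mul0r.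
apply: cvgM => //.
rewrite -[X in _ --> X]mulr1; apply: cvgM; first exact: cvg_cst.
have s2 : dot x u ^+ 2 != 0 by rewrite sqrf_eq0.
rewrite -[X in _ --> X](divff s2); apply: cvgM; first exact: cvg_cst.
apply: cvgV => //; rewrite -[X in _ --> X]addr0; apply: cvgD; first exact: cvg_cst.
exact: cvg_harmonic.
Qed.

(** The Dunkl operator is symmetric for the weight, and its quadratic form
    consists of the tangential gradient and the difference quotients across the
    walls. The formula is the limit of [green_regularized] for vanishing [e].
    *)
Lemma green p q : W (ev (energy_density p q)) = W (fun x => ev p x * ev (L q) x).
Proof.
pose A x := 2^-1 * \sum_i \sum_j ev (rot_deriv i j p) x * ev (rot_deriv i j q) x
     - ev p x * ev (laplace_beltrami q) x.
pose B u x := ev p x * (ev (dunkl_quot u q).2 x - ev (euler q) x)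
       + 2^-1 * (ev (dunkl_quot u p).1 x * ev (dunkl_quot u q).1 x).
have bA : bm A.
  apply: bmB; last exact: (bmM (bm_ev _) (bm_ev _)).
  by apply: bmZ; apply: bm_sum => i; apply: bm_sum => j; exact: (bmM (bm_ev _) (bm_ev _)).
have bB u : bm (B u).
  exact: (bmD (bmM (bm_ev _) (bmB (bm_ev _) (bm_ev _))) (bmZ _ (bmM (bm_ev _) (bm_ev _)))).
have bw0 := bm_root_weight Phi_kappa.
pose e (k : nat) : R := k.+1%:R^-1.
pose f (k : nat) x := A x * w (e k) x + \sum_(u <- Phi) B u x * (kappa u * wall_cutoff (e k) u x * w (e k) x).
pose g x := A x * w0 x + \sum_(u <- Phi) B u x * (kappa u * w0 x).
have e01 k : 0 < e k <= 1 by exact: invS_gt0_le1.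
have e0 k : 0 < e k by have /andP[] := e01 k.
have bf k : bm (f k).
  have bw := bm_smooth_weight Phi_kappa (e01 k).
  apply: bmD; first exact: bmM.
  by apply: bm_sum => u; exact: (bmM (bB u) (bmM (bmZ _ (bm_wall_cutoff u (e0 k))) bw)).
have bg : bm g.
  apply: bmD; first exact: bmM.
  by apply: bm_sum => u; exact: (bmM (bB u) (bmZ _ bw0)).
have [M MP] : exists M, forall x, sphere R d x ->
    `|A x| * weight_bound Phi kappa + \sum_(u <- Phi) `|B u x| * (`|kappa u| * weight_bound Phi kappa) <= M.
  have [_ [M MP]] : bm (fun x => `|A x| * weight_bound Phi kappa +
      \sum_(u <- Phi) `|B u x| * (`|kappa u| * weight_bound Phi kappa)).
    apply: bmD; first exact: (bmM (bm_norm bA) (bm_cst _)).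
    by apply: bm_sum => u; exact: (bmM (bm_norm (bB u)) (bm_cst _)).
  by exists M => x Sx; apply: le_trans (ler_norm _) (MP x Sx).
have cI : I (f k) @[k --> \oo] --> I g.
  apply: (@sphere_int_dominated_cvg _ _ _ sigmaP f g M bf bg).
    move=> k x Sx; apply: le_trans (MP x Sx).
    have wb : `|w (e k) x| <= weight_bound Phi kappa.
      by rewrite ger0_norm ?smooth_weight_le// ltW// smooth_weight_gt0.
    apply: le_trans (ler_normD _ _) _; apply: lerD; first by rewrite normrM ler_wpM2l.
    apply: le_trans (ler_norm_sum _ _ _) _; apply: ler_sum => u _.
    rewrite normrM ler_wpM2l// normrM ler_pM// normrM ler_piMr//.
    have /andP[h0 h1] := wall_cutoff01 u x (e0 k).
    by rewrite ger0_norm.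
  move=> x Sx; apply: cvgD.
    by apply: cvgM; [exact: cvg_cst|exact: (@cvg_smooth_weight _ _ _ _ Phi_kappa x)].
  rewrite big_seq; under eq_cvg do rewrite big_seq.
  apply: cvg_big; first exact: add_continuous.
  move=> u uPhi; apply: cvgM; first exact: cvg_cst.
  exact: cvg_wall_cutoff.
have Ig0 : I g = 0.
  apply: (cvg_unique _ cI); first exact: norm_hausdorff.
  rewrite (_ : (fun k => I (f k)) = fun=> 0); first exact: cvg_cst.
  by apply/funext => k; exact: (green_regularized p q (e01 k)).
apply/eqP; rewrite -subr_eq0 /W -(sphere_intB sigmaP); last 2 first.
- exact: (bmM (bm_ev _) bw0).
- exact: (bmM (bmM (bm_ev _) (bm_ev _)) bw0).
apply/eqP; rewrite -Ig0; apply: eq_sphere_int => x Sx.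
transitivity ((A x + \sum_(u <- Phi) B u x * kappa u) * w0 x); last first.
  by rewrite /g mulrDl mulr_suml; congr (_ + _); apply: eq_bigr => u _; rewrite mulrA.
rewrite -mulrBl; congr (_ * _); rewrite ev_energy_density ev_dunkl_op /A /B.
under [X in _ = _ + X]eq_bigr do rewrite mulrDl mulrBr mulrBl.
rewrite !(big_split, sumrN)/=.
have -> : \sum_(u <- Phi) ev p x * ev (dunkl_quot u q).2 x * kappa u =
    ev p x * \sum_(u <- Phi) kappa u * ev (dunkl_quot u q).2 x.
  by rewrite mulr_sumr; apply: eq_bigr => u _; ring.
have -> : \sum_(u <- Phi) 2^-1 * (ev (dunkl_quot u p).1 x * ev (dunkl_quot u q).1 x) * kappa u =
    2^-1 * \sum_(u <- Phi) kappa u * (ev (dunkl_quot u p).1 x * ev (dunkl_quot u q).1 x).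
  by rewrite mulr_sumr; apply: eq_bigr => u _; ring.
by rewrite -mulr_sumr; ring.
Qed.

End Green.

(** * A pointwise inequality across a wall *)

Section PointwiseInequality.
Context {R : realFieldType}.
Implicit Types (a b s t A B tau eps : R).

Lemma mul_le_young tau (x y : R) : 0 < tau -> x * y <= tau / 2 * x ^+ 2 + y ^+ 2 / (2 * tau).
Proof.
move=> tau0; rewrite -subr_ge0.
have -> : tau / 2 * x ^+ 2 + y ^+ 2 / (2 * tau) - x * y = (tau * x - y) ^+ 2 / (2 * tau).
  by field; rewrite gt_eqF.
by rewrite divr_ge0 ?sqr_ge0// mulr_ge0// ltW.
Qed.

(** The case in which [x] and [y] lie on the same side of the wall, so that [x]
    is closer to [y] than its reflection is. *)
Lemma wall_difference_le_same_side a b s t A B tau eps : 0 < tau -> 0 < eps -> eps < 1 ->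
  s != 0 -> 0 <= s * t -> (t - s) ^+ 2 <= 2 * A -> B = A + 2 * (s * t) ->
  t * ((a - b) / s) * (a + b) <= (a ^+ 2 + b ^+ 2) / (1 - eps) +
    tau * ((a - b) / s) ^+ 2 + (A * a ^+ 2 + B * b ^+ 2) / (eps ^+ 2 * tau).
Proof.
move=> tau0 e0 e1 s0 st hA hB.
have A0 : 0 <= A by have := sqr_ge0 (t - s); lra.
have B0 : 0 <= B by rewrite hB; lra.
have e1' : 0 < 1 - eps by lra.
have et : 0 < eps ^+ 2 * tau by rewrite mulr_gt0// exprn_gt0.
have [far|near] := leP ((1 - eps) ^+ 2 * t ^+ 2) (s ^+ 2).
  have h : t * ((a - b) / s) * (a + b) <= a ^+ 2 / (1 - eps).
    have s2 : 0 < s ^+ 2 by rewrite lt_def sqrf_eq0 s0 sqr_ge0.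
    have ts : t / s = s * t / s ^+ 2 by field.
    have ts0 : 0 <= t / s by rewrite ts divr_ge0// ltW.
    have ts1 : t / s <= (1 - eps)^-1.
      rewrite -(@ler_pXn2r _ 2)// ?nnegrE ?invr_ge0 ?(ltW e1')//.
      by rewrite expr_div_n exprVn ler_pdivrMr// ler_pdivlMl// exprn_gt0.
    have -> : t * ((a - b) / s) * (a + b) = t / s * a ^+ 2 - t / s * b ^+ 2 by field.
    have := mulr_ge0 ts0 (sqr_ge0 b).
    have := ler_wpM2r (sqr_ge0 a) ts1.
    by rewrite (mulrC _^-1); lra.
  have p1 : 0 <= b ^+ 2 / (1 - eps) by rewrite divr_ge0 ?sqr_ge0// ltW.
  have p2 : 0 <= tau * ((a - b) / s) ^+ 2 by rewrite mulr_ge0 ?sqr_ge0// ltW.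
  have p3 : 0 <= (A * a ^+ 2 + B * b ^+ 2) / (eps ^+ 2 * tau).
    by rewrite divr_ge0 ?(ltW et)// addr_ge0// mulr_ge0// sqr_ge0.
  by rewrite mulrDl; lra.
have ht : eps ^+ 2 * t ^+ 2 <= 2 * A.
  apply: le_trans hA; rewrite -!exprMn.
  have q0 : 0 <= (1 - eps) * t ^+ 2 by rewrite mulr_ge0 ?sqr_ge0// ltW.
  have hs : 0 <= (1 - eps) * t ^+ 2 - s * t.
    rewrite subr_ge0 -(@ler_pXn2r _ 2)// exprMn.
    have -> : ((1 - eps) * t ^+ 2) ^+ 2 = (1 - eps) ^+ 2 * t ^+ 2 * t ^+ 2 by ring.
    by rewrite ler_wpM2r ?sqr_ge0// ltW.
  have -> : (t - s) ^+ 2 = (eps * t) ^+ 2 + (2 * (eps * ((1 - eps) * t ^+ 2 - s * t))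
      + (s - (1 - eps) * t) ^+ 2) by ring.
  by rewrite lerDl addr_ge0 ?sqr_ge0// mulr_ge0// mulr_ge0// ltW.
have young c C : 0 <= C -> eps ^+ 2 * t ^+ 2 <= 2 * C ->
    t * ((a - b) / s) * c <= tau / 2 * ((a - b) / s) ^+ 2 + C * c ^+ 2 / (eps ^+ 2 * tau).
  move=> C0 hC.
  have -> : t * ((a - b) / s) * c = ((a - b) / s) * (t * c) by ring.
  apply: le_trans (mul_le_young _ _ tau0) _; rewrite lerD2l.
  rewrite ler_pdivrMr ?mulr_gt0// mulrAC ler_pdivlMr//.
  have -> : (t * c) ^+ 2 * (eps ^+ 2 * tau) = (eps ^+ 2 * t ^+ 2) * (c ^+ 2 * tau) by ring.
  have -> : C * c ^+ 2 * (2 * tau) = (2 * C) * (c ^+ 2 * tau) by ring.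
  by rewrite ler_wpM2r// mulr_ge0 ?sqr_ge0// ltW.
have p1 : 0 <= (a ^+ 2 + b ^+ 2) / (1 - eps).
  by rewrite divr_ge0 ?(ltW e1')// addr_ge0 ?sqr_ge0.
have ya := young a A A0 ht.
have yb := young b B B0 (le_trans ht _).
have {}yb := yb (_ : 2 * A <= 2 * B).
have AB : 2 * A <= 2 * B by lra.
have {}yb := yb AB.
by rewrite mulrDr [X in _ <= _ + X]mulrDl; lra.
Qed.

(** Here [a] and [b] are the values of a function at [x] and at its reflection
    in the wall of a root, [A] and [B] are the squared distances of these two
    points to [y], and [s] and [t] are the inner products of [x] and [y] with
    the root. If [x] is not much closer to the wall than [y], then [t / s] is
    at most slightly larger than 1, and the left-hand side exceeds the larger
    of [a ^ 2] and [b ^ 2] only slightly. Otherwise [t] is controlled by the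
    distance of [x] to [y], and the quotient is absorbed by the energy. *)
Lemma wall_difference_le a b s t A B tau eps : 0 < tau -> 0 < eps -> eps < 1 ->
  s != 0 -> (t - s) ^+ 2 <= 2 * A -> (t + s) ^+ 2 <= 2 * B -> B = A + 2 * (s * t) ->
  t * ((a - b) / s) * (a + b) <= (a ^+ 2 + b ^+ 2) / (1 - eps) +
    tau * ((a - b) / s) ^+ 2 + (A * a ^+ 2 + B * b ^+ 2) / (eps ^+ 2 * tau).
Proof.
move=> tau0 e0 e1 s0 hA hB BA.
have [st|st] := leP 0 (s * t); first exact: wall_difference_le_same_side.
have := @wall_difference_le_same_side b a (- s) t B A tau eps tau0 e0 e1.
have -> : (b - a) / - s = (a - b) / s by field.
rewrite oppr_eq0 opprK [b + a]addrC [b ^+ 2 + a ^+ 2]addrC [B * _ + _]addrC.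
by apply; rewrite // ?BA ?mulNr; lra.
Qed.

End PointwiseInequality.

(** * Weighted integrals and a local Heisenberg inequality *)

Section Heisenberg.
Context {R : realType} {d : nat}.
Implicit Types (x y u v : 'rV[R]_d) (p : mpoly d R) (i j : 'I_d) (F : 'rV[R]_d -> R).
Variable sigma : {measure set (rV_borel R d) -> \bar R}.
Hypothesis sigmaP : surface_measure sigma.
Local Notation bm := bounded_measurable.

Variables (Phi : seq 'rV[R]_d) (kappa : 'rV[R]_d -> R).
Hypothesis Phi_kappa : root_multiplicity Phi kappa.

Local Notation w0 := (root_weight Phi kappa).
Local Notation L := (dunkl_op Phi kappa).
Local Notation W := (weighted_sphere_int sigma Phi kappa).
Let K := \sum_(u <- Phi) kappa u.

Lemma sum_multiplicity_ge0 : 0 <= K.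
Proof. by rewrite /K big_seq sumr_ge0// => u; exact: multiplicity_ge0. Qed.

Lemma bm_weighted F : bm F -> bm (fun x => F x * w0 x).
Proof. by move=> bF; apply: bmM => //; exact: bm_root_weight Phi_kappa. Qed.

Lemma weighted_sphere_intD F G : bm F -> bm G -> W (fun x => F x + G x) = W F + W G.
Proof.
move=> bF bG; rewrite /weighted_sphere_int -(sphere_intD sigmaP (bm_weighted bF) (bm_weighted bG)).
by apply: eq_sphere_int => x _; rewrite mulrDl.
Qed.

Lemma weighted_sphere_intZ c F : bm F -> W (fun x => c * F x) = c * W F.
Proof.
move=> bF; rewrite /weighted_sphere_int -(sphere_intZ sigmaP c (bm_weighted bF)).
by apply: eq_sphere_int => x _; rewrite mulrA.
Qed.

Lemma weighted_sphere_int_sum (J : Type) (r : seq J) (F : J -> 'rV[R]_d -> R) :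
  (forall a, bm (F a)) -> W (fun x => \sum_(a <- r) F a x) = \sum_(a <- r) W (F a).
Proof.
move=> bF; rewrite /weighted_sphere_int -(sphere_int_sum sigmaP).
  by apply: eq_sphere_int => x _; rewrite mulr_suml.
by move=> i; exact: bm_weighted.
Qed.

Lemma le_weighted_sphere_int F G : bm F -> bm G -> (forall x, sphere R d x -> F x * w0 x <= G x * w0 x) ->
  W F <= W G.
Proof. by move=> bF bG; apply: (le_sphere_int sigmaP); exact: bm_weighted. Qed.

Lemma eq_weighted_sphere_int F G : (forall x, sphere R d x -> F x = G x) -> W F = W G.
Proof. by move=> FG; apply: eq_sphere_int => x Sx; rewrite FG. Qed.

Lemma weighted_sphere_int_ge0 F : (forall x, sphere R d x -> 0 <= F x) -> 0 <= W F.
Proof.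
move=> F0; apply: sphere_int_ge0 => x Sx; rewrite mulr_ge0 ?F0//.
exact: root_weight_ge0.
Qed.

Lemma weighted_sphere_int_reflection v F : v \in Phi -> bm F -> W (fun x => F (reflection v x)) = W F.
Proof.
move=> vPhi bF; rewrite -[RHS](sphere_int_reflection sigmaP Phi_kappa vPhi (bm_weighted bF)).
by apply: eq_sphere_int => x _; rewrite (root_weight_reflection Phi_kappa).
Qed.

Lemma bm_reflection v F : v \in Phi -> bm F -> bm (fun x => F (reflection v x)).
Proof.
move=> vPhi bF; have v0 : dot v v != 0 by rewrite (roots_norm Phi_kappa).
apply: (eq_bm _ (bm_mulmx (orthogonal_reflection v0) bF)) => x _.
by rewrite mul_reflection_mx.
Qed.

Lemma euler_lin y : euler (lin_poly y) = lin_poly y.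
Proof.
apply: eq_bigr => i _; rewrite mderiv_lin mulrC.
exact: mul_mpolyC.
Qed.

Lemma ev_laplace_beltrami_lin y x : sphere R d x -> ev (laplace_beltrami (lin_poly y)) x = (d%:R - 1) * dot x y.
Proof.
move=> /sphereE x1; rewrite /laplace_beltrami evZ sum_sqr_rot_derivE !euler_lin.
have -> : laplacian (lin_poly y) = 0.
  by rewrite /laplacian big1// => i _; rewrite mderiv_lin mderivC.
by rewrite mulr0 sub0r evZ evB evN evZ ev_lin; field.
Qed.

Lemma dunkl_quot_lin u y : u \in Phi ->
  (forall x, ev (dunkl_quot u (lin_poly y)).1 x = dot u y) /\
  (forall x, ev (dunkl_quot u (lin_poly y)).2 x = 0).
Proof.
move=> uPhi; have u2 := roots_norm Phi_kappa uPhi.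
have [h1 h2 h3 _] := dunkl_quotP (lin_poly y) u2.
have hl := msize_lin y; split => x.
  have {}h1 : (msize (dunkl_quot u (lin_poly y)).1 <= 1)%N.
    by apply: leq_trans h1 _; move: hl; case: (mmeasure _ _).
  have /msize1_polyC e := h1.
  move: (h3 u); rewrite e !ev_lin /ev !mevalC u2 /reflection u2 dotBl dotZl => h.
  by apply: (@mulfI _ 2) => //; rewrite -h; field.
have : (msize (dunkl_quot u (lin_poly y)).2 <= 0)%N.
  by apply: leq_trans h2 _; move: hl; case: (mmeasure _ _) => [|[|[]]].
by rewrite leqn0 msize_poly_eq0 => /eqP ->; rewrite ev0.
Qed.

(** Linear forms are eigenvectors: there is no remainder as in
    [dunkl_op_lower]. *)
Lemma ev_dunkl_op_lin y x : sphere R d x ->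
  ev (L (lin_poly y)) x = (d%:R - 1 + K) * dot x y.
Proof.
move=> Sx; rewrite ev_dunkl_op ev_laplace_beltrami_lin// euler_lin ev_lin [X in _ - X]big_seq [X in _ - X]big1 ?subr0.
  by rewrite -/K; ring.
by move=> u uPhi; rewrite (dunkl_quot_lin y uPhi).2 mulr0.
Qed.

Definition energy p : R := W (ev (energy_density Phi kappa p p)).

Lemma energy_density_ge0 p x : 0 <= ev (energy_density Phi kappa p p) x.
Proof.
rewrite ev_energy_density addr_ge0// mulr_ge0// ?invr_ge0//.
  by rewrite sumr_ge0// => i _; rewrite sumr_ge0// => j _; rewrite -expr2 sqr_ge0.
rewrite big_seq sumr_ge0// => u uPhi; rewrite mulr_ge0//.
  exact: multiplicity_ge0 Phi_kappa _ uPhi.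
by rewrite -expr2 sqr_ge0.
Qed.

(** The gradient part is estimated by the inequality of Cauchy and Schwarz,
    where the squared tangential gradient of [<., y>] is [1 - <x, y> ^ 2], and
    the part of each root by [wall_difference_le]. *)
Lemma energy_density_sqr_le p y x tau eps : sphere R d x -> sphere R d y ->
    0 < tau -> 0 < eps -> eps < 1 ->
  ev (energy_density Phi kappa (p * p) (lin_poly y)) x * w0 x <=
  (tau * ev (energy_density Phi kappa p p) x + 2 / tau * ((1 - dot x y) * ev p x ^+ 2)
   + \sum_(u <- Phi) kappa u * (2^-1 *
      (((ev p x ^+ 2 + ev p (reflection u x) ^+ 2) / (1 - eps)) +
      (2 * (1 - dot x y) * ev p x ^+ 2 +
       2 * (1 - dot (reflection u x) y) * ev p (reflection u x) ^+ 2) / (eps ^+ 2 * tau)))) * w0 x.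
Proof.
move=> Sx Sy tau0 e0 e1; have x1 := (sphereE x).1 Sx; have y1 := (sphereE y).1 Sy.
have wx := root_weight_ge0 Phi kappa x.
rewrite [X in X * w0 x <= _]ev_energy_density [X in tau * X]ev_energy_density.
set D1 := \sum_i \sum_j ev (rot_deriv i j (p * p)) x * _.
set D2 := \sum_i \sum_j _.
pose D3 := \sum_i \sum_j ev (rot_deriv i j (lin_poly y)) x * ev (rot_deriv i j (lin_poly y)) x.
have hD3 : 2^-1 * D3 = 1 - dot x y ^+ 2.
  rewrite /D3 sum_rot_deriv_lin// euler_lin ev_lin -expr2; congr (_ - _).
  by rewrite -y1; apply: eq_bigr => i _; rewrite mderiv_lin /ev mevalC.
have hxy : dot x y ^+ 2 <= 1 by have := dot_cauchy_schwarz x y; rewrite x1 y1 mulr1.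
have xy1 : dot x y <= 1 by have := dot_sphere_le Sx Sy; rewrite ler_norml => /andP[].
have grad : 2^-1 * D1 <= tau * (2^-1 * D2) + 2 / tau * ((1 - dot x y) * ev p x ^+ 2).
  have h1 : 2^-1 * D1 <= tau * (2^-1 * D2) + ev p x ^+ 2 / tau * (2^-1 * D3).
    rewrite ![_ * (2^-1 * _)]mulrCA -mulrDr ler_wpM2l ?invr_ge0//.
    rewrite /D1 /D2 /D3 !mulr_sumr -big_split; apply: ler_sum => i _.
    rewrite !mulr_sumr -big_split; apply: ler_sum => j _ /=.
    rewrite rot_derivM evD !evM.
    have := mul_le_young (ev (rot_deriv i j p) x * 2) (ev p x * ev (rot_deriv i j (lin_poly y)) x) (_ : 0 < tau / 2).
    rewrite divr_gt0// => /(_ isT) h; apply: le_trans (le_trans h _); rewrite le_eqVlt; apply/orP; left; apply/eqP; first by ring.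
    by field; rewrite gt_eqF.
  apply: le_trans h1 _; rewrite hD3 lerD2l.
  have -> : ev p x ^+ 2 / tau * (1 - dot x y ^+ 2) = (1 - dot x y ^+ 2) * (ev p x ^+ 2 / tau) by ring.
  have -> : 2 / tau * ((1 - dot x y) * ev p x ^+ 2) = 2 * (1 - dot x y) * (ev p x ^+ 2 / tau) by ring.
  rewrite ler_wpM2r ?divr_ge0 ?sqr_ge0// ?(ltW tau0)//.
  by have := sqr_ge0 (1 - dot x y); lra.
rewrite [X in X <= _]mulrDl.
set S1 := \sum_(u <- Phi) _; set S2 := \sum_(u <- Phi) _; set S3 := \sum_(u <- Phi) _.
suff wall : 2^-1 * S1 * w0 x <= (tau * (2^-1 * S2) + S3) * w0 x.
  apply: le_trans (lerD (ler_wpM2r wx grad) wall) _.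
  by rewrite le_eqVlt; apply/orP; left; apply/eqP; ring.
rewrite /S1 /S2 /S3 !mulr_sumr -big_split !mulr_suml !big_seq.
apply: ler_sum => u uPhi /=.
have u2 := roots_norm Phi_kappa uPhi; have ku := multiplicity_ge0 Phi_kappa uPhi.
set s := dot x u; set t := dot u y; set a := ev p x; set b := ev p (reflection u x).
have [s0|s0] := eqVneq s 0.
  have kw := root_weight_wall kappa uPhi s0.
  have e1' P : 2^-1 * (kappa u * P) * w0 x = 2^-1 * P * (kappa u * w0 x) by ring.
  have e2' P Q : (tau * (2^-1 * (kappa u * P)) + kappa u * Q) * w0 x =
      (tau * (2^-1 * P) + Q) * (kappa u * w0 x) by ring.
  by rewrite e1' e2' kw !mulr0.
rewrite (dunkl_quot_lin y uPhi).1 -/t.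
have [_ _ r2 _] := dunkl_quotP (p * p) u2; have [_ _ r1 _] := dunkl_quotP p u2.
have -> : ev (dunkl_quot u (p * p)).1 x = (a - b) / s * (a + b).
  apply: (mulfI s0); rewrite -r2 !evM -/a -/b; field; exact: s0.
have -> : ev (dunkl_quot u p).1 x = (a - b) / s.
  by apply: (mulfI s0); rewrite -r1 -/a -/b; field.
rewrite ler_wpM2r//.
pose A := 2 * (1 - dot x y); pose B := 2 * (1 - dot (reflection u x) y).
have sx : dot (reflection u x) y = dot x y - s * t.
  by rewrite /reflection u2 dotBl dotZl /s /t; field.
have CSu z : dot z z = 1 -> (t - dot z u) ^+ 2 <= 2 * (2 * (1 - dot z y)).
  move=> z1; have := dot_cauchy_schwarz (y - z) u.
  rewrite u2 !dotE z1 y1 (dotC y z) (dotC y u) -/t => h.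
  by apply: le_trans h _; lra.
have hA : (t - s) ^+ 2 <= 2 * A by exact: CSu.
have hB : (t + s) ^+ 2 <= 2 * B.
  have Sr := (sphereE _).1 ((sphere_reflection Phi_kappa x uPhi).2 Sx).
  have su : dot (reflection u x) u = - s by rewrite /reflection u2 dotBl dotZl u2 /s; field.
  by have := CSu _ Sr; rewrite su opprK.
have BA : B = A + 2 * (s * t) by rewrite /B /A sx; ring.
have := wall_difference_le a b tau0 e0 e1 s0 hA hB BA.
move=> h; have h' := ler_wpM2l (_ : 0 <= kappa u / 2) h.
have k2 : 0 <= kappa u / 2 by rewrite divr_ge0.
apply: le_trans (le_trans (h' k2) _); rewrite le_eqVlt; apply/orP; left; apply/eqP.
  by field.
by rewrite /A /B; ring.
Qed.

Definition dispersion F y : R := W (fun x => (1 - dot x y) * F x ^+ 2).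

(** Green's formula for the square of [p] and the eigenvector [<., y>]. The
    weighted integral is invariant under reflections, which removes them from
    the bound of [energy_density_sqr_le]. *)
Lemma heisenberg_linear p y tau eps : sphere R d y ->
    0 < tau -> 0 < eps -> eps < 1 ->
  (d%:R - 1 + K) * W (fun x => ev p x ^+ 2 * dot x y) <=
  tau * energy p + 2 / tau * dispersion (ev p) y +
    K * (W (fun x => ev p x ^+ 2) / (1 - eps) + 2 * dispersion (ev p) y / (eps ^+ 2 * tau)).
Proof.
move=> Sy tau0 e0 e1.
have -> : (d%:R - 1 + K) * W (fun x => ev p x ^+ 2 * dot x y) =
    W (ev (energy_density Phi kappa (p * p) (lin_poly y))).
  rewrite (green sigmaP Phi_kappa) -weighted_sphere_intZ; last exact: (bmM (bmX 2 (bm_ev p)) (bm_dot y)).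
  by apply: eq_weighted_sphere_int => x Sx; rewrite (ev_dunkl_op_lin y Sx) evM -expr2; ring.
pose P x := ev p x ^+ 2; pose M x := (1 - dot x y) * ev p x ^+ 2.
have bP : bm P by exact/bmX/bm_ev.
have bM : bm M by exact: (bmM (bmB (bm_cst 1) (bm_dot y)) bP).
pose N u x := 2^-1 * (((1 - eps)^-1 * (P x + P (reflection u x))) +
  ((eps ^+ 2 * tau)^-1 * 2) * (M x + M (reflection u x))).
have WN u : u \in Phi -> bm (N u) /\
    W (N u) = W P / (1 - eps) + 2 * W M / (eps ^+ 2 * tau).
  move=> uPhi; have bPr := bm_reflection uPhi bP; have bMr := bm_reflection uPhi bM.
  have b1 := bmZ (1 - eps)^-1 (bmD bP bPr).
  have b2 := bmZ ((eps ^+ 2 * tau)^-1 * 2) (bmD bM bMr).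
  split; first exact: (bmZ _ (bmD b1 b2)).
  rewrite (weighted_sphere_intZ _ (bmD b1 b2)) (weighted_sphere_intD b1 b2) (weighted_sphere_intZ _ (bmD bP bPr)) (weighted_sphere_intZ _ (bmD bM bMr)).
  rewrite (weighted_sphere_intD bP bPr) (weighted_sphere_intD bM bMr) !weighted_sphere_int_reflection//; field.
  by rewrite !gt_eqF// subr_gt0.
(* Summands are required to be bounded and measurable for every index; 0 is a
   default off the roots. *)
pose N' u := if u \in Phi then N u else fun=> 0.
have bN' u : bm (N' u).
  by rewrite /N'; case: ifPn => [/WN[]//|_]; exact: bm_cst.
pose H x := tau * ev (energy_density Phi kappa p p) x + 2 / tau * M x +
  \sum_(u <- Phi) kappa u * N' u x.
have bE := bmZ tau (bm_ev (energy_density Phi kappa p p)).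
have bM2 := bmZ (2 / tau) bM.
have bS : bm (fun x => \sum_(u <- Phi) kappa u * N' u x).
  by apply: bm_sum => u; exact: bmZ.
have -> : tau * energy p + 2 / tau * dispersion (ev p) y +
    K * (W P / (1 - eps) + 2 * dispersion (ev p) y / (eps ^+ 2 * tau)) = W H.
  rewrite (weighted_sphere_intD (bmD bE bM2) bS) (weighted_sphere_intD bE bM2) (weighted_sphere_intZ _ (bm_ev _)) (weighted_sphere_intZ _ bM).
  rewrite (@weighted_sphere_int_sum _ Phi (fun u x => kappa u * N' u x)).
    congr (_ + _); rewrite /K mulr_suml !big_seq; apply: eq_bigr => u uPhi.
    by rewrite weighted_sphere_intZ// /N' uPhi (WN u uPhi).2.
  by move=> u; exact: bmZ.
apply: le_weighted_sphere_int; [exact: bm_ev|exact: (bmD (bmD bE bM2) bS)|].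
move=> x Sx; apply: le_trans (energy_density_sqr_le p Sx Sy tau0 e0 e1) _.
rewrite le_eqVlt; apply/orP; left; apply/eqP; congr (_ * _); rewrite /H.
congr (_ + _); rewrite !big_seq; apply: eq_bigr => u uPhi.
by rewrite /N' uPhi /N /P /M; ring.
Qed.

(** If the mass of [p ^+ 2] is concentrated near [y], then the left-hand side
    of [heisenberg_linear] is almost [d - 1 + K] times the mass, while the
    walls contribute only slightly more than [K] times the mass. *)
Lemma heisenberg p y tau : (2 <= d)%N -> sphere R d y -> 0 < tau ->
  2^-1 * W (fun x => ev p x ^+ 2) <= (d%:R - 1 + K) * dispersion (ev p) y +
    tau * energy p + (2 + 2 * K * (2 * K + 3) ^+ 2) * (dispersion (ev p) y / tau).
Proof.
move=> d2 Sy tau0; have K0 := sum_multiplicity_ge0.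
(* With this value [K / (1 - eps)] is at most [K + 1 / 2]. Since [d - 1] is at
   least 1, half of the mass remains. *)
pose eps : R := (2 * K + 3)^-1.
have K3 : 0 < 2 * K + 3 by lra.
have e0 : 0 < eps by rewrite invr_gt0.
have e1 : eps < 1 by rewrite invf_lt1//; lra.
have := heisenberg_linear p Sy tau0 e0 e1.
set P := W (fun x => ev p x ^+ 2); set D := dispersion _ _; set E := energy p.
have P0 : 0 <= P by apply: weighted_sphere_int_ge0 => x _; exact: sqr_ge0.
have bP : bm (fun x => ev p x ^+ 2) by exact/bmX/bm_ev.
have -> : W (fun x => ev p x ^+ 2 * dot x y) = P - D.
  apply/esym/eqP; rewrite subr_eq; apply/eqP.
  have bPy := bmM bP (bm_dot y).
  rewrite /P /D /dispersion -(weighted_sphere_intD bPy (bmM (bmB (bm_cst 1) (bm_dot y)) bP)).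
  by apply: eq_weighted_sphere_int => x _; ring.
have -> : (eps ^+ 2 * tau) = tau / (2 * K + 3) ^+ 2 by rewrite /eps; field; rewrite !gt_eqF.
have -> : P / (1 - eps) = P + P / (2 * K + 2).
  by rewrite /eps; field; rewrite !gt_eqF//; lra.
have hK : K * (P / (2 * K + 2)) <= P / 2.
  rewrite mulrA ler_pdivrMr; last by lra.
  by have := mulr_ge0 K0 P0; lra.
have -> : 2 * D / (tau / (2 * K + 3) ^+ 2) = 2 * (2 * K + 3) ^+ 2 * (D / tau).
  by field; rewrite !gt_eqF.
have -> : 2 / tau * D = 2 * (D / tau) by ring.
have dP : P <= (d%:R - 1) * P.
  rewrite ler_peMl//; have : (2 : R) <= d%:R by rewrite (ler_nat R 2).
  by move=> ?; lra.
have -> : (2 + 2 * K * (2 * K + 3) ^+ 2) * (D / tau) =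
  2 * (D / tau) + K * (2 * (2 * K + 3) ^+ 2 * (D / tau)) by ring.
rewrite [K * (_ + _ + _)]mulrDr [K * (_ + _)]mulrDr [_ * (P - D)]mulrBr [(_ + K) * P]mulrDl.
by lra.
Qed.

End Heisenberg.

(** * The weighted L2 space *)

Section WeightedL2.
Context {R : realType} {d : nat}.
Variable sigma : {measure set (rV_borel R d) -> \bar R}.
Hypothesis sigmaP : surface_measure sigma.
Local Notation bm := bounded_measurable.
Local Notation S := (sphere R d : set (rV_borel R d)).

Variable h : 'rV[R]_d -> R.
Hypothesis bh : bm (fun x => h x ^+ 2).
Implicit Types (f g : 'rV[R]_d -> R) (c : R).

Local Notation L2 := (in_L2 sigma h).
Local Notation "''[' f , g ]" := (inner sigma h f g).

Lemma measurable_L2 f : L2 f -> measurable_fun S (f : rV_borel R d -> R).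
Proof. by case. Qed.

Lemma integrable_L2 f g : L2 f -> L2 g ->
  sigma.-integrable S (EFin \o (fun x => f x * g x * h x ^+ 2)%R).
Proof.
move=> [mf If] [mg Ig]; have mS := @measurable_sphere R d.
have mh : measurable_fun S ((fun x => h x ^+ 2) : rV_borel R d -> R) by case: bh.
have sq u : measurable_fun S (u : rV_borel R d -> R) ->
    (\int[sigma]_(x in S) (`|u x| ^+ 2 * h x ^+ 2)%:E < +oo)%E ->
    sigma.-integrable S (EFin \o (fun x => `|u x| ^+ 2 * h x ^+ 2)).
  move=> mu Iu; apply/integrableP; split.
    apply/measurable_EFinP; apply: measurable_funM => //.
    by apply: measurable_funX; exact: measurableT_comp.
  apply: le_lt_trans Iu; rewrite le_eqVlt; apply/orP; left; apply/eqP.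
  by apply: eq_integral => x _ /=; rewrite ger0_norm// mulr_ge0// sqr_ge0.
apply: (@le_integrable _ _ _ sigma S mS _
  (EFin \o (fun x => `|f x| ^+ 2 * h x ^+ 2 + `|g x| ^+ 2 * h x ^+ 2))).
- apply/measurable_EFinP; apply: measurable_funM => //; exact: measurable_funM.
- move=> x Sx; rewrite /= lee_fin [leRHS]ger0_norm; last first.
    by rewrite addr_ge0// mulr_ge0// sqr_ge0.
  rewrite -mulrDl normrM [X in _ * X]ger0_norm ?sqr_ge0// ler_wpM2r ?sqr_ge0//.
  rewrite normrM; have := sqr_ge0 (`|f x| - `|g x|).
  by have := mulr_ge0 (normr_ge0 (f x)) (normr_ge0 (g x)); nra.
- rewrite (_ : _ \o _ = (EFin \o (fun x => `|f x| ^+ 2 * h x ^+ 2)%R) \+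
    (EFin \o (fun x => `|g x| ^+ 2 * h x ^+ 2)%R))%E//.
  by apply: integrableD => //; exact: sq.
Qed.

Lemma L2_integrableP f : measurable_fun S (f : rV_borel R d -> R) ->
  sigma.-integrable S (EFin \o (fun x => f x * f x * h x ^+ 2)%R) -> L2 f.
Proof.
move=> mf /integrableP[_ If]; split => //; apply: le_lt_trans If.
rewrite le_eqVlt; apply/orP; left; apply/eqP; apply: eq_integral => x _ /=.
by rewrite -expr2 normrM normrX [X in _ = (_ * X)%:E]ger0_norm ?sqr_ge0.
Qed.

Lemma L2_bm f : bm f -> L2 f.
Proof.
move=> bf; apply: L2_integrableP; first by case: bf.
exact: (bm_integrable sigmaP (bmM (bmM bf bf) bh)).
Qed.

Lemma eq_L2 f g : (forall x, sphere R d x -> f x = g x) -> L2 f -> L2 g.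
Proof.
move=> fg [mf If]; split.
  by apply: eq_measurable_fun mf => x /set_mem; exact: fg.
apply: le_lt_trans If; rewrite le_eqVlt; apply/orP; left; apply/eqP.
by apply: eq_integral => x /set_mem Sx; rewrite fg.
Qed.

Lemma L2D f g : L2 f -> L2 g -> L2 (fun x => f x + g x).
Proof.
move=> lf lg; have mS := @measurable_sphere R d; apply: L2_integrableP.
  by apply: measurable_funD; exact: measurable_L2.
have ff := integrable_L2 lf lf; have fg := integrable_L2 lf lg; have gg := integrable_L2 lg lg.
rewrite (_ : _ \o _ = (EFin \o (fun x => f x * f x * h x ^+ 2)%R) \+
    ((EFin \o (fun x => f x * g x * h x ^+ 2)%R) \+
     ((EFin \o (fun x => f x * g x * h x ^+ 2)%R) \+
      (EFin \o (fun x => g x * g x * h x ^+ 2)%R))))%E.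
  by do 3 apply: integrableD => //.
by apply/funext => x /=; rewrite -!EFinD; congr EFin; ring.
Qed.

Lemma L2Z c f : L2 f -> L2 (fun x => c * f x).
Proof.
move=> lf; have mS := @measurable_sphere R d; apply: L2_integrableP.
  by apply: measurable_funM => //; exact: measurable_L2.
have ff := integrable_L2 lf lf.
rewrite (_ : _ \o _ = (fun x => ((c * c)%R%:E * (EFin \o (fun x => f x * f x * h x ^+ 2)%R) x)%E)).
  exact: integrableZl.
by apply/funext => x /=; rewrite -!EFinM; congr EFin; ring.
Qed.

Lemma L2B f g : L2 f -> L2 g -> L2 (fun x => f x - g x).
Proof.
move=> lf lg; apply: (@eq_L2 (fun x => f x + (-1) * g x)).
  by move=> x _; rewrite mulN1r.
by apply: L2D => //; exact: L2Z.
Qed.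

Lemma L2_sum (J : Type) (r : seq J) (F : J -> 'rV[R]_d -> R) :
  (forall i, L2 (F i)) -> L2 (fun x => \sum_(i <- r) F i x).
Proof.
move=> lF; elim: r => [|i r ih].
  by apply: (@eq_L2 (fun=> 0)); [move=> x _; rewrite big_nil|exact/L2_bm/bm_cst].
apply: (@eq_L2 (fun x => F i x + \sum_(i <- r) F i x)); last exact: L2D.
by move=> x _; rewrite big_cons.
Qed.

Lemma innerC f g : '[f, g] = '[g, f].
Proof. by apply: eq_Rintegral => x _; rewrite (mulrC (f x)). Qed.

Lemma eq_inner f f' g g' : (forall x, sphere R d x -> f x = f' x) ->
  (forall x, sphere R d x -> g x = g' x) -> '[f, g] = '[f', g'].
Proof. by move=> ff gg; apply: eq_Rintegral => x /set_mem Sx; rewrite ff ?gg. Qed.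

Lemma innerDl f g u : L2 f -> L2 g -> L2 u -> '[fun x => f x + g x, u] = '[f, u] + '[g, u].
Proof.
move=> lf lg lu; rewrite /inner /weighted_int.
rewrite -RintegralD; [|exact: measurable_sphere|exact: integrable_L2|exact: integrable_L2].
by apply: eq_Rintegral => x _; rewrite !mulrDl.
Qed.

Lemma innerZl c f u : L2 f -> L2 u -> '[fun x => c * f x, u] = c * '[f, u].
Proof.
move=> lf lu; rewrite /inner /weighted_int.
rewrite -RintegralZl; [|exact: measurable_sphere|exact: integrable_L2].
by apply: eq_Rintegral => x _; rewrite !mulrA.
Qed.

Lemma innerBl f g u : L2 f -> L2 g -> L2 u -> '[fun x => f x - g x, u] = '[f, u] - '[g, u].
Proof.
move=> lf lg lu; rewrite -[X in _ - X]mul1r -mulNr -innerZl// -innerDl//; last exact: L2Z.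
by apply: eq_inner => // x _; rewrite mulN1r.
Qed.

Lemma innerDr f g u : L2 f -> L2 g -> L2 u -> '[u, fun x => f x + g x] = '[u, f] + '[u, g].
Proof. by move=> *; rewrite innerC innerDl// !(innerC u). Qed.

Lemma innerZr c f u : L2 f -> L2 u -> '[u, fun x => c * f x] = c * '[u, f].
Proof. by move=> *; rewrite innerC innerZl// (innerC u). Qed.

Lemma innerBr f g u : L2 f -> L2 g -> L2 u -> '[u, fun x => f x - g x] = '[u, f] - '[u, g].
Proof. by move=> *; rewrite innerC innerBl// !(innerC u). Qed.

Lemma inner_suml (J : Type) (r : seq J) (F : J -> 'rV[R]_d -> R) u :
  (forall i, L2 (F i)) -> L2 u ->
  '[fun x => \sum_(i <- r) F i x, u] = \sum_(i <- r) '[F i, u].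
Proof.
move=> lF lu; elim: r => [|i r ih].
  rewrite big_nil; transitivity (0 * '[u, u]); last by rewrite mul0r.
  by rewrite -innerZl//; apply: eq_inner => // x _; rewrite big_nil mul0r.
rewrite big_cons -ih -innerDl//; last exact: L2_sum.
by apply: eq_inner => // x _; rewrite big_cons.
Qed.

Lemma inner_ge0 f : 0 <= '[f, f].
Proof.
by apply: Rintegral_ge0 => x _; rewrite mulr_ge0 ?sqr_ge0// -expr2 sqr_ge0.
Qed.

Lemma inner_sqrB f g : L2 f -> L2 g ->
  '[fun x => f x - g x, fun x => f x - g x] = '[f, f] - 2 * '[f, g] + '[g, g].
Proof.
move=> lf lg; rewrite innerBl//; last exact: L2B.
by rewrite !innerBr// (innerC g f); ring.
Qed.

Lemma inner_sqrD f g : L2 f -> L2 g ->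
  '[fun x => f x + g x, fun x => f x + g x] = '[f, f] + 2 * '[f, g] + '[g, g].
Proof.
move=> lf lg; rewrite innerDl//; last exact: L2D.
by rewrite !innerDr// (innerC g f); ring.
Qed.

Lemma inner_cauchy_schwarz f g : L2 f -> L2 g -> '[f, g] ^+ 2 <= '[f, f] * '[g, g].
Proof.
move=> lf lg.
have H c : 0 <= '[f, f] - 2 * c * '[f, g] + c ^+ 2 * '[g, g].
  have lcg := L2Z c lg; have := inner_ge0 (fun x => f x - c * g x).
  rewrite inner_sqrB// innerZr// innerZl// innerZr//.
  by congr (0 <= _); ring.
have [g0|g0] := eqVneq '[g, g] 0.
  have [->|fg] := eqVneq '[f, g] 0; first by rewrite g0 expr0n mulr0.
  have := H (('[f, f] + 1) / (2 * '[f, g])); rewrite g0.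
  have -> : '[f, f] - 2 * (('[f, f] + 1) / (2 * '[f, g])) * '[f, g] +
    (('[f, f] + 1) / (2 * '[f, g])) ^+ 2 * 0 = -1 by field.
  by rewrite lerNr oppr0 ler10.
have gp : 0 < '[g, g] by rewrite lt_def g0 inner_ge0.
have := mulr_ge0 (ltW gp) (H ('[f, g] / '[g, g])).
have -> : '[g, g] * ('[f, f] - 2 * ('[f, g] / '[g, g]) * '[f, g] +
    ('[f, g] / '[g, g]) ^+ 2 * '[g, g]) = '[f, f] * '[g, g] - '[f, g] ^+ 2.
  by field.
by rewrite subr_ge0.
Qed.

Lemma inner_null f g : L2 f -> L2 g -> '[f, f] = 0 -> '[f, g] = 0.
Proof.
move=> lf lg f0; have := inner_cauchy_schwarz lf lg; rewrite f0 mul0r => fg.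
by apply/eqP; rewrite -sqrf_eq0 eq_le fg sqr_ge0.
Qed.

Lemma L2_ev (p : mpoly d R) : L2 (ev p).
Proof. exact/L2_bm/bm_ev. Qed.

(** The Gram-Schmidt process for a family that may be dependent in L2. That [p]
    lies in the span of [s] is recorded by [V], a subspace that contains [s],
    and by the annihilator of [s]. *)
Lemma orth_projection_span (V : mpoly d R -> Prop) (s : seq (mpoly d R)) :
  V 0 -> (forall c p q, V p -> V q -> V (p + c *: q)) -> (forall p, p \in s -> V p) ->
  forall f, L2 f -> exists p, [/\ V p,
    forall g, L2 g -> (forall q, q \in s -> '[g, ev q] = 0) -> '[g, ev p] = 0 &
    forall q, q \in s -> '[fun x => f x - ev p x, ev q] = 0].
Proof.
move=> V0 VD; elim: s => [_ f lf|m s ih Vs f lf].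
  exists 0; split => // g lg _.
  transitivity (0 * '[g, g]); last by rewrite mul0r.
  by rewrite -innerZr//; apply: eq_inner => // x _; rewrite ev0 mul0r.
have {}ih := ih (fun p ps => Vs p (mem_behead (s := m :: s) ps)).
have Vm : V m by apply: Vs; rewrite mem_head.
have [p0 [Vp0 p0s fp0]] := ih f lf.
have [q0 [Vq0 q0s mq0]] := ih (ev m) (L2_ev m).
pose m' := m - q0.
have em' x : ev m' x = ev m x - ev q0 x by rewrite evB.
have Vm' : V m' by have := VD (-1) _ _ Vm Vq0; rewrite scaleN1r.
have m's q : q \in s -> '[ev m', ev q] = 0.
  by move=> qs; rewrite -(mq0 q qs); apply: eq_inner => // x _.
have g_m' g : L2 g -> (forall q, q \in m :: s -> '[g, ev q] = 0) -> '[g, ev m'] = 0.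
  move=> lg gs; rewrite (@eq_inner _ g _ (fun x => ev m x - ev q0 x))// innerBr//; try exact: L2_ev.
  by rewrite gs ?mem_head// q0s ?subrr// => q qs; apply: gs; rewrite inE qs orbT.
have lp0 : L2 (fun x => f x - ev p0 x) by apply: L2B => //; exact: L2_ev.
(* A null vector [m'] adds nothing to the span in L2. *)
pose c := if '[ev m', ev m'] == 0 then 0 else '[fun x => f x - ev p0 x, ev m'] / '[ev m', ev m'].
exists (p0 + c *: m').
have ep x : ev (p0 + c *: m') x = ev p0 x + c * ev m' x by rewrite evD evZ.
have lm' := L2_ev m'; have lcm := L2Z c lm'.
have fpm' : '[fun x => f x - ev (p0 + c *: m') x, ev m'] = 0.
  rewrite (@eq_inner _ (fun x => (f x - ev p0 x) - c * ev m' x) _ (ev m'))//; last first.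
    by move=> x _; rewrite ep; ring.
  rewrite innerBl// innerZl// /c; case: eqP => [m0|/eqP m0]; last by rewrite divfK// subrr.
  by rewrite mul0r subr0 innerC; exact: inner_null.
have fps q : q \in s -> '[fun x => f x - ev (p0 + c *: m') x, ev q] = 0.
  move=> qs; rewrite (@eq_inner _ (fun x => (f x - ev p0 x) - c * ev m' x) _ (ev q))//; last first.
    by move=> x _; rewrite ep; ring.
  have lq := L2_ev q.
  by rewrite innerBl// innerZl// fp0// m's// mulr0 subrr.
split; first exact: VD.
  move=> g lg gs; rewrite (@eq_inner _ g _ (fun x => ev p0 x + c * ev m' x))//.
  rewrite innerDr//; last exact: L2_ev.
  rewrite innerZr// g_m'// mulr0 addr0 p0s// => q qs.
  by apply: gs; rewrite inE qs orbT.
move=> q; rewrite inE => /orP[/eqP ->|]; last exact: fps.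
rewrite (@eq_inner _ (fun x => f x - ev (p0 + c *: m') x) _ (fun x => ev m' x + ev q0 x))//.
  have lf' : L2 (fun x => f x - ev (p0 + c *: m') x) by apply: L2B => //; exact: L2_ev.
  by rewrite innerDr ?fpm' ?add0r//; [exact: q0s|exact: L2_ev].
by move=> x _; rewrite em' subrK.
Qed.

Lemma orth_projection n f : L2 f -> exists2 p, (msize p <= n)%N &
  forall q, (msize q <= n)%N -> '[fun x => f x - ev p x, ev q] = 0.
Proof.
move=> lf; pose s : seq (mpoly d R) := [seq mpolyX R (val m) | m : bmultinom d n].
have sP q : q \in s -> (msize q <= n)%N.
  by case/mapP => m _ ->; rewrite msizeX; exact: bmdeg.
have V0 : (msize (0 : mpoly d R) <= n)%N by rewrite msize0.
have VD c (p q : mpoly d R) : (msize p <= n)%N -> (msize q <= n)%N -> (msize (p + c *: q) <= n)%N.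
  by move=> hp hq; rewrite msize_add// msize_scale.
have [p [hp _ fp]] := @orth_projection_span (fun p => (msize p <= n)%N) s V0 VD sP f lf.
exists p => // q hq; have lf' : L2 (fun x => f x - ev p x) by apply: L2B => //; exact: L2_ev.
rewrite (@eq_inner _ (fun x => f x - ev p x) _ (fun x => \sum_(m : bmultinom d n) ev (mcoeff m q *: mpolyX R (val m)) x))//.
  rewrite innerC inner_suml//; last by move=> m; exact: L2_ev.
  rewrite big1// => m _.
  rewrite (@eq_inner _ (fun x => mcoeff m q * ev (mpolyX R (val m)) x) _ (fun x => f x - ev p x))//.
    have lm := L2_ev (mpolyX R (val m)).
    by rewrite innerZl// innerC fp ?mulr0//; apply: map_f; rewrite mem_enum.
  by move=> x _; rewrite evZ.
by move=> x _; rewrite {1}(mpolywE hq) ev_sum.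
Qed.

End WeightedL2.

(** * Expansion in h-harmonics *)

Section Spectral.
Context {R : realType} {d : nat}.
Variable sigma : {measure set (rV_borel R d) -> \bar R}.
Hypothesis sigmaP : surface_measure sigma.
Local Notation bm := bounded_measurable.

Variables (Phi : seq 'rV[R]_d) (kappa : 'rV[R]_d -> R).
Hypothesis Phi_kappa : root_multiplicity Phi kappa.
Variable h : 'rV[R]_d -> R.
Hypothesis hP : forall x, h x ^+ 2 = root_weight Phi kappa x.
Implicit Types (f g : 'rV[R]_d -> R) (p q y z : mpoly d R) (n : nat).

Local Notation L := (dunkl_op Phi kappa).
Local Notation W := (weighted_sphere_int sigma Phi kappa).
Local Notation L2 := (in_L2 sigma h).
Local Notation "''[' f , g ]" := (inner sigma h f g).
Local Notation energy := (energy sigma Phi kappa).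
Let K := \sum_(u <- Phi) kappa u.

Let bh : bm (fun x => h x ^+ 2).
Proof. by apply: (eq_bm _ (bm_root_weight Phi_kappa)) => x _; rewrite hP. Qed.

Let l2 p : L2 (ev p) := L2_ev sigmaP bh p.

Lemma weighted_intE F : weighted_int sigma h F = W F.
Proof. by apply: eq_Rintegral => x _; rewrite hP. Qed.

Lemma innerE f g : '[f, g] = W (fun x => f x * g x).
Proof. exact: weighted_intE. Qed.

Definition dunkl_eigenvalue n : R := n%:R * (n%:R + (d%:R - 2 + K)).
Local Notation mu := dunkl_eigenvalue.

Definition dirichlet_form p q : R := W (ev (energy_density Phi kappa p q)).
Local Notation B := dirichlet_form.

Lemma dirichlet_formE p q : B p q = '[ev p, ev (L q)].
Proof. by rewrite innerE; exact: green. Qed.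

Lemma dirichlet_formC p q : B p q = B q p.
Proof.
rewrite /B; apply: eq_weighted_sphere_int => x _; rewrite [LHS]ev_energy_density [RHS]ev_energy_density.
congr (_ * _ + _ * _).
  by apply: eq_bigr => i _; apply: eq_bigr => j _; rewrite mulrC.
by apply: eq_bigr => u _; congr (_ * _); rewrite mulrC.
Qed.

Definition harmonic n y : Prop := (msize y <= n.+1)%N /\
  forall z, (msize z <= n)%N -> '[ev y, ev z] = 0.

(** The Dunkl operator does not raise the degree, and [y] is orthogonal to the
    lower degrees. *)
Lemma inner_lower n q y : harmonic n y -> (msize q <= n)%N -> '[ev y, ev (L q)] = 0.
Proof.
move=> [_ yn]; case: n yn => [|n] yn hq.
  (* The divided differences are chosen polynomials; that the operator sends 0
     to a null vector follows from the symmetry of the form. *)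
  move: hq; rewrite leqn0 msize_poly_eq0 => /eqP ->.
  rewrite -dirichlet_formE dirichlet_formC dirichlet_formE.
  transitivity (0 * '[ev y, ev (L y)]); last by rewrite mul0r.
  by rewrite -(innerZl bh)//; apply: eq_inner => // x _; rewrite ev0 mul0r.
have [q' hq' Lq] := dunkl_op_lower kappa (roots_norm Phi_kappa) hq.
set c := n%:R * _ in Lq.
rewrite (@eq_inner _ _ _ _ _ (ev y) _ (fun x => c * ev q x + ev q' x))//.
rewrite (innerDr bh (L2Z bh c (l2 q)) (l2 q') (l2 y)).
by rewrite (innerZr bh)// yn// yn ?(leqW hq')// mulr0 addr0.
Qed.

(** On degree [n] the operator is the scalar [mu n] up to a polynomial of lower
    degree. As it is symmetric and preserves the lower degrees, this remainder
    is orthogonal to itself if [y] is orthogonal to the lower degrees. *)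
Lemma dirichlet_form_harmonic n y p : harmonic n y -> B p y = mu n * '[ev p, ev y].
Proof.
move=> hy; have [sy yn] := hy.
have [q hq Ly] := dunkl_op_lower kappa (roots_norm Phi_kappa) sy.
rewrite -/K -/(mu n) in Ly.
have Bq r : B r y = mu n * '[ev r, ev y] + '[ev r, ev q].
  rewrite dirichlet_formE (@eq_inner _ _ _ _ _ (ev r) _ (fun x => mu n * ev y x + ev q x))//.
  rewrite (innerDr bh (L2Z bh (mu n) (l2 y)) (l2 q) (l2 r)).
  by rewrite (innerZr bh).
rewrite Bq; have q0 : '[ev q, ev q] = 0.
  have := Bq q; rewrite dirichlet_formC dirichlet_formE (inner_lower hy hq).
  by rewrite innerC yn// mulr0 add0r.
by rewrite [X in _ + X]innerC (inner_null bh (l2 q) (l2 p) q0) addr0.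
Qed.

Lemma harmonic_orth n m y z : harmonic n y -> harmonic m z -> n != m -> '[ev y, ev z] = 0.
Proof.
have H i j a b : harmonic i a -> harmonic j b -> (i < j)%N -> '[ev a, ev b] = 0.
  by move=> [sa _] [_ hb] ij; rewrite innerC; apply: hb; exact: leq_trans sa ij.
move=> hy hz; rewrite neq_ltn => /orP[|mn]; first exact: H.
by rewrite innerC; exact: H mn.
Qed.

Definition partial_sum (ys : nat -> mpoly d R) n : mpoly d R := \sum_(k < n) ys k.

Section PartialSums.
Variable ys : nat -> mpoly d R.
Hypothesis hys : forall n, harmonic n (ys n).
Local Notation s := (partial_sum ys).

Lemma inner_partial_sum f n : L2 f ->
  '[f, ev (s n)] = \sum_(k < n) '[f, ev (ys k)].
Proof.
move=> lf; rewrite (@eq_inner _ _ _ _ _ f _ (fun x => \sum_(k < n) ev (ys k) x))//.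
  rewrite innerC (inner_suml sigmaP bh _ (fun k : 'I_n => l2 (ys k)) lf).
  by apply: eq_bigr => i _; rewrite innerC.
by move=> x _; rewrite ev_sum.
Qed.

Lemma inner_partial_sum_harmonic n k : (k < n)%N ->
  '[ev (s n), ev (ys k)] = '[ev (ys k), ev (ys k)].
Proof.
move=> kn; rewrite innerC inner_partial_sum; last exact: l2.
rewrite (bigD1 (Ordinal kn))//= big1 ?addr0// => j jk.
apply: harmonic_orth (hys _) (hys _) _.
by apply: contraNneq jk => e; apply/eqP/val_inj.
Qed.

Lemma partial_sum_sqr n : '[ev (s n), ev (s n)] = \sum_(k < n) '[ev (ys k), ev (ys k)].
Proof.
rewrite inner_partial_sum; last exact: l2.
by apply: eq_bigr => k _; exact: inner_partial_sum_harmonic.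
Qed.

Lemma dirichlet_form_partial_sum p n :
  B p (s n) = \sum_(k < n) mu k * '[ev p, ev (ys k)].
Proof.
rewrite dirichlet_formC dirichlet_formE innerC inner_partial_sum; last exact: l2.
apply: eq_bigr => k _; rewrite innerC -dirichlet_formE dirichlet_formC.
exact: dirichlet_form_harmonic.
Qed.

Lemma energy_partial_sum n :
  energy (s n) = \sum_(k < n) mu k * '[ev (ys k), ev (ys k)].
Proof.
rewrite -[LHS]/(B (s n) (s n)) dirichlet_form_partial_sum.
by apply: eq_bigr => k _; rewrite inner_partial_sum_harmonic.
Qed.

(** The harmonics need not be the projections of [p]. Expand the energy of the
    difference of [p] and the partial sum, which is nonnegative. *)
Lemma energy_bessel p n : 2 * (\sum_(k < n) mu k * '[ev p, ev (ys k)]) -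
  \sum_(k < n) mu k * '[ev (ys k), ev (ys k)] <= energy p.
Proof.
have : 0 <= B (p - s n) (p - s n).
  by apply: weighted_sphere_int_ge0 => x _; exact: energy_density_ge0 Phi_kappa _ _.
have BB a b c : B (a - b) c = B a c - B b c.
  rewrite !dirichlet_formE (@eq_inner _ _ _ _ _ (fun x => ev a x - ev b x) _ (ev (L c)))//.
    by rewrite (innerBl bh).
  by move=> x _; rewrite evB.
rewrite BB [B p _]dirichlet_formC [B (s n) _]dirichlet_formC !BB.
rewrite [B (s n) p]dirichlet_formC dirichlet_form_partial_sum.
rewrite -[B p p]/(energy p) -[B (s n) (s n)]/(energy (s n)) energy_partial_sum.
by set x := \sum_(k < n) _; set y := \sum_(k < n) _; lra.
Qed.

(** The [ys n] are the projections of [f]: [s n] is then the best approximation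
    of [f] by polynomials of degree less than [n]. *)
Section Projections.
Variable f : 'rV[R]_d -> R.
Hypothesis lf : L2 f.
Hypothesis fys : forall n z, harmonic n z -> '[fun x => f x - ev (ys n) x, ev z] = 0.

Lemma inner_proj_harmonic n : '[f, ev (ys n)] = '[ev (ys n), ev (ys n)].
Proof.
by apply/eqP; rewrite -subr_eq0 -(innerBl bh lf (l2 _) (l2 _)) fys.
Qed.

(** By induction: a polynomial is the sum of one of lower degree and a harmonic
    one. *)
Lemma partial_sum_orth n q : (msize q <= n)%N ->
  '[fun x => f x - ev (s n) x, ev q] = 0.
Proof.
elim: n q => [|n ih] q hq.
  move: hq; rewrite leqn0 msize_poly_eq0 => /eqP ->.
  have lg : L2 (fun x => f x - ev (s 0) x) by exact: L2B.
  rewrite innerC; transitivity (0 * '[ev 0, fun x => f x - ev (s 0) x]); last by rewrite mul0r.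
  by rewrite -(innerZl bh)//; apply: eq_inner => // x _; rewrite ev0 mul0r.
have [r hr qr] := orth_projection sigmaP bh n (l2 q).
have hz : harmonic n (q - r).
  split; first by rewrite msize_sub// (leqW hr).
  move=> z hz; rewrite -(qr z hz); apply: eq_inner => // x _.
  by rewrite evB.
have lg : L2 (fun x => f x - ev (s n.+1) x) by exact: L2B.
rewrite (@eq_inner _ _ _ _ (fun x => f x - ev (s n.+1) x) (fun x => f x - ev (s n.+1) x) _ (fun x => ev (q - r) x + ev r x))//; last first.
  by move=> x _; rewrite evB subrK.
rewrite (innerDr bh)//.
have es x : ev (s n.+1) x = ev (s n) x + ev (ys n) x.
  by rewrite /s /partial_sum big_ord_recr evD.
have -> : '[fun x => f x - ev (s n.+1) x, ev (q - r)] = 0.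
  rewrite (@eq_inner _ _ _ _ (fun x => f x - ev (s n.+1) x) (fun x => (f x - ev (ys n) x) - ev (s n) x) _ (ev (q - r)))//; last first.
    by move=> x _; rewrite es; ring.
  rewrite (innerBl bh)//; last exact: L2B.
  rewrite fys// sub0r innerC inner_partial_sum// big1 ?oppr0// => k _.
  by apply: harmonic_orth hz (hys k) _; rewrite gtn_eqF.
rewrite add0r.
rewrite (@eq_inner _ _ _ _ (fun x => f x - ev (s n.+1) x) (fun x => (f x - ev (s n) x) - ev (ys n) x) _ (ev r))//; last first.
  by move=> x _; rewrite es; ring.
rewrite (innerBl bh)//; last exact: L2B.
by rewrite ih// (hys n).2// subrr.
Qed.

Lemma partial_sum_best n p : (msize p <= n)%N ->
  '[fun x => f x - ev (s n) x, fun x => f x - ev (s n) x] <=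
  '[fun x => f x - ev p x, fun x => f x - ev p x].
Proof.
move=> hp; pose g x := f x - ev (s n) x; have lg : L2 g by exact: L2B.
have hs : (msize (s n) <= n)%N.
  rewrite /partial_sum; apply: (big_ind (fun q => (msize q <= n)%N)).
  - by rewrite msize0.
  - by move=> *; exact: msize_add.
  - by move=> k _; exact: leq_trans (hys k).1 _.
rewrite (@eq_inner _ _ _ _ (fun x => f x - ev p x) (fun x => g x + ev (s n - p) x) (fun x => f x - ev p x) (fun x => g x + ev (s n - p) x)); try by move=> x _; rewrite /g evB; ring.
have og : '[g, ev (s n - p)] = 0 by apply: partial_sum_orth; rewrite msize_sub.
rewrite (inner_sqrD bh lg (l2 _)) og.
by rewrite mulr0 addr0 lerDl inner_ge0.
Qed.

Lemma pythagoras n : '[f, f] = \sum_(k < n) '[ev (ys k), ev (ys k)] +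
  '[fun x => f x - ev (s n) x, fun x => f x - ev (s n) x].
Proof.
rewrite (inner_sqrB bh lf (l2 _)) inner_partial_sum//.
rewrite partial_sum_sqr; under [X in 2 * X]eq_bigr do rewrite inner_proj_harmonic.
by set S := \sum_(k < n) _; ring.
Qed.

End Projections.

End PartialSums.

(** The projection is the difference of the projections onto the polynomials of
    degree at most [n] and of degree less than [n]. *)
Lemma proj_harmonic_ex n f : L2 f -> exists2 y, harmonic n y &
  forall z, harmonic n z -> '[fun x => f x - ev y x, ev z] = 0.
Proof.
move=> lf.
have [p hp fp] := orth_projection sigmaP bh n.+1 lf.
have [q hq fq] := orth_projection sigmaP bh n lf.
have lfp : L2 (fun x => f x - ev p x) by exact: L2B.
have lfq : L2 (fun x => f x - ev q x) by exact: L2B.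
exists (p - q).
  split; first by rewrite msize_sub// (leqW hq).
  move=> z hz; rewrite (@eq_inner _ _ _ _ _ (fun x => (f x - ev q x) - (f x - ev p x)) _ (ev z))//.
    by rewrite (innerBl bh)// fq// fp ?subrr// (leqW hz).
  by move=> x _; rewrite evB; ring.
move=> z [hz zn].
rewrite (@eq_inner _ _ _ _ _ (fun x => (f x - ev p x) + ev q x) _ (ev z))//.
  by rewrite (innerDl bh)// fp// add0r innerC zn.
by move=> x _; rewrite evB; ring.
Qed.

Lemma h_harmonicP n Y : h_harmonic sigma h n Y <->
  exists2 y, harmonic n y & forall x, sphere R d x -> Y x = ev y x.
Proof.
split=> [[[y [hy Yy]] Yn]|[y [hy yn] Yy]].
  exists y => //; split => // z hz.
  rewrite -(Yn (ev z)); last by exists z.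
  by apply: eq_inner => // x Sx; rewrite Yy.
split; first by exists y.
move=> Z [z [hz Zz]]; rewrite (@eq_inner _ _ _ _ Y (ev y) Z (ev z))//; exact: yn.
Qed.

Lemma is_projP n f Y : is_proj sigma h n f Y <->
  exists2 y, harmonic n y /\ (forall x, sphere R d x -> Y x = ev y x) &
    forall z, harmonic n z -> '[fun x => f x - ev y x, ev z] = 0.
Proof.
split=> [[/h_harmonicP[y hy Yy] fY]|[y [hy Yy] fy]].
  exists y => // z hz; rewrite -(fY (ev z)); last by apply/h_harmonicP; exists z.
  by apply: eq_inner => // x Sx; rewrite Yy.
split; first by apply/h_harmonicP; exists y.
move=> Z /h_harmonicP[z hz Zz]; rewrite -(fy z hz).
by apply: eq_inner => // x Sx; rewrite Yy.
Qed.

End Spectral.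

(** * Approximation of Lipschitz functions by polynomials *)

Section SphericalMollifier.
Context {R : realType} {d : nat}.
Implicit Types (x y z : 'rV[R]_d) (p q : mpoly d R) (N : nat) (f : 'rV[R]_d -> R).
Variable sigma : {measure set (rV_borel R d) -> \bar R}.
Hypothesis sigmaP : surface_measure sigma.
Hypothesis d2 : (2 <= d)%N.
Local Notation I := (sphere_int sigma).
Local Notation bm := bounded_measurable.

Let k0 : 'rV[R]_d -> R := fun=> 0.

(** Without roots, Green's formula is that of the unweighted sphere. *)
Lemma root_multiplicity_nil : root_multiplicity ([::] : seq 'rV[R]_d) k0.
Proof. by split. Qed.

Lemma weighted_sphere_int_nil F : weighted_sphere_int sigma [::] k0 F = I F.
Proof. by apply: eq_sphere_int => x _; rewrite /root_weight big_nil mulr1. Qed.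

(** As a function of [y] this is a polynomial that concentrates at [x] for
    large [N]. *)
Definition zonal N x y : R := (1 + dot y x) ^+ N.

Lemma bm_zonal N x : bm (zonal N x).
Proof. exact: (bmX N (bmD (bm_cst 1) (bm_dot x))). Qed.

Lemma zonal_ge0 N x y : sphere R d x -> sphere R d y -> 0 <= zonal N x y.
Proof.
move=> Sx Sy; apply: exprn_ge0; have := dot_sphere_le Sy Sx.
by rewrite ler_norml => /andP[h _]; lra.
Qed.

Lemma rot_deriv_zonal i j N x y :
  ev (rot_deriv i j ((1 + lin_poly x) ^+ N.+1)) y =
  N.+1%:R * zonal N x y * ev (rot_deriv i j (lin_poly x)) y.
Proof.
have r1 : rot_deriv i j (1 + lin_poly x) = rot_deriv i j (lin_poly x).
  by rewrite rot_derivD [X in X + _](_ : _ = 0) ?add0r// /rot_deriv !mderiv1 !mulr0 subrr.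
have e1 : ev (1 + lin_poly x) y = 1 + dot y x by rewrite evD ev1 ev_lin.
elim: N => [|N ih]; first by rewrite expr1 r1 /zonal expr0 !mul1r.
rewrite exprS rot_derivM r1 [LHS]evD [X in X + _]evM [X in _ + X]evM ih e1.
rewrite evX e1 -[N.+2%:R]natr1 /zonal !exprS; ring.
Qed.

(** Green's formula without roots, for the zonal polynomial and the linear form
    [<., x>]. It says that [1 - <y, x>] has mean [(d - 1) / (N + d - 1)] for
    the normalized kernel. *)
Lemma zonal_moment N x : sphere R d x ->
  (N%:R + (d%:R - 1)) * I (fun y => zonal N x y * (1 - dot y x)) =
  (d%:R - 1) * I (zonal N x).
Proof.
move=> Sx; have x1 := (sphereE x).1 Sx.
have bz := bm_zonal N x; have bzd := bmM bz (bm_dot x).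
have bz1 := bmM bz (bmB (bm_cst 1) (bm_dot x)).
have : N%:R * I (fun y => zonal N x y * (1 - dot y x)) =
    (d%:R - 1) * I (fun y => zonal N x y * dot y x).
  have := green sigmaP root_multiplicity_nil ((1 + lin_poly x) ^+ N) (lin_poly x).
  rewrite !weighted_sphere_int_nil -!(sphere_intZ sigmaP)// => e; symmetry.
  transitivity (I (fun y => ev ((1 + lin_poly x) ^+ N) y * ev (dunkl_op [::] k0 (lin_poly x)) y)).
    apply: eq_sphere_int => y Sy; rewrite (ev_dunkl_op_lin root_multiplicity_nil x Sy) big_nil.
    by rewrite evX evD ev1 ev_lin addr0 /zonal; ring.
  rewrite -e; apply: eq_sphere_int => y Sy; rewrite ev_energy_density big_nil mulr0 addr0.
  case: N {bz bzd bz1 e} => [|N].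
    rewrite mul0r big1 ?mulr0// => i _; rewrite big1// => j _.
    by rewrite expr0 [X in X * _]ev_rot_deriv !mderiv1 !ev0 !mulr0 subrr mul0r.
  under eq_bigr do under eq_bigr do rewrite rot_deriv_zonal -mulrA.
  under eq_bigr do rewrite -mulr_sumr.
  rewrite -mulr_sumr mulrCA sum_rot_deriv_lin// euler_lin ev_lin.
  rewrite (_ : \sum_i _ = 1).
    by rewrite /zonal exprS; ring.
  by rewrite -x1; apply: eq_bigr => i _; rewrite mderiv_lin /ev mevalC.
have -> : I (fun y => zonal N x y * dot y x) = I (zonal N x) - I (fun y => zonal N x y * (1 - dot y x)).
  rewrite -(sphere_intB sigmaP)//; apply: eq_sphere_int => y _; ring.
by move=> h; rewrite mulrDl h; ring.
Qed.

Lemma pred_dim_gt0 : 0 < d%:R - 1 :> R.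
Proof. by have : (2 : R) <= d%:R by [rewrite (ler_nat R 2)]; lra. Qed.

(** Since [1 + <y, x>] is [2 - (1 - <y, x>)], [zonal_moment] gives a recursion
    in which [x] does not occur. *)
Lemma zonal_mass N : exists2 c, 0 < c & forall x, sphere R d x -> I (zonal N x) = c.
Proof.
elim: N => [|N [c c0 cE]].
  exists (fine (sigma (sphere R d))); first exact: sigma_gt0.
  move=> x _; rewrite -[RHS]mul1r -(sphere_int_cst sigma 1); apply: eq_sphere_int => y _.
  by rewrite /zonal expr0.
have d1 := pred_dim_gt0.
have Nd : 0 < N%:R + (d%:R - 1) :> R by rewrite ltr_wpDl.
exists ((2 - (d%:R - 1) / (N%:R + (d%:R - 1))) * c).
  rewrite mulr_gt0// subr_gt0 ltr_pdivrMr//.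
  by have := ler0n R N; lra.
move=> x Sx; have := zonal_moment N Sx; rewrite cE// => h.
have bz := bm_zonal N x.
have bz1 := bmM bz (bmB (bm_cst 1) (bm_dot x)).
transitivity (2 * I (zonal N x) - I (fun y => zonal N x y * (1 - dot y x))).
  rewrite -(sphere_intZ sigmaP)// -(sphere_intB sigmaP)//; last exact: bmZ.
  by apply: eq_sphere_int => y _; rewrite /zonal exprS; ring.
have -> : I (fun y => zonal N x y * (1 - dot y x)) = (d%:R - 1) / (N%:R + (d%:R - 1)) * c.
  apply: (mulfI (lt0r_neq0 Nd)); rewrite h; field; exact: lt0r_neq0.
by rewrite cE//; ring.
Qed.

(** The power is expanded one factor at a time, for all [f] at once. *)
Lemma zonal_poly N f : bm f -> exists p, forall x, I (fun y => f y * zonal N x y) = ev p x.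
Proof.
elim: N f => [|N ih] f bf.
  exists (mpolyC d (I f)) => x; rewrite /ev mevalC; apply: eq_sphere_int => y _.
  by rewrite /zonal expr0 mulr1.
have [p0 p0E] := ih f bf.
have /choice[P PE] : forall i : 'I_d, exists p, forall x, I (fun y => (f y * y 0 i) * zonal N x y) = ev p x.
  by move=> i; apply: ih; exact: (bmM bf (bm_coord i)).
exists (p0 + \sum_i mvar i * P i) => x.
rewrite evD -p0E ev_sum.
have bi i : bm (fun y => x 0 i * ((f y * y 0 i) * zonal N x y)).
  exact: (bmZ _ (bmM (bmM bf (bm_coord i)) (bm_zonal N x))).
have bz := bmM bf (bm_zonal N x).
transitivity (I (fun y => f y * zonal N x y + \sum_i x 0 i * ((f y * y 0 i) * zonal N x y))).
  apply: eq_sphere_int => y _; rewrite /zonal exprS mulrDl mul1r mulrDr; congr (_ + _).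
  by rewrite mulrA mulr_sumr mulr_suml; apply: eq_bigr => i _; ring.
rewrite (sphere_intD sigmaP bz (bm_sum _ bi)) (sphere_int_sum sigmaP _ bi); congr (_ + _).
apply: eq_bigr => i _; rewrite evM ev_var -PE (sphere_intZ sigmaP)//.
exact: (bmM (bmM bf (bm_coord i)) (bm_zonal N x)).
Qed.

(** The rotation of the plane of [x] and [z] taking [x] to [z], a product of two
    reflections, moves no point of the sphere much more than it moves [x]. *)
Lemma transitive_rotation x z : sphere R d x -> sphere R d z ->
  exists Q : 'M[R]_d, [/\ orthogonal_mx Q, x *m Q = z &
    forall y, sphere R d y -> enorm (y *m Q - y) <= 2 * enorm (x - z)].
Proof.
move=> /sphereE x1 /sphereE z1.
have ox : orthogonal_mx (reflection_mx x).
  by apply: orthogonal_reflection; rewrite x1 oner_eq0.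
have x0 : reflection x x = - x by rewrite /reflection x1 divr1 mulr1 scalerDl scale1r opprD addNKr.
have [w0|w0] := eqVneq (x + z) 0.
  have zx : z = - x by apply/eqP; rewrite -addr_eq0 addrC w0.
  exists (reflection_mx x); split => //; first by rewrite mul_reflection_mx x0.
  move=> y /sphereE y1; rewrite mul_reflection_mx; apply: enorm_le => //.
  rewrite /reflection zx opprK x1 divr1 addrAC subrr add0r !dotE x1.
  by have := dot_cauchy_schwarz y x; rewrite x1 y1; lra.
have ww : dot (x + z) (x + z) = 2 * (1 + dot x z).
  by rewrite !dotE x1 z1 (dotC z x); ring.
have c1 : 1 + dot x z != 0.
  by apply: contra_neq w0 => c1; apply/eqP; rewrite -dot_eq0 ww c1 mulr0.
have ow : orthogonal_mx (reflection_mx (x + z)).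
  by apply: orthogonal_reflection; rewrite dot_eq0.
exists (reflection_mx x *m reflection_mx (x + z)); split.
- exact: orthogonal_mul.
- rewrite mulmxA !mul_reflection_mx x0 /reflection ww !dotE x1.
  rewrite (_ : 2 * _ / _ = -1); last by field.
  by rewrite scaleN1r opprK addKr.
move=> y /sphereE y1; rewrite mulmxA !mul_reflection_mx.
have cp : 0 < 1 + dot x z.
  by rewrite lt_def c1 -(@pmulr_rge0 _ 2)// -ww dot_ge0.
set a := dot y x; set b := dot y z; set c := dot x z in ww c1 cp *.
have -> : reflection (x + z) (reflection x y) - y =
    (2 * a) *: z - ((a + b) / (1 + c)) *: (x + z).
  rewrite /reflection ww x1 divr1 !dotE -/a -/b -/c x1.
  by apply/rowP => i; rewrite !mxE; field.
apply: enorm_le => //.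
have h1 : (a + b) ^+ 2 <= 2 * (1 + c) by have := dot_cauchy_schwarz y (x + z); rewrite y1 ww !dotE mul1r.
have h2 : (a - b) ^+ 2 <= 2 - 2 * c.
  by have := dot_cauchy_schwarz y (x - z); rewrite y1 !dotE x1 z1 (dotC z x) -/c -/a -/b; lra.
have -> : dot ((2 * a) *: z - ((a + b) / (1 + c)) *: (x + z))
    ((2 * a) *: z - ((a + b) / (1 + c)) *: (x + z)) =
    (a - b) ^+ 2 + (a + b) ^+ 2 * ((1 - c) / (1 + c)).
  by rewrite !dotE x1 z1 (dotC z x) -/c; field.
have h3 : 0 <= 1 - c by have := sqr_ge0 (a - b); lra.
have h4 : (a + b) ^+ 2 * ((1 - c) / (1 + c)) <= 2 * (1 - c).
  apply: le_trans (ler_wpM2r _ h1) _; first by rewrite divr_ge0// ltW.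
  by rewrite le_eqVlt; apply/orP; left; apply/eqP; field.
by rewrite !dotE x1 z1 (dotC z x) -/c; lra.
Qed.

Definition sphere_lipschitz (l : R) f : Prop :=
  forall x y, sphere R d x -> sphere R d y -> `|f x - f y| <= l * enorm (x - y).

(** The polynomial is the normalized convolution with the zonal kernel. A
    rotation that takes [x] to [z] takes one kernel to the other, so that
    [transitive_rotation] bounds the Lipschitz constant, and [zonal_moment]
    bounds the mean distance to [x]. *)
Lemma lipschitz_approximation l f : 0 <= l -> bm f -> sphere_lipschitz l f ->
  forall e, 0 < e -> exists p, sphere_lipschitz (2 * l) (ev p) /\
    forall x, sphere R d x -> `|f x - ev p x| <= e.
Proof.
move=> l0 bf fl e e0; have d1 := pred_dim_gt0.
(* |f x - f y| <= l (t + |x - y|^2 / t), and the second term has mean at most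
   2 (d - 1) / (N t) *)
pose t := e / (2 * (l + 1)).
have t0 : 0 < t by rewrite divr_gt0// mulr_gt0// ltr_wpDl.
have [N NE] : exists N, (d%:R - 1) * 4 * l / (t * e) < N%:R.
  exists (Num.truncn ((d%:R - 1) * 4 * l / (t * e))).+1.
  by apply: truncnS_gt.
have [c c0 cE] := zonal_mass N.
have ci : 0 <= c^-1 by rewrite invr_ge0 ltW.
have [p0 p0E] := zonal_poly N bf.
exists (c^-1 *: p0); split.
  move=> x z Sx Sz; have [Q [oQ xQ yQ]] := transitive_rotation Sx Sz.
  rewrite !evZ -!p0E -mulrBr normrM (ger0_norm ci) ler_pdivrMl//.
  have bk := bm_zonal N; have bfQ := bm_mulmx oQ bf.
  have -> : I (fun y => f y * zonal N z y) = I (fun y => f (y *m Q) * zonal N x y).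
    rewrite -(sphere_int_mulmx sigmaP oQ (bmM bf (bk z))); apply: eq_sphere_int => y _.
    by rewrite /zonal -xQ orthogonal_dot.
  rewrite -(sphere_intB sigmaP (bmM bf (bk x)) (bmM bfQ (bk x))).
  have bD : bm (fun y => f y * zonal N x y - f (y *m Q) * zonal N x y).
    exact: (bmB (bmM bf (bk x)) (bmM bfQ (bk x))).
  apply: le_trans (le_normr_Rintegral _ _) _; [exact: measurable_sphere|exact: bm_integrable|].
  have -> : c * (2 * l * enorm (x - z)) = I (fun y => (2 * l * enorm (x - z)) * zonal N x y).
    by rewrite (sphere_intZ sigmaP)// cE// mulrC.
  apply: (le_sphere_int sigmaP (bm_norm bD) (bmZ _ (bk x))) => y Sy.
  rewrite -mulrBl normrM (ger0_norm (zonal_ge0 N Sx Sy)) ler_wpM2r ?zonal_ge0//.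
  have SyQ := (sphere_orthogonal y oQ).2 Sy.
  rewrite distrC; apply: le_trans (fl _ _ SyQ Sy) _.
  by rewrite [2 * l]mulrC -mulrA ler_wpM2l// yQ.
move=> x Sx; rewrite evZ -p0E.
have bk := bm_zonal N x; have bz1 := bmM bk (bmB (bm_cst 1) (bm_dot x)).
have -> : f x - c^-1 * I (fun y => f y * zonal N x y) = c^-1 * I (fun y => (f x - f y) * zonal N x y).
  have -> : I (fun y => (f x - f y) * zonal N x y) = f x * c - I (fun y => f y * zonal N x y).
    rewrite -(cE x Sx) -(sphere_intZ sigmaP (f x) bk) -(sphere_intB sigmaP (bmZ _ bk) (bmM bf bk)).
    by apply: eq_sphere_int => y _; ring.
  by field; rewrite gt_eqF.
rewrite normrM (ger0_norm ci) ler_pdivrMl//.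
have bD : bm (fun y => (f x - f y) * zonal N x y) by exact: (bmM (bmB (bm_cst _) bf) bk).
apply: le_trans (le_normr_Rintegral _ _) _; [exact: measurable_sphere|exact: bm_integrable|].
pose G y := l * t * zonal N x y + 2 * l / t * (zonal N x y * (1 - dot y x)).
have bG : bm G by exact: (bmD (bmZ _ bk) (bmZ _ bz1)).
apply: le_trans (le_sphere_int sigmaP (bm_norm bD) bG _) _.
  move=> y Sy; have zp := zonal_ge0 N Sx Sy.
  rewrite normrM (ger0_norm zp).
  have -> : G y = (l * t + 2 * l / t * (1 - dot y x)) * zonal N x y by rewrite /G; ring.
  rewrite ler_wpM2r//; apply: le_trans (fl _ _ Sx Sy) _.
  have -> : l * t + 2 * l / t * (1 - dot y x) = l * (t + 2 * (1 - dot y x) / t) by ring.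
  rewrite ler_wpM2l//.
  have -> : 2 * (1 - dot y x) = enorm (x - y) ^+ 2.
    by rewrite enorm_sqr !dotE ((sphereE x).1 Sx) ((sphereE y).1 Sy) (dotC x y); ring.
  set r := enorm _; have r0 : 0 <= r by exact: enorm_ge0.
  rewrite -subr_ge0 (_ : _ - r = ((t - r) ^+ 2 + t * r) / t); last by field; rewrite gt_eqF.
  by rewrite divr_ge0 ?(ltW t0)// addr_ge0 ?sqr_ge0// mulr_ge0// ltW.
rewrite /G (sphere_intD sigmaP (bmZ _ bk) (bmZ _ bz1)) (sphere_intZ sigmaP _ bk) (sphere_intZ sigmaP _ bz1) cE//.
have Nd : 0 < N%:R + (d%:R - 1) :> R by rewrite ltr_wpDl.
have -> : I (fun y => zonal N x y * (1 - dot y x)) = (d%:R - 1) / (N%:R + (d%:R - 1)) * c.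
  apply: (mulfI (lt0r_neq0 Nd)); rewrite (zonal_moment N Sx) cE//; field; exact: lt0r_neq0.
rewrite [c * e]mulrC [2 * l / t * (_ * c)]mulrA -mulrDl ler_wpM2r ?(ltW c0)//.
have h1 : l * t <= e / 2.
  rewrite /t mulrA ler_pdivrMr ?mulr_gt0 ?ltr_wpDl//.
  by have := mulr_ge0 l0 (ltW e0); lra.
have te : 0 < t * e by rewrite mulr_gt0.
have h2 : 2 * l / t * ((d%:R - 1) / (N%:R + (d%:R - 1))) <= e / 2.
  have -> : 2 * l / t * ((d%:R - 1) / (N%:R + (d%:R - 1))) =
     (2 * l * (d%:R - 1) / t) / (N%:R + (d%:R - 1)) by field; rewrite !gt_eqF.
  rewrite ler_pdivrMr//.
  have : (d%:R - 1) * 4 * l / (t * e) <= N%:R + (d%:R - 1) by apply/ltW/(lt_trans NE); rewrite ltrDl.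
  rewrite ler_pdivrMr// => h3; rewrite ler_pdivrMr//.
  by move: h3; rewrite mulrA; lra.
by lra.
Qed.

End SphericalMollifier.

(** * C1 functions on the sphere are Lipschitz *)

Section C1Sphere.
Context {R : realType} {d : nat}.
Implicit Types (x y z v : 'rV[R]_d) (f : 'rV[R]_d -> R) (i j : 'I_d).
Local Notation bm := bounded_measurable.

(** It avoids the origin, where the extension of degree 0 is singular, and
    contains the chord between two points of the sphere at distance at most 1.
    *)
Definition annulus : set 'rV[R]_d := [set z | 4^-1 <= dot z z <= 1].

Lemma dot_self_continuous : continuous (fun z : 'rV[R]_d => dot z z).
Proof.
apply: continuous_big => [|i _ z]; first exact: add_continuous.
by apply: (@continuousM _ _ (fun z : 'rV[R]_d => z 0 i) (fun z => z 0 i));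
  exact: coord_continuous.
Qed.

Lemma annulus_compact : compact annulus.
Proof.
apply: bounded_closed_compact.
  exists 1; split; first exact: num_real.
  move=> M M1 z /= /andP[_ zz].
  rewrite [leLHS]/Num.norm /= mx_normrE; apply: bigmax_le; first by rewrite ltW// (le_lt_trans _ M1).
  move=> [i j] _ /=; rewrite (ord1 i); apply: le_trans (ltW M1).
  rewrite -(@expr_le1 _ 2)// real_normK ?num_real//; apply: le_trans zz.
  exact: sqr_coord_le.
rewrite (_ : annulus = (fun z => dot z z) @^-1` `[4^-1, 1]%classic).
  apply: preimage_closed; last exact: interval_closed.
  by move=> z _; exact: dot_self_continuous.
by apply/seteqP; split => z /=; rewrite in_itv.
Qed.

Lemma annulus_neq0 z : annulus z -> z != 0.
Proof.
move=> /andP[h _]; apply/eqP => z0; move: h.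
rewrite z0; have -> : dot (0 : 'rV[R]_d) 0 = 0 by apply/eqP; rewrite dot_eq0.
by rewrite leNgt invr_gt0 ltr0n.
Qed.

Lemma annulus_bounded f : (forall z, z != 0 -> {for z, continuous f}) ->
  exists M, forall z, annulus z -> `|f z| <= M.
Proof.
move=> cf.
have cA : {within annulus, continuous f}.
  by apply: continuous_in_subspaceT => z /set_mem /annulus_neq0; exact: cf.
have [M [_ MP]] := compact_bounded (continuous_compact cA annulus_compact).
by exists (M + 1) => z Az; apply: MP; [rewrite ltrDl|exists z].
Qed.

Lemma sphere_annulus x : sphere R d x -> annulus x.
Proof. by move=> /sphereE; rewrite /annulus /= => ->; rewrite lexx andbT invf_le1// ler1n. Qed.

Lemma derive_line (F : 'rV[R]_d -> R) x v t : differentiable F (x + t *: v) ->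
  is_derive t 1 (fun s => F (x + s *: v)) ('D_v F (x + t *: v)).
Proof.
move=> dF.
have e : (fun h : R => h^-1 *: (((fun s => F (x + s *: v)) \o shift t) (h *: 1) - F (x + t *: v))) =
    (fun h => h^-1 *: ((F \o shift (x + t *: v)) (h *: v) - F (x + t *: v))).
  apply/funext => h /=; congr (_ *: (F _ - _)).
  by rewrite [h%:A]mulr1 scalerDl addrCA.
split; first by rewrite /derivable e; exact: (@diff_derivable R _ _ F (x + t *: v) v dF).
by rewrite /derive e.
Qed.

Lemma derive_le (F : 'rV[R]_d -> R) z v (M : 'I_d -> R) : differentiable F z ->
  (forall i, `|'D_(delta_mx 0 i) F z| <= M i) ->
  `|'D_v F z| <= (\sum_i M i) * enorm v.
Proof.
move=> dF DM; rewrite deriveE// {1}(row_sum_delta v) linear_sum mulr_suml.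
apply: le_trans (ler_norm_sum _ _ _) _; apply: ler_sum => i _.
rewrite linearZ /= normrM mulrC ler_pM// -?deriveE//.
rewrite -(@ler_pXn2r _ 2)// ?nnegrE ?enorm_ge0// enorm_sqr real_normK ?num_real//.
exact: sqr_coord_le.
Qed.

Lemma homogeneous_ext_sphere f x : sphere R d x -> homogeneous_ext f x = f x.
Proof. by rewrite /homogeneous_ext /sphere /= => ->; rewrite invr1 scale1r. Qed.

(** For close points use the mean value theorem on the chord, with the bound
    that compactness of the annulus gives for the partial derivatives; for
    distant points the boundedness of [f] suffices. *)
Lemma C1_sphere_lipschitz f : C1_sphere f ->
  bm f /\ exists2 l, 0 <= l & sphere_lipschitz l f.
Proof.
move=> Cf; set F := homogeneous_ext f.
have dF z : z != 0 -> differentiable F z by move=> /Cf[].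
have cF z : z != 0 -> {for z, continuous F}.
  by move=> /dF; exact: differentiable_continuous.
have FE x : sphere R d x -> F x = f x by exact: homogeneous_ext_sphere.
have [M0 M0P] := annulus_bounded cF.
have fM x : sphere R d x -> `|f x| <= M0.
  by move=> Sx; rewrite -FE// M0P//; exact: sphere_annulus.
split.
  split; last by exists M0.
  have oU : open [set z : 'rV[R]_d | z != 0].
    rewrite (_ : mkset _ = (fun z => dot z z) @^-1` [set r | 0 < r]).
      apply: open_comp; last exact: open_gt.
      by move=> z _; exact: dot_self_continuous.
    by apply/seteqP; split => z /=; rewrite lt_def dot_ge0 andbT dot_eq0.
  have mU := @borel_continuous_on_measurable R d _ F oU cF.
  have mS : measurable_fun (sphere R d : set (rV_borel R d)) (F : rV_borel R d -> R).
    apply: (measurable_funS _ _ mU).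
      by apply: sub_sigma_algebra.
    by move=> x /sphere_annulus/annulus_neq0.
  by apply: eq_measurable_fun mS => x /set_mem; exact: FE.
have /choice[M MP] : forall i, exists M, forall z, annulus z -> `|'D_(delta_mx 0 i) F z| <= M.
  by move=> i; apply: annulus_bounded => z /Cf[_]; apply.
exists (\sum_i `|M i| + 2 * `|M0|).
  by rewrite addr_ge0 ?mulr_ge0// sumr_ge0.
move=> x y Sx Sy; have x1 := (sphereE x).1 Sx; have y1 := (sphereE y).1 Sy.
rewrite mulrDl; have r0 := enorm_ge0 (x - y).
have S0 : 0 <= \sum_i `|M i| by exact: sumr_ge0.
have [r1|r1] := leP (enorm (x - y)) 1; last first.
  apply: le_trans (_ : 2 * `|M0| * 1 <= _).
    rewrite mulr1; apply: le_trans (ler_normB _ _) _.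
    have := fM x Sx; have := fM y Sy; have := ler_norm M0; lra.
  by rewrite -[leLHS]add0r lerD ?mulr_ge0// ler_wpM2l ?mulr_ge0// ltW.
rewrite -[leLHS]addr0 lerD ?mulr_ge0//.
pose v := y - x.
have zA t : 0 <= t <= 1 -> annulus (x + t *: v).
  move=> /andP[t0 t1].
  have rr : dot (x - y) (x - y) <= 1 by rewrite -enorm_sqr expr_le1.
  have -> : x + t *: v = x + t *: (y - x) by [].
  have e : dot (x + t *: (y - x)) (x + t *: (y - x)) = 1 - t * (1 - t) * dot (x - y) (x - y).
    by rewrite !dotE x1 y1 (dotC y x); ring.
  rewrite /annulus /= e.
  have h0 := dot_ge0 (x - y).
  have tt : 0 <= t * (1 - t) by rewrite mulr_ge0// subr_ge0.
  have h1 := mulr_ge0 tt h0.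
  have h2 : t * (1 - t) * dot (x - y) (x - y) <= t * (1 - t) by rewrite ler_piMr.
  have h3 : t * (1 - t) <= 4^-1 by have := sqr_ge0 (t - 2^-1); lra.
  by apply/andP; split; lra.
have [] := @MVT_segment R (fun t => F (x + t *: v)) (fun t => 'D_v F (x + t *: v)) 0 1 ler01.
- move=> t; rewrite in_itv /= => /andP[t0 t1].
  by apply: derive_line; apply/dF/annulus_neq0/zA; rewrite !ltW.
- apply: derivable_within_continuous => t; rewrite in_itv /= => t01.
  by apply: ex_derive; apply: derive_line; apply/dF/annulus_neq0/zA.
move=> t; rewrite in_itv /= => t01; rewrite scale1r scale0r addr0 subr0 mulr1.
have xv : x + v = y by rewrite /v addrC subrK.
rewrite xv !FE// distrC => ->.
have -> : enorm (x - y) = enorm v by rewrite /enorm /v !dotE; congr Num.sqrt; ring.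
apply: derive_le; first exact/dF/annulus_neq0/zA.
by move=> i; apply: le_trans (MP i _ (zA t t01)) (ler_norm _).
Qed.

End C1Sphere.

(** * Completeness of the weighted L2 space *)

Section RieszFischer.
Context {R : realType}.

(** The inequality of Cauchy and Schwarz for the telescoping sum; the factor in
    front is the sum of the numbers [2 ^- k]. *)
Lemma telescope_sqr_le (v : nat -> R) n :
  (v n - v 0%N) ^+ 2 <=
  (2 - 2 * (2 ^+ n)^-1) * \sum_(k < n) 2 ^+ k * (v k.+1 - v k) ^+ 2.
Proof.
elim: n => [|n ih]; first by rewrite big_ord0 mulr0 subrr expr0n.
rewrite big_ord_recr /=; set S := \sum_(k < n) _ in ih *.
set a := v n - v 0%N in ih; set b := v n.+1 - v n.
have -> : v n.+1 - v 0%N = a + b by rewrite /a /b; ring.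
set q : R := (2 ^+ n)^-1; have p0 : 0 < (2 : R) ^+ n by rewrite exprn_gt0.
have q0 : 0 < q by rewrite invr_gt0.
have pq : 2 ^+ n = q^-1 :> R by rewrite invrK.
have -> : (2 ^+ n.+1)^-1 = q / 2 :> R by rewrite exprS invfM mulrC.
have q1 : q <= 1 by rewrite invf_le1// exprn_ege1// ler1n.
have S0 : 0 <= S by apply: sumr_ge0 => k _; rewrite mulr_ge0 ?sqr_ge0// exprn_ge0.
rewrite -/q in ih; rewrite pq.
(* Since al * S >= a^2 and q * B = b^2, (a + b)^2 <= (al + q) (S + B). *)
pose al := 2 - 2 * q; pose B := q^-1 * b ^+ 2.
have al0 : 0 <= al by rewrite /al; lra.
have B0 : 0 <= B by rewrite mulr_ge0 ?sqr_ge0// invr_ge0 ltW.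
have bB : b ^+ 2 = q * B by rewrite /B mulrA divff ?mul1r// gt_eqF.
have -> : 2 - 2 * (q / 2) = al + q by rewrite /al; field.
have cross : 2 * (a * b) <= al * B + q * S.
  have p1 : 0 <= al * B + q * S by exact: (addr_ge0 (mulr_ge0 al0 B0) (mulr_ge0 (ltW q0) S0)).
  have [ab|/ltW ab] := leP (a * b) 0.
    by lra.
  have ab2 : 0 <= 2 * (a * b) by rewrite mulr_ge0.
  rewrite -(@ler_pXn2r _ 2)//.
  have : (a * b) ^+ 2 <= (al * S) * (q * B).
    by rewrite exprMn bB ler_wpM2r// mulr_ge0 ?(ltW q0).
  have := sqr_ge0 (al * B - q * S).
  have -> : (2 * (a * b)) ^+ 2 = 4 * (a * b) ^+ 2 by ring.
  have -> : (al * B + q * S) ^+ 2 = (al * B - q * S) ^+ 2 + 4 * ((al * S) * (q * B)) by ring.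
  by lra.
have -> : (a + b) ^+ 2 = a ^+ 2 + 2 * (a * b) + b ^+ 2 by ring.
rewrite -/B bB; have -> : (al + q) * (S + B) = al * S + (al * B + q * S) + q * B by ring.
by move: ih; rewrite -/al; lra.
Qed.

Lemma geometric_half_le n : \sum_(k < n) (2 ^+ k)^-1 <= 2 :> R.
Proof.
suff -> : \sum_(k < n) (2 ^+ k)^-1 = 2 - 2 * (2 ^+ n)^-1 :> R.
  by rewrite gerBl mulr_ge0// invr_ge0 exprn_ge0.
elim: n => [|n ih]; first by rewrite big_ord0 expr0 invr1; ring.
by rewrite big_ord_recr /= ih exprS invfM; field; rewrite expf_neq0.
Qed.

Lemma weighted_increments_cvg (v : nat -> R) M :
  (forall n, \sum_(k < n) 2 ^+ k * (v k.+1 - v k) ^+ 2 <= M) ->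
  cvgn v /\ (limn v - v 0%N) ^+ 2 <= 2 * M.
Proof.
move=> vM.
have cv : cvgn v.
  suff cs : cvgn (series (telescope v)).
    move: cs; rewrite telescopeK => cs.
    rewrite (_ : v = (fun n => v n - v 0%N) + cst (v 0%N)).
      by apply: is_cvgD cs (is_cvg_cst _).
    by apply/funext => n; rewrite !fctE /= subrK.
  apply: normed_cvg; apply: nondecreasing_is_cvgn.
    apply/nondecreasing_seqP => n; rewrite /= !seriesEnat /= big_nat_recr//= lerDl.
    exact: normr_ge0.
  exists (1 + M / 2) => _ [n _ <-]; rewrite /= seriesEnat /= big_mkord.
  apply: le_trans (_ : \sum_(k < n) (2^-1 * (2 ^+ k)^-1 + 2^-1 * (2 ^+ k * (v k.+1 - v k) ^+ 2)) <= _).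
    apply: ler_sum => k _; rewrite /telescope.
    have p0 : 0 < (2 : R) ^+ k by rewrite exprn_gt0.
    set b := v _ - v _; set p := 2 ^+ k in p0 *.
    rewrite -[X in _ <= _ + _ * (_ * X)]real_normK ?num_real//.
    rewrite -subr_ge0 (_ : _ - _ = (1 - p * `|b|) ^+ 2 / (2 * p)); last first.
      by field; rewrite gt_eqF.
    by rewrite divr_ge0 ?sqr_ge0// mulr_ge0// ltW.
  rewrite big_split -!mulr_sumr /=.
  by have := geometric_half_le n; have := vM n; lra.
split => //.
have M0 : 0 <= M by have := vM 0%N; rewrite big_ord0.
have cl : (v n - v 0%N) ^+ 2 @[n --> \oo] --> (limn v - v 0%N) ^+ 2.
  rewrite expr2; apply: cvgM; apply: cvgB => //; exact: cvg_cst.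
rewrite -(cvg_lim (@norm_hausdorff _ _) cl).
apply: limr_le; first by apply: cvgP cl.
apply: nearW => n; apply: le_trans (telescope_sqr_le v n) _.
have := vM n; set S := \sum_(k < n) _ => hS.
have S0 : 0 <= S by apply: sumr_ge0 => k _; rewrite mulr_ge0 ?sqr_ge0// exprn_ge0.
apply: ler_pM => //; last first.
  by rewrite gerBl mulr_ge0// invr_ge0 exprn_ge0.
have : (2 ^+ n)^-1 <= 1 :> R by rewrite invf_le1 ?exprn_gt0// exprn_ege1// ler1n.
by lra.
Qed.

Context {d : nat}.
Variable sigma : {measure set (rV_borel R d) -> \bar R}.
Local Notation bm := bounded_measurable.
Local Notation S := (sphere R d : set (rV_borel R d)).

Variable h : 'rV[R]_d -> R.
Hypothesis bh : bm (fun x => h x ^+ 2).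
Implicit Types (f g : 'rV[R]_d -> R).

Local Notation L2 := (in_L2 sigma h).
Local Notation "''[' f , g ]" := (inner sigma h f g).

Lemma inner_EFin f : L2 f ->
  (\int[sigma]_(x in S) (f x * f x * h x ^+ 2)%:E = ('[f, f])%:E)%E.
Proof.
move=> lf; rewrite /inner /weighted_int /Rintegral fineK//.
by apply: integrable_fin_num; [exact: measurable_sphere|exact: (integrable_L2 bh lf lf)].
Qed.

(** The limit is a pointwise limit superior, so that it is measurable without
    further choices. Where the sum of the squared increments, weighted by
    powers of 2, is finite, it is a limit and [weighted_increments_cvg] bounds
    the error; elsewhere that bound is infinite. *)
Lemma riesz_fischer (u : nat -> 'rV[R]_d -> R) : (forall k, L2 (u k)) ->
  (forall k, '[fun x => u k.+1 x - u k x, fun x => u k.+1 x - u k x] <= (4 ^+ k)^-1) ->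
  exists2 g, L2 g & forall k,
    '[fun x => g x - u k x, fun x => g x - u k x] <= 4 / 4 ^+ k.
Proof.
move=> lu du; have mS := @measurable_sphere R d.
pose g x := fine (limn_esup (fun k => (u k x)%:E)).
have mg : measurable_fun S (g : rV_borel R d -> R).
  apply: measurableT_comp; first exact: fine_measurable.
  apply: measurable_fun_limn_esup => k; apply/measurable_EFinP.
  exact: measurable_L2 (lu k).
pose inc K k x := u (k + K).+1 x - u (k + K)%N x.
have linc K k : L2 (inc K k) by exact: L2B (lu _) (lu _).
pose F K (k : nat) (x : rV_borel R d) : \bar R :=
  ((2 * 2 ^+ k) * (inc K k x * inc K k x * h x ^+ 2))%:E.
have F0 K k x : (0 <= F K k x)%E.
  have inc0 : 0 <= inc K k x * inc K k x * h x ^+ 2.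
    by apply: mulr_ge0; rewrite -?expr2 sqr_ge0.
  by rewrite lee_fin; apply: mulr_ge0 => //; rewrite mulr_ge0 ?exprn_ge0.
have mF K k : measurable_fun S (F K k).
  apply/measurable_EFinP; apply: measurable_funM => //.
  have /integrableP[+ _] := integrable_L2 bh (linc K k) (linc K k).
  by move=> /measurable_EFinP.
have IF K k : (\int[sigma]_(x in S) F K k x <= (2 * (4 ^+ K)^-1 * (2 ^+ k)^-1)%:E)%E.
  have -> : (\int[sigma]_(x in S) F K k x = ((2 * 2 ^+ k) * '[inc K k, inc K k])%:E)%E.
    rewrite EFinM -inner_EFin// -integralZl//; exact: (integrable_L2 bh (linc K k) (linc K k)).
  rewrite lee_fin.
  have -> : 2 * (4 ^+ K)^-1 * (2 ^+ k)^-1 = 2 * 2 ^+ k * (4 ^+ (k + K))^-1 :> R.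
    have -> : (4 : R) = 2 * 2 by ring.
    by rewrite exprD !exprMn; field; rewrite !expf_neq0.
  by rewrite ler_wpM2l ?mulr_ge0 ?exprn_ge0//; exact: du.
have pointwise K x : (((g x - u K x) * (g x - u K x) * h x ^+ 2)%:E <= \sum_(k <oo) F K k x)%E.
  have [h0|h0] := eqVneq (h x ^+ 2) 0.
    by rewrite h0 mulr0; apply: nneseries_ge0 => k _ _; exact: F0.
  have hp : 0 < h x ^+ 2 by rewrite lt_def h0 sqr_ge0.
  have G0 : (0 <= \sum_(k <oo) F K k x)%E by apply: nneseries_ge0 => k _ _; exact: F0.
  have [Gfin|] := boolP (\sum_(k <oo) F K k x \is a fin_num)%E; last first.
    by rewrite ge0_fin_numE// -leNgt leye_eq => /eqP ->; rewrite leey.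
  pose M := fine (\sum_(k <oo) F K k x)%E.
  pose v k := u (k + K)%N x.
  have vM n : \sum_(k < n) 2 ^+ k * (v k.+1 - v k) ^+ 2 <= M / (2 * h x ^+ 2).
    have h2 : 0 < 2 * h x ^+ 2 by rewrite mulr_gt0.
    rewrite ler_pdivlMr//.
    suff : ((\sum_(k < n) 2 ^+ k * (v k.+1 - v k) ^+ 2 * (2 * h x ^+ 2))%:E <= M%:E)%E.
      by rewrite lee_fin mulr_suml.
    rewrite /M fineK//.
    apply: le_trans (@nneseries_lim_ge R (fun k => F K k x) xpredT 0 n _); last first.
      by move=> k _ _; exact: F0.
    rewrite big_mkord /F sumEFin lee_fin le_eqVlt; apply/orP; left; apply/eqP.
    by apply: eq_bigr => k _; rewrite /v /inc addSn; ring.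
  have [cv lv] := weighted_increments_cvg vM.
  have cu : u k x @[k --> \oo] --> limn v.
    by rewrite -(cvg_shiftn K).
  have -> : g x = limn v.
    have cE : (fun k => (u k x)%:E) @ \oo --> (limn v)%:E.
      by apply: cvg_EFin => //; exact: nearW.
    rewrite /g is_cvg_limn_esupE; last by apply: cvgP cE.
    by rewrite (cvg_lim _ cE).
  rewrite -(fineK Gfin) lee_fin -/M -expr2.
  have -> : u K x = v 0%N by [].
  apply: le_trans (ler_wpM2r (ltW hp) lv) _.
  rewrite le_eqVlt; apply/orP; left; apply/eqP; field.
  by move: h0; rewrite sqrf_eq0.
have key K : (\int[sigma]_(x in S) ((g x - u K x) * (g x - u K x) * h x ^+ 2)%:E <= (4 / 4 ^+ K)%:E)%E.
  apply: le_trans (_ : (\int[sigma]_(x in S) (\sum_(k <oo) F K k x) <= _)%E).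
    apply: ge0_le_integral => //.
    - by move=> x _; rewrite lee_fin; apply: mulr_ge0; rewrite -?expr2 sqr_ge0.
    - apply/measurable_EFinP; apply: measurable_funM; last by case: bh.
      by apply: measurable_funM; apply: measurable_funB => //; exact: measurable_L2 (lu K).
    - by apply: ge0_emeasurable_sum => // k x _ _; exact: F0.
  rewrite integral_nneseries//.
  apply: lime_le.
    by apply: is_cvg_nneseries => k _ _; apply: integral_ge0 => x _; exact: F0.
  apply: nearW => n; rewrite big_mkord.
  apply: (@le_trans _ _ (\sum_(k < n) (2 * (4 ^+ K)^-1 * (2 ^+ k)^-1)%:E)%E).
    by apply: lee_sum => k _; exact: IF.
  rewrite sumEFin lee_fin -mulr_sumr.
  have -> : 4 / 4 ^+ K = 2 * (4 ^+ K)^-1 * 2 :> R by ring.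
  rewrite ler_wpM2l ?geometric_half_le// mulr_ge0// invr_ge0 exprn_ge0//.
have ld K : L2 (fun x => g x - u K x).
  split; first by apply: measurable_funB => //; exact: measurable_L2 (lu K).
  apply: le_lt_trans (le_lt_trans (key K) (ltry _)).
  rewrite le_eqVlt; apply/orP; left; apply/eqP; apply: eq_integral => x _.
  by rewrite -expr2 real_normK ?num_real.
exists g.
  have := L2D bh (ld 0%N) (lu 0%N); apply: (eq_L2 (f := fun x => g x - u 0%N x + u 0%N x)).
  by move=> x _; rewrite subrK.
by move=> k; have := key k; rewrite inner_EFin// lee_fin.
Qed.

End RieszFischer.

(** * The energy of a Lipschitz polynomial *)

Section LipschitzEnergy.
Context {R : realType} {d : nat}.
Implicit Types (x u : 'rV[R]_d) (p : mpoly d R) (i j : 'I_d).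

Lemma sin_le (t : R) : 0 <= t -> `|sin t| <= t.
Proof.
move=> t0; have := @is_derive_mvt R sin cos 1 t (fun s => is_derive_sin s) _ t0.
rewrite sin0 subr0 mul1r; apply => s.
by rewrite ler_norml cos_geN1 cos_le1.
Qed.

Lemma enorm_rot_le i j t x : i != j -> 0 <= t -> sphere R d x ->
  enorm (x - rot i j t x) <= t.
Proof.
move=> ij t0 /sphereE x1.
have e : dot (x - rot i j t x) (x - rot i j t x) =
    (2 * sin (t / 2)) ^+ 2 * (x 0 i ^+ 2 + x 0 j ^+ 2).
  rewrite !dotDl !dotNl !dotBr dot_rot// x1 (dotC _ x).
  have -> : dot x (rot i j t x) = 1 + (cos t - 1) * (x 0 i ^+ 2 + x 0 j ^+ 2).
    by rewrite /rot !dotDr !dotZr x1 !dot_deltar; ring.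
  have -> : cos t = 1 - 2 * sin (t / 2) ^+ 2.
    have {1}-> : t = t / 2 + t / 2 by field.
    have c2 : cos (t / 2) ^+ 2 = 1 - sin (t / 2) ^+ 2 by have := cos2Dsin2 (t / 2); lra.
    by rewrite cosD -!expr2 c2; ring.
  by ring.
rewrite -(@ler_pXn2r _ 2)// ?nnegrE ?enorm_ge0// enorm_sqr e.
have t2 : 0 <= t / 2 by rewrite divr_ge0.
have h1 : (2 * sin (t / 2)) ^+ 2 <= t ^+ 2.
  rewrite -[(2 * _) ^+ 2]real_normK ?num_real// normrM ger0_norm//.
  rewrite ler_pXn2r ?nnegrE ?mulr_ge0//.
  by have := sin_le t2; lra.
have h2 : x 0 i ^+ 2 + x 0 j ^+ 2 <= 1.
  rewrite -x1 /dot (bigD1 i)//= (bigD1 j) 1?eq_sym//= -!expr2 addrA lerDl.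
  by rewrite sumr_ge0// => k _; rewrite -expr2 sqr_ge0.
rewrite -[leRHS]mulr1 ler_pM ?sqr_ge0// addr_ge0 ?sqr_ge0//.
Qed.

(** A rotation by the angle [t] moves a point of the sphere by at most [t]. *)
Lemma rot_deriv_lipschitz l i j p x : 0 <= l -> sphere_lipschitz l (ev p) -> sphere R d x ->
  ev (rot_deriv i j p) x ^+ 2 <= l ^+ 2.
Proof.
move=> l0 pl Sx; have [<-|ij] := eqVneq i j.
  by rewrite rot_deriv_id ev0 expr0n sqr_ge0.
have := rot_differentiable_ev p ij x 0; rewrite rot0 => dp.
have /is_derive_cvg_quotient := dp; rewrite rot0.
set v := fun k : nat => _ => cv.
have nv (k : nat) : v k ^+ 2 <= l ^+ 2.
  rewrite /v; set t : R := k.+1%:R^-1.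
  have t0 : 0 <= t by rewrite invr_ge0.
  have Sr : sphere R d (rot i j t x).
    by rewrite -mul_rot_mx; exact: (sphere_orthogonal x (orthogonal_rot t ij)).2.
  have h : `|ev p (rot i j t x) - ev p x| <= l * t.
    rewrite distrC; apply: le_trans (pl _ _ Sx Sr) _.
    by rewrite ler_wpM2l// enorm_rot_le.
  rewrite -[leLHS]real_normK ?num_real// ler_pXn2r ?nnegrE// normrM ger0_norm//.
  rewrite -ler_pdivlMl ?ltr0n//.
  by apply: le_trans h _; rewrite /t mulrC.
have cv2 : v k ^+ 2 @[k --> \oo] --> ev (rot_deriv i j p) x ^+ 2.
  by rewrite expr2; apply: cvgM.
rewrite -(cvg_lim (@norm_hausdorff _ _) cv2); apply: limr_le; first by apply: cvgP cv2.
by apply: nearW => k.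
Qed.

Variable sigma : {measure set (rV_borel R d) -> \bar R}.
Hypothesis sigmaP : surface_measure sigma.
Variables (Phi : seq 'rV[R]_d) (kappa : 'rV[R]_d -> R).
Hypothesis Phi_kappa : root_multiplicity Phi kappa.

(** The reflection of [u] moves [x] by [<x, u>] times [u], so that the
    difference quotients are bounded like the derivatives. *)
Lemma energy_lipschitz_le l p : 0 <= l -> sphere_lipschitz l (ev p) ->
  energy sigma Phi kappa p <= weighted_sphere_int sigma Phi kappa
    (fun=> 2^-1 * (\sum_(i < d) \sum_(j < d) l ^+ 2) + 2^-1 * (\sum_(u <- Phi) kappa u * (2 * l ^+ 2))).
Proof.
move=> l0 pl; apply: (le_weighted_sphere_int sigmaP Phi_kappa); [exact: bm_ev|exact: bm_cst|].
move=> x Sx; have w0 := root_weight_ge0 Phi kappa x.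
rewrite ev_energy_density !mulrDl; apply: lerD.
  rewrite ler_wpM2r// ler_wpM2l// ?invr_ge0//.
  apply: ler_sum => i _; apply: ler_sum => j _.
  by rewrite -expr2; exact: rot_deriv_lipschitz.
rewrite !mulr_sumr !mulr_suml !big_seq; apply: ler_sum => u uPhi.
have u2 := roots_norm Phi_kappa uPhi.
have [_ _ rp _] := dunkl_quotP p u2.
have [s0|s0] := eqVneq (dot x u) 0.
  have kw := root_weight_wall kappa uPhi s0.
  have e P : 2^-1 * (kappa u * P) * root_weight Phi kappa x =
    2^-1 * P * (kappa u * root_weight Phi kappa x) by ring.
  by rewrite !e kw !mulr0.
rewrite ler_wpM2r// ler_wpM2l ?invr_ge0// ler_wpM2l ?(multiplicity_ge0 Phi_kappa)//.
have Sr := (sphere_reflection Phi_kappa x uPhi).2 Sx.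
have := pl _ _ Sx Sr; rewrite rp => h.
have s2 : 0 < dot x u ^+ 2 by rewrite lt_def sqrf_eq0 s0 sqr_ge0.
have {}h : (dot x u * ev (dunkl_quot u p).1 x) ^+ 2 <= (l * enorm (x - reflection u x)) ^+ 2.
  by rewrite -[leLHS]real_normK ?num_real// ler_pXn2r ?nnegrE ?mulr_ge0 ?enorm_ge0.
move: h; rewrite !exprMn enorm_sqr.
have -> : dot (x - reflection u x) (x - reflection u x) = 2 * dot x u ^+ 2.
  by rewrite /reflection opprB addrCA subrr addr0 u2 dotZl dotZr u2; field.
by rewrite -expr2 => h; rewrite -(ler_pM2l s2); apply: le_trans h _; lra.
Qed.

End LipschitzEnergy.

(** * The square root of the Dunkl-Laplace-Beltrami operator *)

Section SquareRootLaplacian.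
Context {R : realType} {d : nat}.
Variable sigma : {measure set (rV_borel R d) -> \bar R}.
Hypothesis sigmaP : surface_measure sigma.
Hypothesis d2 : (2 <= d)%N.
Local Notation bm := bounded_measurable.

Variables (Phi : seq 'rV[R]_d) (kappa : 'rV[R]_d -> R).
Hypothesis Phi_kappa : root_multiplicity Phi kappa.
Variable h : 'rV[R]_d -> R.
Hypothesis hP : forall x, h x ^+ 2 = root_weight Phi kappa x.
Variable lambda : R.
Let K := \sum_(u <- Phi) kappa u.
Hypothesis lambdaP : 2 * lambda = d%:R - 2 + K.
Implicit Types (f g : 'rV[R]_d -> R) (p q y z : mpoly d R) (n : nat).

Local Notation W := (weighted_sphere_int sigma Phi kappa).
Local Notation L2 := (in_L2 sigma h).
Local Notation "''[' f , g ]" := (inner sigma h f g).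
Local Notation energy := (energy sigma Phi kappa).
Local Notation mu := (@dunkl_eigenvalue R d Phi kappa).
Local Notation harmonic := (harmonic sigma h).

Let bh : bm (fun x => h x ^+ 2).
Proof. by apply: (eq_bm _ (bm_root_weight Phi_kappa)) => x _; rewrite hP. Qed.

Let l2 p : L2 (ev p) := L2_ev sigmaP bh p.

Let d2R : (2 : R) <= d%:R.
Proof. by rewrite (ler_nat R 2). Qed.

Let K0 : 0 <= K := sum_multiplicity_ge0 Phi_kappa.

Lemma eigenvalue_ge0 n : 0 <= mu n.
Proof. by rewrite mulr_ge0// addr_ge0// addr_ge0// subr_ge0. Qed.

Lemma eigenvalue_ge1 n : (0 < n)%N -> 1 <= mu n.
Proof.
move=> n0; have n1 : 1 <= n%:R :> R by rewrite ler1n.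
rewrite -[X in X <= _](mulr1 1); apply: ler_pM => //.
by rewrite -/K; have := d2R; have := K0; lra.
Qed.

(** The harmonic parts that the square root of the operator must have. *)
Definition sqrt_scaled (ys : nat -> mpoly d R) n : mpoly d R := Num.sqrt (mu n) *: ys n.

Lemma harmonic_scale n c y : harmonic n y -> harmonic n (c *: y).
Proof.
move=> [sy yn]; split; first by rewrite msize_scale.
move=> z hz; rewrite (@eq_inner _ _ _ _ _ (fun x => c * ev y x) _ (ev z))//.
  by rewrite (innerZl bh)// yn// mulr0.
by move=> x _; rewrite evZ.
Qed.

Lemma inner_sqrt_scaled ys n : '[ev (sqrt_scaled ys n), ev (sqrt_scaled ys n)] = mu n * '[ev (ys n), ev (ys n)].
Proof.
rewrite /sqrt_scaled; set c := Num.sqrt _.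
have l := L2Z bh c (l2 (ys n)).
rewrite (@eq_inner _ _ _ _ _ (fun x => c * ev (ys n) x) _ (fun x => c * ev (ys n) x)); last 2 first.
- by move=> x _; rewrite evZ.
- by move=> x _; rewrite evZ.
by rewrite (innerZl bh c (l2 _) l) (innerZr bh c (l2 _) (l2 _)) mulrA -expr2 sqr_sqrtr// eigenvalue_ge0.
Qed.

Section ProjectionFamily.
Variables (f : 'rV[R]_d -> R) (l : R) (ys : nat -> mpoly d R).
Hypotheses (bf : bm f) (l0 : 0 <= l) (fl : sphere_lipschitz l f).
Hypothesis hys : forall n, harmonic n (ys n).
Hypothesis fys : forall n z, harmonic n z -> '[fun x => f x - ev (ys n) x, ev z] = 0.

Let lf : L2 f := L2_bm sigmaP bh bf.

Lemma inner_approx_le p e (q : mpoly d R) : 0 <= e ->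
  (forall x, sphere R d x -> `|f x - ev p x| <= e) ->
  `|'[f, ev q] - '[ev p, ev q]| <= e * W (fun x => `|ev q x|).
Proof.
move=> e0 fp; have bp := bm_ev p; have bq := bm_ev q.
rewrite -(innerBl bh lf (l2 p) (l2 q)) (innerE _ hP).
have bD := bmM (bmB bf bp) bq.
have bA := bm_norm bq.
apply: le_trans (le_normr_Rintegral _ _) _; [exact: measurable_sphere|exact: bm_integrable (bm_weighted Phi_kappa bD)|].
rewrite -(weighted_sphere_intZ sigmaP Phi_kappa e bA).
apply: (le_sphere_int sigmaP (bm_norm (bm_weighted Phi_kappa bD)) (bm_weighted Phi_kappa (bmZ e bA))) => x Sx.
rewrite normrM (ger0_norm (root_weight_ge0 _ _ _)) ler_wpM2r ?root_weight_ge0//.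
by rewrite normrM ler_wpM2r// fp.
Qed.

Lemma le_of_forall_le_add (a b c : R) : (forall e, 0 < e -> a <= b + e * c) -> a <= b.
Proof.
move=> H; have [c0|c0] := leP c 0.
  by apply: le_trans (H 1 ltr01) _; rewrite mul1r gerDl.
rewrite leNgt; apply/negP => ba.
have := H ((a - b) / 2 / c) _; rewrite divfK ?gt_eqF// => /(_ _).
rewrite divr_gt0 ?divr_gt0 ?subr_gt0//; move=> /(_ isT); lra.
Qed.

(** Lipschitz polynomials close to [f] have uniformly bounded energies, and
    Bessel's inequality for the energy survives the limit. *)
Lemma spectral_energy_bounded : exists C, forall n,
  \sum_(k < n) mu k * '[ev (ys k), ev (ys k)] <= C.
Proof.
exists (W (fun=> 2^-1 * (\sum_(i < d) \sum_(j < d) (2 * l) ^+ 2) +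
   2^-1 * (\sum_(u <- Phi) kappa u * (2 * (2 * l) ^+ 2)))) => n.
set C := W _.
apply: (@le_of_forall_le_add _ _ (2 * \sum_(k < n) mu k * W (fun x => `|ev (ys k) x|))) => e e0.
have [p [pl fp]] := lipschitz_approximation sigmaP d2 l0 bf fl e0.
have l20 : 0 <= 2 * l by rewrite mulr_ge0.
have Ep := energy_lipschitz_le sigmaP Phi_kappa l20 pl; rewrite -/C in Ep.
have := energy_bessel sigmaP Phi_kappa hP hys p n.
set s1 := \sum_(k < n) mu k * '[ev p, _]; set s2 := \sum_(k < n) mu k * _.
set s3 := \sum_(k < n) mu k * _ => hb.
have : s2 - s1 <= e * s3.
  rewrite /s1 /s2 /s3 -sumrB mulr_sumr; apply: ler_sum => k _.
  rewrite -mulrBr mulrCA ler_wpM2l ?eigenvalue_ge0//.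
  apply: le_trans (inner_approx_le (ys k) (ltW e0) fp).
  rewrite (inner_proj_harmonic sigmaP Phi_kappa hP hys lf fys); exact: ler_norm.
by lra.
Qed.

(** Polynomials are dense, and the partial sums are the best approximations by
    polynomials. *)
Lemma partial_sum_cvg e : 0 < e -> exists n, forall m, (n <= m)%N ->
  '[fun x => f x - ev (partial_sum ys m) x, fun x => f x - ev (partial_sum ys m) x] <= e.
Proof.
move=> e0; pose V := W (fun=> 1).
have V0 : 0 <= V by apply: weighted_sphere_int_ge0.
pose e' := Num.sqrt (e / (V + 1)).
have V1 : 0 < V + 1 by rewrite ltr_wpDl.
have e'0 : 0 < e' by rewrite sqrtr_gt0 divr_gt0.
have [p [_ fp]] := lipschitz_approximation sigmaP d2 l0 bf fl e'0.
exists (msize p) => m pm.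
apply: le_trans (partial_sum_best sigmaP Phi_kappa hP hys lf fys pm) _.
rewrite (innerE _ hP); have bD := bmB bf (bm_ev p).
apply: le_trans (_ : W (fun=> e' ^+ 2) <= _).
  apply: (le_weighted_sphere_int sigmaP Phi_kappa (bmM bD bD) (bm_cst _)) => x Sx.
  rewrite ler_wpM2r ?root_weight_ge0// -expr2 -[leLHS]real_normK ?num_real//.
  by rewrite ler_pXn2r ?nnegrE ?(ltW e'0)// fp.
have -> : W (fun=> e' ^+ 2) = e' ^+ 2 * V.
  by rewrite -(weighted_sphere_intZ sigmaP Phi_kappa _ (bm_cst 1)); apply: eq_weighted_sphere_int => x _; rewrite mulr1.
rewrite sqr_sqrtr ?divr_ge0 ?(ltW e0) ?(ltW V1)// mulrAC ler_pdivrMr//.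
by rewrite ler_wpM2l ?(ltW e0)// lerDl.
Qed.

Local Notation zs := (sqrt_scaled ys).

Lemma inner_zs_partial_sum (n m : nat) : (n <= m)%N ->
  '[ev (partial_sum zs m), ev (partial_sum zs n)] =
  '[ev (partial_sum zs n), ev (partial_sum zs n)].
Proof.
move=> nm; have hzs k : harmonic k (zs k) by exact: harmonic_scale.
rewrite !(inner_partial_sum sigmaP Phi_kappa hP) //; try exact: l2.
apply: eq_bigr => k _.
rewrite !(inner_partial_sum_harmonic sigmaP Phi_kappa hP hzs)//.
exact: leq_trans nm.
Qed.

(** The squared norms of the partial sums of the scaled family increase and are
    bounded. A rapidly Cauchy subsequence thus has a limit, and the projections
    of the limit are those of its partial sums. *)
Lemma sqrt_laplace_ex : exists g, is_sqrt_laplace sigma h lambda f g.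
Proof.
have hzs k : harmonic k (zs k) by exact: harmonic_scale.
have [C sC] := spectral_energy_bounded.
pose s n := '[ev (partial_sum zs n), ev (partial_sum zs n)].
have sE n : s n = \sum_(k < n) mu k * '[ev (ys k), ev (ys k)].
  rewrite /s (partial_sum_sqr sigmaP Phi_kappa hP hzs).
  by apply: eq_bigr => k _; rewrite inner_sqrt_scaled.
have s_nd n m : (n <= m)%N -> s n <= s m.
  move=> nm; rewrite !sE -!(big_mkord xpredT (fun k => mu k * '[ev (ys k), ev (ys k)])).
  rewrite (big_cat_nat (leq0n n) nm)//= lerDl big_nat sumr_ge0// => k _.
  by rewrite mulr_ge0 ?eigenvalue_ge0 ?inner_ge0.
have ub : has_sup (range s).
  by split; [exists (s 0%N), 0%N|exists C => _ [n _ <-]; rewrite sE].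
pose A := sup (range s).
have sA n : s n <= A by apply: sup_upper_bound => //; exists n.
have /choice[nu nuP] : forall k : nat, exists n, A - s n <= (4 ^+ k)^-1.
  move=> k; have e0 : 0 < (4 ^+ k)^-1 :> R by rewrite invr_gt0 exprn_gt0.
  have [_ [n _ <-] hn] := sup_adherent e0 ub.
  by exists n; move: hn; rewrite -/A; lra.
(* The maximum makes the indices increase, and adding [k] makes them tend to
   infinity. *)
pose N k := (\max_(j < k.+1) nu j + k)%N.
have N_nu k : (nu k <= N k)%N.
  by apply: leq_trans (leq_addr _ _); exact: (leq_bigmax_cond (F := fun j : 'I_k.+1 => nu j) ord_max).
have N_mono k : (N k <= N k.+1)%N.
  rewrite /N addnS; apply: leqW; rewrite leq_add2r [X in (_ <= X)%N]big_ord_recr /=.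
  exact: leq_maxl.
pose u k := ev (partial_sum zs (N k)).
have [|g lg gu] := riesz_fischer bh (fun k => l2 (partial_sum zs (N k))).
  move=> k; rewrite (inner_sqrB bh (l2 _) (l2 _)) inner_zs_partial_sum// -!/(s _).
  have := nuP k; have := s_nd _ _ (N_nu k); have := sA (N k.+1); lra.
exists g; split => // n.
have lam : n%:R * (n%:R + 2 * lambda) = mu n by rewrite lambdaP.
exists (ev (ys n)).
  apply/is_projP; exists (ys n); first by split.
  exact: fys.
rewrite lam; apply/is_projP; exists (zs n).
  by split => // x _; rewrite evZ.
move=> z hz; have lz := l2 z.
have lgz : L2 (fun x => g x - ev (zs n) x) by exact: L2B.
(* The inner product with a harmonic of degree [n] does not distinguish the
   partial sums of length greater than [n]. *)
have key k : (n < N k)%N -> '[fun x => g x - ev (zs n) x, ev z] ^+ 2 <= 4 / 4 ^+ k * '[ev z, ev z].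
  move=> nN.
  have -> : '[fun x => g x - ev (zs n) x, ev z] = '[fun x => g x - u k x, ev z].
    rewrite (innerBl bh lg (l2 _) lz) (innerBl bh lg (l2 _) lz); congr (_ - _).
    rewrite [RHS]innerC (inner_partial_sum sigmaP Phi_kappa hP) //.
    rewrite (bigD1 (Ordinal nN))//= big1 ?addr0; first by rewrite innerC.
    move=> j jn; apply: (harmonic_orth hz (hzs _)).
    by apply: contraNneq jn => e; apply/eqP/val_inj.
  apply: le_trans (inner_cauchy_schwarz bh (L2B bh lg (l2 _)) lz) _.
  by rewrite ler_wpM2r ?inner_ge0//; exact: gu.
apply/eqP; rewrite -sqrf_eq0 eq_le sqr_ge0 andbT.
set X := _ ^+ 2 in key *; set Y := '[ev z, ev z] in key.
have Y0 : 0 <= Y by exact: inner_ge0.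
have keyk (k : nat) : (n < k)%N -> X * k%:R <= 4 * Y.
  move=> nk; have p4 : 0 < (4 : R) ^+ k by rewrite exprn_gt0.
  have := key k (leq_trans nk (leq_addl _ _)).
  rewrite mulrAC ler_pdivlMr// => hX; apply: le_trans hX.
  rewrite ler_wpM2l ?sqr_ge0//.
  by rewrite -natrX ler_nat ltnW// ltn_expl.
rewrite leNgt; apply/negP => X0.
pose k := maxn n.+1 (Num.truncn (4 * Y / X)).+1.
have := keyk k (leq_maxl _ _); rewrite leNgt => /negP; apply.
rewrite [X * _]mulrC -ltr_pdivrMr//; apply: lt_le_trans (truncnS_gt _) _.
by rewrite ler_nat leq_maxr.
Qed.

Hypothesis f0 : '[f, fun=> 1] = 0.
Hypothesis f1 : '[f, f] = 1.
Variable g : 'rV[R]_d -> R.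
Hypothesis lg : L2 g.
Hypothesis gzs : forall n z, harmonic n z -> '[fun x => g x - ev (zs n) x, ev z] = 0.

Lemma spectral_energy_le n :
  \sum_(k < n) mu k * '[ev (ys k), ev (ys k)] <= '[g, g].
Proof.
have hzs k : harmonic k (zs k) by exact: harmonic_scale.
rewrite (pythagoras sigmaP Phi_kappa hP hzs lg gzs n).
rewrite (eq_bigr (fun k : 'I_n => '[ev (zs k), ev (zs k)])); last by move=> k _; rewrite inner_sqrt_scaled.
by rewrite lerDl inner_ge0.
Qed.

Lemma inner_ys0 : '[ev (ys 0), ev (ys 0)] = 0.
Proof.
have /msize1_polyC e := (hys 0).1.
rewrite -(inner_proj_harmonic sigmaP Phi_kappa hP hys lf fys).
set c := mcoeff _ _ in e.
rewrite (@eq_inner _ _ _ _ f f _ (fun x => c * 1))//.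
  by rewrite (innerZr bh c (L2_bm sigmaP bh (bm_cst 1)) lf) f0 mulr0.
by move=> x _; rewrite e /ev mevalC mulr1.
Qed.

(** The constant part of [f] vanishes, and all other eigenvalues are at least
    1. *)
Lemma spectral_gap : 1 <= '[g, g].
Proof.
apply: (@le_of_forall_le_add _ _ 1) => e e0; rewrite mulr1.
have [n /(_ n.+1 (leqnSn _)) hn] := partial_sum_cvg e0.
have := spectral_energy_le n.+1.
have := pythagoras sigmaP Phi_kappa hP hys lf fys n.+1; rewrite f1.
rewrite !big_ord_recl /= inner_ys0 mulr0 !add0r => e1.
have : \sum_(i < n) '[ev (ys (lift ord0 i)), ev (ys (lift ord0 i))] <=
  \sum_(i < n) mu (lift ord0 i) * '[ev (ys (lift ord0 i)), ev (ys (lift ord0 i))].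
  apply: ler_sum => i _; rewrite ler_peMl ?inner_ge0//.
  exact: eigenvalue_ge1.
by lra.
Qed.

(** The weight [1 - <x, y>] lies between 0 and 2. *)
Lemma dispersion_le p (y : 'rV[R]_d) : sphere R d y ->
  dispersion sigma Phi kappa (ev p) y <= 2 * dispersion sigma Phi kappa f y +
    4 * '[fun x => f x - ev p x, fun x => f x - ev p x].
Proof.
move=> Sy; rewrite (innerE _ hP) /dispersion.
have bD := bmB bf (bm_ev p); have b1 := bmB (bm_cst 1) (bm_dot y).
have bF := bmM b1 (bmX 2 bf).
rewrite -(weighted_sphere_intZ sigmaP Phi_kappa 2 bF) -(weighted_sphere_intZ sigmaP Phi_kappa 4 (bmM bD bD)).
rewrite -(weighted_sphere_intD sigmaP Phi_kappa (bmZ 2 bF) (bmZ 4 (bmM bD bD))).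
apply: (le_weighted_sphere_int sigmaP Phi_kappa (bmM b1 (bmX 2 (bm_ev p))) (bmD (bmZ 2 bF) (bmZ 4 (bmM bD bD)))) => x Sx.
rewrite ler_wpM2r ?root_weight_ge0//.
have := dot_sphere_le Sx Sy; rewrite ler_norml => /andP[c0 c1].
set c := 1 - dot x y; set a := f x; set b := ev p x.
have cc0 : 0 <= c by rewrite subr_ge0.
have h1 : c * b ^+ 2 <= c * (2 * a ^+ 2 + 2 * (a - b) ^+ 2).
  rewrite ler_wpM2l//; have := sqr_ge0 (2 * a - b); nra.
apply: le_trans h1 _; rewrite mulrDr mulrCA lerD2l -expr2.
have -> : 4 * (a - b) ^+ 2 = 2 * (2 * (a - b) ^+ 2) by ring.
by rewrite ler_wpM2r ?(mulr_ge0 (ler0n _ 2) (sqr_ge0 _))// /c; lra.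
Qed.

Let B := 2 + 2 * K * (2 * K + 3) ^+ 2.

Let B2 : 2 <= B.
Proof. by rewrite lerDl (mulr_ge0 (mulr_ge0 (ler0n _ 2) K0) (sqr_ge0 _)). Qed.

(** The inequality of [heisenberg] for the partial sums of the expansion of
    [f], whose energies are at most the squared norm of [g], in the limit. *)
Lemma uncertainty_linear (y : 'rV[R]_d) tau : sphere R d y -> 0 < tau ->
  2^-1 <= 2 * (d%:R - 1 + K) * dispersion sigma Phi kappa f y + tau * '[g, g] +
    2 * B * (dispersion sigma Phi kappa f y / tau).
Proof.
move=> Sy tau0; set D := dispersion _ _ _ _ _.
apply: (@le_of_forall_le_add _ _ (2^-1 + 4 * (d%:R - 1 + K) + 4 * B / tau)) => e e0.
have [n /(_ n (leqnn _)) hn] := partial_sum_cvg e0.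
have := heisenberg sigmaP Phi_kappa (partial_sum ys n) d2 Sy tau0.
rewrite -/K -/B (energy_partial_sum sigmaP Phi_kappa hP hys).
have := dispersion_le (partial_sum ys n) Sy; rewrite -/D.
set Dn := dispersion _ _ _ _ _; set En := \sum_(k < n) _.
have -> : W (fun x => ev (partial_sum ys n) x ^+ 2) = '[ev (partial_sum ys n), ev (partial_sum ys n)].
  by rewrite (innerE _ hP); apply: eq_weighted_sphere_int => x _; rewrite expr2.
rewrite (partial_sum_sqr sigmaP Phi_kappa hP hys).
have := pythagoras sigmaP Phi_kappa hP hys lf fys n; rewrite f1.
set S := \sum_(k < n) '[ev (ys k), _]; set del := '[_, _] in hn *.
move=> S1 Dle hb.
have B0 : 0 <= B := le_trans (ler0n _ 2) B2.
have A0 : 0 <= d%:R - 1 + K by rewrite addr_ge0//; have := d2R; lra.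
have E1 : tau * En <= tau * '[g, g] by rewrite ler_wpM2l ?(ltW tau0)// spectral_energy_le.
have Dn2 : Dn <= 2 * D + 4 * e by apply: le_trans Dle _; lra.
have h1 : (d%:R - 1 + K) * Dn <= (d%:R - 1 + K) * (2 * D + 4 * e) by rewrite ler_wpM2l.
have h2 : B * (Dn / tau) <= B * ((2 * D + 4 * e) / tau).
  by rewrite ler_wpM2l// ler_wpM2r// invr_ge0 ltW.
have -> : 2 * (d%:R - 1 + K) * D + tau * '[g, g] + 2 * B * (D / tau) +
  e * (2^-1 + 4 * (d%:R - 1 + K) + 4 * B / tau) = 2^-1 * e +
   (d%:R - 1 + K) * (2 * D + 4 * e) + tau * '[g, g] + B * ((2 * D + 4 * e) / tau) by ring.
by lra.
Qed.

(** If the dispersion is not small, then [spectral_gap] suffices. Otherwise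
    [uncertainty_linear] is applied with a [tau] for which the energy term
    takes a quarter of the available mass 1 / 2, and the dispersion at most
    another half. *)
Lemma uncertainty (y : 'rV[R]_d) : sphere R d y ->
  (8 * (d%:R - 1 + K) + 128 * B)^-1 <= dispersion sigma Phi kappa f y * '[g, g].
Proof.
move=> Sy; set D := dispersion _ _ _ _ _; set G := '[g, g].
have G1 : 1 <= G := spectral_gap.
have G0 : 0 < G by lra.
pose A := d%:R - 1 + K; rewrite -/A.
have A1 : 1 <= A by rewrite /A; have := d2R; have := K0; lra.
have BB := B2.
have D0 : 0 <= D.
  apply: weighted_sphere_int_ge0 => x Sx; rewrite mulr_ge0 ?sqr_ge0// subr_ge0.
  by have := dot_sphere_le Sx Sy; rewrite ler_norml => /andP[].
have M0 : 0 < 8 * A + 128 * B by lra.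
have [far|near] := leP (8 * A)^-1 D.
  apply: le_trans (_ : (8 * A)^-1 <= _).
    by rewrite lef_pV2 ?posrE//; lra.
  by apply: le_trans far _; rewrite ler_peMr.
pose tau := (8 * G)^-1.
have tau0 : 0 < tau by rewrite invr_gt0 mulr_gt0.
have := uncertainty_linear Sy tau0; rewrite -/A -/D -/G.
have -> : tau * G = 8^-1 by rewrite /tau; field; rewrite gt_eqF.
have -> : 2 * B * (D / tau) = 16 * (B * (D * G)) by rewrite /tau invrK; ring.
have h1 : 2 * A * D <= 4^-1.
  have : D * (8 * A) <= 1 by rewrite -ler_pdivlMr ?mul1r ?(ltW near)//; lra.
  by lra.
move=> h2; have h3 : 128^-1 <= B * (D * G) by lra.
rewrite -(ler_pM2l (_ : 0 < B)); last by lra.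
apply: le_trans h3; rewrite ler_pdivrMr// mulrC -ler_pdivrMr ?invr_gt0// invrK.
by lra.
Qed.

End ProjectionFamily.

End SquareRootLaplacian.

(** * Positive roots, the minimizing point, and the theorem *)

Section PositiveRoots.
Context {R : realType} {d : nat}.
Variables (G : set 'M[R]_d) (Phi : {fset 'rV[R]_d}) (kappa : 'rV[R]_d -> R).
Hypothesis GPhi : reflection_group G Phi.
Hypothesis Phi2 : forall v, v \in Phi -> dot v v = 2.
Hypothesis kappaP : multiplicity G Phi kappa.
Implicit Types u v x : 'rV[R]_d.

Lemma reflection_group_root_multiplicity : root_multiplicity Phi kappa.
Proof.
have [_ [_ closed _] GP _] := GPhi; have [kappa_ge0 kappaG] := kappaP.
split; [exact: fset_uniq|exact: Phi2| |exact: kappa_ge0|] => u v uPhi vPhi.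
  exact: closed.
rewrite -mul_reflection_mx kappaG//.
apply/GP; last by exists v.
by rewrite -dot_eq0 Phi2// pnatr_eq0.
Qed.

Let Phi_kappa := reflection_group_root_multiplicity.

Lemma root_opp v : v \in Phi -> - v \in Phi /\ kappa (- v) = kappa v.
Proof.
move=> vPhi; have <- : reflection v v = - v.
  by rewrite /reflection Phi2// mulfK ?pnatr_eq0// scaler_nat mulr2n opprD addrA subrr add0r.
split; first exact: (roots_reflection Phi_kappa).
exact: (multiplicity_reflection Phi_kappa).
Qed.

Variable Rp : {fset 'rV[R]_d}.
Hypothesis RpP : positive_subsystem Phi Rp.

Lemma perm_positive_roots : perm_eq Phi (Rp ++ [seq - v | v <- Rp]).
Proof.
have [u [u0 RpE]] := RpP.
have oppE v : (v \in [seq - w | w <- Rp]) = (v \in Phi) && (dot u v < 0).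
  rewrite -[v in LHS]opprK (mem_map (@oppr_inj _)) RpE dotNr oppr_gt0.
  case: (boolP (v \in Phi)) => [/root_opp[-> //]|] vPhi.
  by rewrite [X in X && _](contraNF _ vPhi)// => /root_opp[]; rewrite opprK.
apply: uniq_perm; first exact: fset_uniq.
  rewrite cat_uniq fset_uniq (map_inj_uniq (@oppr_inj _)) fset_uniq andbT /=.
  apply/hasPn => v; rewrite oppE => /andP[_ uv].
  by rewrite /= RpE negb_and -leNgt (ltW uv) orbT.
move=> v; rewrite mem_cat oppE RpE -andb_orr.
case: (boolP (v \in Phi)) => //= /u0.
by rewrite neq_lt orbC => ->.
Qed.

Lemma kappa_opp v : v \in Rp -> kappa (- v) = kappa v.
Proof. by have [u [_ ->]] := RpP => /andP[/root_opp[]]. Qed.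

Lemma sqr_weight x : weight Rp kappa x ^+ 2 = root_weight Phi kappa x.
Proof.
rewrite /root_weight (perm_big _ perm_positive_roots)/= big_cat big_map/= expr2.
congr (_ * _); rewrite /weight !big_seq; apply: eq_bigr => v vRp.
by rewrite dotNr normrN kappa_opp.
Qed.

Lemma lambda_kappaE :
  2 * lambda_kappa Rp kappa = d%:R - 2 + \sum_(u <- Phi) kappa u.
Proof.
rewrite (perm_big _ perm_positive_roots)/= big_cat big_map/=.
have -> : \sum_(v <- Rp) kappa (- v) = \sum_(v <- Rp) kappa v.
  by rewrite !big_seq; apply: eq_bigr => v; exact: kappa_opp.
by rewrite /lambda_kappa; field.
Qed.

End PositiveRoots.

Section DispersionMinimum.
Context {R : realType} {d : nat}.
Variable sigma : {measure set (rV_borel R d) -> \bar R}.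
Hypothesis sigmaP : surface_measure sigma.
Variables (Phi : seq 'rV[R]_d) (kappa : 'rV[R]_d -> R).
Hypothesis Phi_kappa : root_multiplicity Phi kappa.
Variable f : 'rV[R]_d -> R.
Hypothesis bf : bounded_measurable f.
Implicit Types x y : 'rV[R]_d.
Local Notation W := (weighted_sphere_int sigma Phi kappa).

Lemma sphere_nonempty : exists x, sphere R d x.
Proof.
have := sigma_gt0 sigmaP; have [-> |/set0P//] := eqVneq (sphere R d) set0.
by rewrite measure0 ltxx.
Qed.

(** By [dispersionE] the dispersion is an affine function of [y] whose linear
    part is the negative of this vector, so that it is least in the direction
    of the vector. *)
Definition mass_moment : 'rV[R]_d := \row_i W (fun x => x 0 i * f x ^+ 2).

Lemma dispersionE y :
  dispersion sigma Phi kappa f y = W (fun x => f x ^+ 2) - dot mass_moment y.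
Proof.
have b2 := bmX 2 bf; have bm1 i : bounded_measurable (fun x => y 0 i * (x 0 i * f x ^+ 2)).
  exact: bmZ _ (bmM (bm_coord i) b2).
have -> : dot mass_moment y = W (fun x => \sum_(i < d) y 0 i * (x 0 i * f x ^+ 2)).
  rewrite (weighted_sphere_int_sum sigmaP Phi_kappa _ bm1); apply: eq_bigr => i _.
  by rewrite mxE mulrC (weighted_sphere_intZ sigmaP Phi_kappa _ (bmM (bm_coord i) b2)).
rewrite -[X in _ - X]mul1r -mulNr -(weighted_sphere_intZ sigmaP Phi_kappa _ (bm_sum _ bm1)).
rewrite -(weighted_sphere_intD sigmaP Phi_kappa b2 (bmZ _ (bm_sum _ bm1))).
apply: eq_weighted_sphere_int => x _; rewrite mulN1r mulrBl mul1r; congr (_ - _).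
by rewrite /dot mulr_suml; apply: eq_bigr => i _; rewrite mulrA [y 0 i * _]mulrC.
Qed.

Lemma dispersion_minimum :
  exists2 y, sphere R d y &
    forall z, sphere R d z -> dispersion sigma Phi kappa f y <= dispersion sigma Phi kappa f z.
Proof.
have [y0 Sy0] := sphere_nonempty.
have [b0|b0] := eqVneq mass_moment 0.
  by exists y0 => // z _; rewrite !dispersionE b0 -(scale0r 0) !dotZl !mul0r.
pose n := enorm mass_moment; have n2 : n ^+ 2 = dot mass_moment mass_moment by exact: enorm_sqr.
have n0 : 0 < n by rewrite /n lt_neqAle enorm_ge0 andbT eq_sym -sqrf_eq0 n2 dot_eq0.
exists (n^-1 *: mass_moment).
  apply/sphereE; rewrite dotZl dotZr -n2; field; exact: lt0r_neq0.
move=> z /sphereE z1; rewrite !dispersionE lerD2l lerN2 dotZr -n2 expr2 mulKf ?lt0r_neq0//.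
have := dot_cauchy_schwarz mass_moment z; rewrite z1 mulr1 -n2.
by move=> h; apply: le_trans (ler_norm _) _; rewrite -(ler_pXn2r (_ : (0 < 2)%N)) ?nnegrE ?(ltW n0)// real_normK ?num_real.
Qed.

End DispersionMinimum.

Theorem theorem1p1 (R : realType) (d : nat) (G : set 'M[R]_d)
    (Phi : {fset 'rV[R]_d}) (kappa : 'rV[R]_d -> R) :
  (2 <= d)%N ->
  reflection_group G Phi ->
  (forall v, v \in Phi -> dot v v = 2) ->
  multiplicity G Phi kappa ->
  exists2 C : R, 0 < C &
    forall (Rp : {fset 'rV[R]_d}) (sigma : {measure set (rV_borel R d) -> \bar R})
      (f : 'rV[R]_d -> R),
    positive_subsystem Phi Rp ->
    surface_measure sigma ->
    C1_sphere f ->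
    weighted_int sigma (weight Rp kappa) f = 0 ->
    weighted_int sigma (weight Rp kappa) (fun x => `|f x| ^+ 2) = 1 ->
    exists2 m : R,
      is_minimum (sphere R d)
        (fun y => weighted_int sigma (weight Rp kappa)
                    (fun x => (1 - dot x y) * `|f x| ^+ 2)) m &
      C <= m * weighted_int sigma (weight Rp kappa)
                 (fun x => `|sqrt_laplace sigma (weight Rp kappa)
                               (lambda_kappa Rp kappa) f x| ^+ 2).
Proof.
move=> d2 GPhi Phi2 kappaP.
have Phi_kappa := reflection_group_root_multiplicity GPhi Phi2 kappaP.
pose K := \sum_(u <- Phi) kappa u; have K0 : 0 <= K by exact: sum_multiplicity_ge0 Phi_kappa.
have d2R : (2 : R) <= d%:R by rewrite (ler_nat R 2).
pose B := 2 + 2 * K * (2 * K + 3) ^+ 2.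
have B0 : 0 <= B.
  by rewrite (addr_ge0 (ler0n _ 2) (mulr_ge0 (mulr_ge0 (ler0n _ 2) K0) (sqr_ge0 _))).
exists (8 * (d%:R - 1 + K) + 128 * B)^-1; first by rewrite invr_gt0; lra.
move=> Rp sigma f RpP sigmaP Cf f0 f1.
set h := weight Rp kappa in f0 f1 *; set lambda := lambda_kappa Rp kappa.
have hP x : h x ^+ 2 = root_weight Phi kappa x := sqr_weight GPhi Phi2 kappaP RpP x.
have lambdaP : 2 * lambda = d%:R - 2 + K := lambda_kappaE GPhi Phi2 kappaP RpP.
have [bf [l l0 fl]] := C1_sphere_lipschitz Cf.
have bh : bounded_measurable (fun x => h x ^+ 2).
  by apply: (eq_bm _ (bm_root_weight Phi_kappa)) => x _; rewrite hP.
have lf : in_L2 sigma h f := L2_bm sigmaP bh bf.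
have normE : weighted_int sigma h (fun x => `|f x| ^+ 2) = inner sigma h f f.
  by apply: eq_Rintegral => x _; rewrite real_normK ?num_real// expr2.
(* The square root is a chosen function, and the choice is governed by the
   projections only if a function with these projections exists. *)
have sqrt_laplaceP : is_sqrt_laplace sigma h lambda f (sqrt_laplace sigma h lambda f).
  have /choice[ys ysP] : forall n : nat, exists y, harmonic sigma h n y /\
      forall z, harmonic sigma h n z -> inner sigma h (fun x => f x - ev y x) (ev z) = 0.
    by move=> n; have [y] := proj_harmonic_ex sigmaP Phi_kappa hP n lf; exists y.
  have [g gP] := sqrt_laplace_ex sigmaP d2 Phi_kappa hP lambdaP bf l0 fl
    (fun n => (ysP n).1) (fun n => (ysP n).2).
  by apply: xgetPex; exists g.
set g := sqrt_laplace _ _ _ _ in sqrt_laplaceP *; have [lg gP] := sqrt_laplaceP.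
have /choice[ys ysP] : forall n : nat, exists y, [/\ harmonic sigma h n y,
    forall z, harmonic sigma h n z -> inner sigma h (fun x => f x - ev y x) (ev z) = 0 &
    forall z, harmonic sigma h n z ->
      inner sigma h (fun x => g x - ev (Num.sqrt (dunkl_eigenvalue Phi kappa n) *: y) x) (ev z) = 0].
  move=> n; have [Y /is_projP[y [hy Yy] fy] [_ gY]] := gP n.
  exists y; split=> // z hz.
  rewrite -(gY (ev z)); last by apply/h_harmonicP; exists z.
  by apply: eq_inner => // x Sx; rewrite evZ Yy// lambdaP.
have [y Sy ymin] := dispersion_minimum sigmaP Phi_kappa bf.
have dispE z : weighted_int sigma h (fun x => (1 - dot x z) * `|f x| ^+ 2) =
    dispersion sigma Phi kappa f z.
  rewrite (weighted_intE _ hP); apply: eq_weighted_sphere_int => x _.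
  by rewrite real_normK ?num_real.
exists (dispersion sigma Phi kappa f y).
  split; first by exists y.
  by move=> z Sz; rewrite dispE ymin.
have -> : weighted_int sigma h (fun x => `|g x| ^+ 2) = inner sigma h g g.
  by apply: eq_Rintegral => x _; rewrite real_normK ?num_real// expr2.
apply: (uncertainty sigmaP d2 Phi_kappa hP bf l0 fl (ys := ys)) => //.
- by move=> n; have [] := ysP n.
- by move=> n; have [] := ysP n.
- by rewrite -f0; apply: eq_Rintegral => x _; rewrite mulr1.
- by rewrite -normE.
- by move=> n; have [] := ysP n.
Qed.
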